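(* Let $\kappa$ be a consistent (positive definite) kernel on $\mathbf X$, $g:\mathbf X\to(0,\infty)$ continuous, $a=(a_i)_{i\in I}$ with all $a_i>0$, and $\mathcal A=(A_i)_{i\in I}$ an $(m,p)$-condenser with $0<\mathrm{cap}\,\mathcal A<\infty$, where $\mathrm{cap}\,\mathcal A:=\mathrm{cap}\,(\mathcal A,a,g)$. Assume that either $I^-=\varnothing$, or both $\inf_{x\in A}g(x)>0$ and $\sup_{x\in A^+,\,y\in A^-}\kappa(x,y)<\infty$. Let $\nu\in\mathcal E(\overline{\mathcal A})$ and $\tau_i\in\mathbb R$, $i\in I$, satisfy the relations $$\alpha_ia_i\kappa(x,\nu)\geqslant\tau_i\,g(x)\ \text{ n.e. in }A_i,\ i\in I,\qquad \sum_{i\in I}\tau_i=\frac{\mathrm{cap}\,\mathcal A+\|\nu\|^2}{2\,\mathrm{cap}\,\mathcal A}.$$ Then $\nu$ is equivalent in $\mathcal E(\overline{\mathcal A})$ to every $\gamma_{\mathcal A}\in\mathcal D(\mathcal A,a,g)$, and for all $i\in I$, $$\tau_i=C_i(\mathcal A,a,g)=''\!\inf_{x\in A_i}\!''\,\frac{\alpha_ia_i\kappa(x,\nu)}{g(x)},$$ where $\mathcal D(\mathcal A,a,g)$ is the set of interior capacitary distributions and $C_i(\mathcal A,a,g)$ are the interior capacitary constants associated with $\mathcal A$.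
   Context: $\mathbf X$ is a locally compact Hausdorff space; $\mathfrak M$ is the space of all real-valued (signed) Radon measures on $\mathbf X$ with the vague topology (pointwise convergence on continuous real functions with compact support). A kernel is a lower semicontinuous $\kappa:\mathbf X\times\mathbf X\to(-\infty,\infty]$, assumed $\geqslant0$ unless $\mathbf X$ is compact. Write $\kappa(\nu,\nu_1)=\int\kappa\,d(\nu\otimes\nu_1)$ (mutual energy; energy if $\nu_1=\nu$) and $\kappa(x,\nu)=\int\kappa(x,y)\,d\nu(y)$ (potential) whenever well defined. $\mathcal E$ is the set of $\nu\in\mathfrak M$ with finite energy. $\kappa$ is positive definite: symmetric with $\kappa(\nu,\nu)\geqslant0$ whenever defined; then $\mathcal E$ is a pre-Hilbert space with scalar product $\kappa(\nu,\nu_1)$ and seminorm $\|\nu\|=\kappa(\nu,\nu)^{1/2}$, defining the strong topology. A nonnegative measure is concentrated on $E\subset\mathbf X$ if $\mathbf X\setminus E$ is locally negligible for it; $\mathfrak M^+(E)$ is the set of such measures, $\mathcal E^+(E)=\mathfrak M^+(E)\cap\mathcal E$, $\mathcal E^+=\mathcal E^+(\mathbf X)$. $\kappa$ is consistent if every strong Cauchy net in $\mathcal E^+$ converges strongly to each of its vague cluster points. Interior capacity of a set: $C(E)=1/\inf\{\|\nu\|^2:\nu\in\mathcal E^+(E),\ \nu(\mathbf X)=1\}$. A relation holds n.e. (nearly everywhere) in $E$ if the set of $x\in E$ where it fails has interior capacity zero; for $\nu\in\mathcal E$ the potential $\kappa(\cdot,\nu)$ is defined and finite n.e. in $\mathbf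 X$. If $C(E)>0$, $''\!\inf_{x\in E}\!''f(x):=\sup\{q:f(x)\geqslant q\text{ n.e. in }E\}$. Conventions: $\inf\varnothing=+\infty$, $1/0=+\infty$, $1/(+\infty)=0$. Fix integers $m\geqslant1$, $p\geqslant0$; $I=\{1,\dots,m+p\}$, $I^+=\{1,\dots,m\}$, $I^-=I\setminus I^+$; $\alpha_i=+1$ for $i\in I^+$, $\alpha_i=-1$ for $i\in I^-$. An $(m,p)$-condenser is an ordered collection $\mathcal A=(A_i)_{i\in I}$ of nonempty subsets of $\mathbf X$ with $\overline{A_i}\cap\overline{A_j}=\varnothing$ for all $i\in I^+$, $j\in I^-$; it is compact if all $A_i$ are; $\overline{\mathcal A}=(\overline{A_i})_{i\in I}$ is again a condenser; $\mathcal A'\prec\mathcal A$ means $A_i'\subset A_i$ for all $i$. $A=\bigcup_{i\in I}A_i$, $A^+=\bigcup_{i\in I^+}A_i$, $A^-=\bigcup_{i\in I^-}A_i$. $\mathfrak M(\mathcal A)$ is the set of formal combinations $\mu=\sum_{i\in I}\alpha_i\mu^i$ with $\mu^i\in\mathfrak M^+(A_i)$, identified with tuples $(\mu^i)_{i\in I}$; $R\mu\in\mathfrak M$ is the signed measure $\sum_i\alpha_i\mu^i$; potentials and (mutual) energies of $\mu$ are those of $R\mu$, e.g. $\kappa(x,\mu)=\kappa(x,R\mu)$. $\mathcal E(\mathcal A)$ is the set of $\mu\in\mathfrak M(\mathcal A)$ with finite energy $\|\mu\|^2:=\kappa(\mu,\mu)$, a semimetric space with semimetric $\|\mu_1-\mu_2\|:=\|R\mu_1-R\mu_2\|$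 (its topology is called strong); $\mu_1,\mu_2$ are equivalent in $\mathcal E(\mathcal A)$ if $\|\mu_1-\mu_2\|=0$. $\mathcal A$-vague convergence in $\mathfrak M(\overline{\mathcal A})$ is vague convergence of each $i$-coordinate. $\mathcal E(\mathcal A,a,g)=\{\mu\in\mathcal E(\mathcal A):\int g\,d\mu^i=a_i\ \forall i\}$. For a set $\mathcal H$ in $\mathcal E$ or $\mathcal E(\mathcal A)$, $\|\mathcal H\|^2:=\inf_{\nu\in\mathcal H}\|\nu\|^2$. $\mathrm{cap}\,(\mathcal A,a,g):=1/\|\mathcal E(\mathcal A,a,g)\|^2$. For a number $c>0$, $ac=(a_ic)_{i\in I}$. $\mathcal S(\mathcal A,a,g)$ is the set of all $\lambda\in\mathcal E(\mathcal A,a,g)$ with $\|\lambda\|^2=\|\mathcal E(\mathcal A,a,g)\|^2$. $\hat\Gamma(\mathcal A,a,g)$ is the class of all $\nu\in\mathcal E$ for which there exist real $c_i(\nu)$, $i\in I$, with (1) $\alpha_ia_i\kappa(x,\nu)\geqslant c_i(\nu)g(x)$ n.e. in $A_i$ for all $i\in I$ and (2) $\sum_{i\in I}c_i(\nu)\geqslant1$. Under the stated assumptions there is $\hat\omega\in\hat\Gamma(\mathcal A,a,g)$ with $\|\hat\omega\|^2=\|\hat\Gamma(\mathcal A,a,g)\|^2$, and the numbers $c_i(\hat\omega)$ satisfying (1) and (2) for $\nu=\hat\omega$ are unique and independent of the choice of such $\hat\omega$; they are the interior capacitary constants $C_i(\mathcal A,a,g):=c_i(\hat\omega)$. $\{\mathcal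 K\}_{\mathcal A}$ is the family, directed upward by $\prec$, of all compact condensers $\mathcal K\prec\mathcal A$ (only those with $\mathrm{cap}\,\mathcal K:=\mathrm{cap}\,(\mathcal K,a,g)>0$ are considered). $\gamma\in\mathcal E(\overline{\mathcal A})$ is an interior capacitary distribution associated with $\mathcal A$ if there exist a subnet $(\mathcal K_s)_{s\in S}$ of $(\mathcal K)_{\mathcal K\in\{\mathcal K\}_{\mathcal A}}$ and $\lambda_{\mathcal K_s}\in\mathcal S(\mathcal K_s,a\,\mathrm{cap}\,\mathcal K_s,g)$ such that $(\lambda_{\mathcal K_s})_{s\in S}$ converges to $\gamma$ both $\mathcal A$-vaguely and strongly; $\mathcal D(\mathcal A,a,g)$ is the collection of all such $\gamma$. *)

(* Defs.v *)
(* MathComp-Analysis has neither signed Radon measures of infinite variation nor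
   the Riesz representation theorem, so Radon measures are functionals on
   C_c(X), and integrals of lower semicontinuous functions, (local)
   negligibility and products are those of Bourbaki's Integration. *)
From HB Require Import structures.
From mathcomp Require Import all_boot all_order all_algebra.
From mathcomp Require Import all_classical all_reals all_analysis.

Set Implicit Arguments.
Unset Strict Implicit.
Unset Printing Implicit Defensive.

Import Order.TTheory GRing.Theory Num.Theory.
Import numFieldNormedType.Exports.

Local Open Scope classical_set_scope.
Local Open Scope ring_scope.

Section Cc.
Context (R : realType) (X : topologicalType).

(* In a Hausdorff space this is compactness of the closure of the support. *)
Definition is_Cc : {pred X -> R} :=
  mem [set f : X -> R | continuous f /\
    exists2 K : set X, compact K & forall x, ~ K x -> f x = 0].

Record Cc := MkCc { Cc_fun :> X -> R ; CcP : Cc_fun \in is_Cc }.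

HB.instance Definition _ := [isSub for Cc_fun].
HB.instance Definition _ := [Choice of Cc by <:].

Lemma is_Cc_submod_closed : submod_closed is_Cc.
Proof.
split.
  apply/mem_set; split; first by move=> x; exact: cvg_cst.
  by exists set0 => //; exact: compact0.
move=> a f g /set_mem[cf [Kf kKf Kf0]] /set_mem[cg [Kg kKg Kg0]].
apply/mem_set; split.
  move=> x; apply: cvgD; last exact: cg.
  by apply: cvgM; [exact: cvg_cst|exact: cf].
exists (Kf `|` Kg); first exact: compactU.
move=> x /not_orP[/Kf0 fx0 /Kg0 gx0].
by rewrite !fctE fx0 gx0 scaler0 addr0.
Qed.

HB.instance Definition _ :=
  GRing.isSubmodClosed.Build _ _ is_Cc is_Cc_submod_closed.
HB.instance Definition _ := [SubChoice_isSubLmodule of Cc by <:].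

(* A linear functional that is continuous in the sup norm on the functions
   supported in any given compact set. *)
Definition is_radon : {pred Cc -> R} :=
  mem [set mu : Cc -> R |
    (forall (a : R) (f g : Cc), mu (a *: f + g) = a * mu f + mu g) /\
    (forall K : set X, compact K -> exists M : R, forall (f : Cc) (c : R),
       (forall x, ~ K x -> f x = 0) -> (forall x, `|f x| <= c) ->
       `|mu f| <= M * c)].

Record radon := MkRadon { radon_fun :> Cc -> R ; radonP : radon_fun \in is_radon }.

HB.instance Definition _ := [isSub for radon_fun].
HB.instance Definition _ := [Choice of radon by <:].

Lemma is_radon_submod_closed : submod_closed is_radon.
Proof.
split.
  apply/mem_set; split; first by by move=> a f g; change ((0 : R) = a * 0 + 0); rewrite mulr0 addr0.
  by move=> K _; exists 0 => f c _ _; change (`|0 : R| <= 0 * c); rewrite normr0 mul0r.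
move=> b mu nu /set_mem[lmu bmu] /set_mem[lnu bnu]; apply/mem_set; split.
  move=> a f g; rewrite !fctE lmu lnu /GRing.scale/= !mulrDr !mulrA.
  by rewrite (mulrC b a) addrACA.
move=> K kK; have [M HM] := bmu K kK; have [N HN] := bnu K kK.
exists (`|b| * M + N) => f c f0 fc; rewrite !fctE (le_trans (ler_normD _ _))//.
rewrite mulrDl lerD ?HN// normrM -mulrA ler_wpM2l//; exact: HM.
Qed.

HB.instance Definition _ :=
  GRing.isSubmodClosed.Build _ _ is_radon is_radon_submod_closed.
HB.instance Definition _ := [SubChoice_isSubLmodule of radon by <:].

(* the vague topology *)
HB.instance Definition _ := Topological.copy radon
  (initial_topology (fun mu : radon => (mu : Cc -> R) : {ptws Cc -> R})).


Lemma radon_linear (mu : radon) (a : R) (f g : Cc) :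
  mu (a *: f + g) = a * mu f + mu g.
Proof. by case: mu => mu /= /set_mem[]. Qed.

Lemma radon0 (mu : radon) : mu 0 = 0.
Proof.
have := radon_linear mu 1 0 0; rewrite scaler0 addr0 mul1r.
by move/eqP; rewrite -subr_eq0 opprD addNKr oppr_eq0 => /eqP.
Qed.

Lemma radonD (mu : radon) (f g : Cc) : mu (f + g) = mu f + mu g.
Proof. by rewrite -[f]scale1r radon_linear mul1r scale1r. Qed.

Lemma radonZ (mu : radon) (a : R) (f : Cc) : mu (a *: f) = a * mu f.
Proof. by rewrite -[a *: f]addr0 radon_linear radon0 addr0. Qed.

Lemma radonB (mu : radon) (f g : Cc) : mu (f - g) = mu f - mu g.
Proof. by rewrite radonD -scaleN1r radonZ mulN1r. Qed.

Lemma radon_bounded (mu : radon) (K : set X) : compact K ->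
  exists M : R, forall (f : Cc) (c : R),
    (forall x, ~ K x -> f x = 0) -> (forall x, `|f x| <= c) ->
    `|mu f| <= M * c.
Proof. by case: mu => mu /= /set_mem[_]; apply. Qed.

Lemma Cc_bounded (f : Cc) : exists K : set X, exists c : R,
  [/\ compact K, forall x, ~ K x -> f x = 0 & forall x, `|f x| <= c].
Proof.
case: f => f /= /set_mem[cf [K kK f0]]; exists K.
have /compact_bounded[M [_ HM]] : compact (f @` K).
  by apply: continuous_compact => //; apply: continuous_subspaceT.
exists (`|M| + 1); split => // x; have [Kx|nKx] := pselect (K x).
  by apply: (HM (`|M| + 1)); [rewrite (le_lt_trans (ler_norm M))// ltrDl|exists x].
by rewrite f0// normr0 addr_ge0.
Qed.

Lemma Cc_minP (f g : Cc) : (fun x => Num.min (f x) (g x)) \in is_Cc.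
Proof.
case: f g => f /= /set_mem[cf [Kf kKf Kf0]] [g /= /set_mem[cg [Kg kKg Kg0]]].
apply/mem_set; split.
  by move=> x; apply: (@continuous_min _ _ f g); [exact: cf|exact: cg].
exists (Kf `|` Kg); first exact: compactU.
by move=> x /not_orP[/Kf0 -> /Kg0 ->]; rewrite minxx.
Qed.

Definition Cc_min (f g : Cc) := MkCc (Cc_minP f g).

(* mu^+(f) for f >= 0 *)
Definition pos_val (mu : radon) (f : Cc) : R :=
  sup [set mu h | h in [set h : Cc | forall x, 0 <= h x <= Num.max (f x) 0]].

Lemma pos_val_has_sup (mu : radon) (K : set X) (M c : R) (f : Cc) :
  (forall (f : Cc) (c : R),
    (forall x, ~ K x -> f x = 0) -> (forall x, `|f x| <= c) ->
    `|mu f| <= M * c) ->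
  (forall x, ~ K x -> f x = 0) -> (forall x, `|f x| <= c) ->
  has_sup [set mu h | h in [set h : Cc | forall x, 0 <= h x <= Num.max (f x) 0]]
  /\ 0 <= pos_val mu f <= M * c.
Proof.
move=> HM f0 fc.
set S := (X in has_sup X).
have S0 : S 0.
  by exists 0; [move=> x /=; rewrite lexx le_max lexx orbT|rewrite radon0].
have ubS : ubound S (M * c).
  move=> _ [h /= hf <-]; rewrite (le_trans (ler_norm _))//; apply: HM => x.
    move=> nKx; have := hf x; rewrite f0// maxxx -eq_le => /eqP.
    by move=> <-.
  have /andP[h0 hx] := hf x; rewrite ger0_norm// (le_trans hx)// ge_max.
  by rewrite (le_trans (ler_norm _))//= (le_trans (normr_ge0 _) (fc x)).
have supS : has_sup S by split; [exists 0|exists (M * c)].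
split=> //; apply/andP; split; first by apply: ub_le_sup; [exists (M * c)|exists 0; [move=> x /=; rewrite lexx le_max lexx orbT|rewrite radon0]].
by apply: ge_sup => //; exists 0.
Qed.

Lemma pos_val_sup (mu : radon) (f : Cc) :
  has_sup [set mu h | h in [set h : Cc | forall x, 0 <= h x <= Num.max (f x) 0]].
Proof.
have [K [c [kK f0 fc]]] := Cc_bounded f.
have [M HM] := radon_bounded mu kK.
by have [] := pos_val_has_sup HM f0 fc.
Qed.

Lemma pos_val_ge (mu : radon) (f h : Cc) :
  (forall x, 0 <= h x <= f x) -> mu h <= pos_val mu f.
Proof.
move=> hf; have [_ ub] := pos_val_sup mu f; apply: ub_le_sup => //.
by exists h => // x /=; have /andP[-> hx] := hf x; rewrite le_max hx.
Qed.

Lemma pos_val_le (mu : radon) (f : Cc) (r : R) : (forall x, 0 <= f x) ->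
  (forall h : Cc, (forall x, 0 <= h x <= f x) -> mu h <= r) ->
  pos_val mu f <= r.
Proof.
move=> f0 H; have [ne _] := pos_val_sup mu f; apply: ge_sup => // _ [h /= hf <-].
by apply: H => x; have := hf x; rewrite max_l.
Qed.

Lemma pos_valD (mu : radon) (f g : Cc) :
  (forall x, 0 <= f x) -> (forall x, 0 <= g x) ->
  pos_val mu (f + g) = pos_val mu f + pos_val mu g.
Proof.
move=> f0 g0; apply/eqP; rewrite eq_le; apply/andP; split.
  apply: pos_val_le => [x|h hfg]; first exact: addr_ge0.
  rewrite -[h](subrK (Cc_min h f)) addrC radonD lerD//; apply: pos_val_ge => x /=.
    by have /andP[h0 _] := hfg x; rewrite le_min h0 f0 ge_min lexx orbT.
  have /andP[h0] := hfg x; change (h x <= f x + g x -> 0 <= h x - Num.min (h x) (f x) <= g x).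
  move=> hx; rewrite subr_ge0 ge_min lexx/= lerBlDr.
  by case: (leP (h x) (f x)) => _; [rewrite lerDr|rewrite addrC].
rewrite -lerBrDr; apply: pos_val_le => // h hf.
rewrite lerBrDl -lerBrDr; apply: pos_val_le => // k kg.
rewrite lerBrDr -radonD; apply: pos_val_ge => x.
have /andP[h0 hx] := hf x; have /andP[k0 kx] := kg x.
change (0 <= k x + h x <= f x + g x).
by rewrite addr_ge0//= addrC lerD.
Qed.

Lemma pos_valZ (mu : radon) (a : R) (f : Cc) : 0 <= a ->
  (forall x, 0 <= f x) -> pos_val mu (a *: f) = a * pos_val mu f.
Proof.
rewrite le_eqVlt => /predU1P[<- f0|a0 f0].
  rewrite scale0r mul0r; apply/eqP; rewrite eq_le; apply/andP; split.
    apply: pos_val_le => [x|h h0]; first exact: lexx.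
    suff -> : h = 0 by rewrite radon0.
    by apply/val_inj/funext => x; apply/eqP; rewrite eq_le andbC; exact: h0.
  rewrite -[leLHS](radon0 mu); apply: pos_val_ge => x; exact/andP.
have le (b : R) (g : Cc) : 0 < b -> (forall x, 0 <= g x) ->
    b * pos_val mu g <= pos_val mu (b *: g).
  move=> b0 g0; rewrite mulrC -ler_pdivlMr//; apply: pos_val_le => // h hg.
  rewrite ler_pdivlMr// mulrC -radonZ; apply: pos_val_ge => x.
  change (0 <= b * h x <= b * g x); have /andP[h0 hx] := hg x.
  apply/andP; split; first by apply: mulr_ge0 => //; exact: ltW.
  by rewrite ler_pM2l.
apply/eqP; rewrite eq_le le// andbT.
rewrite -ler_pdivrMl// (le_trans (le _ _ _ _))// ?invr_gt0//.
  by move=> x; change (0 <= a * f x); rewrite mulr_ge0// ltW.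
by rewrite scalerA mulVf ?gt_eqF// scale1r.
Qed.

Definition pos_fun (mu : radon) (f : Cc) : R :=
  pos_val mu f - pos_val mu (- f).

Lemma pos_fun_decomp (mu : radon) (u v : Cc) :
  (forall x, 0 <= u x) -> (forall x, 0 <= v x) ->
  pos_fun mu (u - v) = pos_val mu u - pos_val mu v.
Proof.
move=> u0 v0.
pose w := Cc_min u v.
have w0 x : 0 <= w x by rewrite le_min u0 v0.
have uw x : 0 <= (u - w) x.
  by change (0 <= u x - Num.min (u x) (v x)); rewrite subr_ge0 ge_min lexx.
have vw x : 0 <= (v - w) x.
  by change (0 <= v x - Num.min (u x) (v x)); rewrite subr_ge0 ge_min lexx orbT.
have E (f g : Cc) : (forall x, Num.max (f x) 0 = g x) -> pos_val mu f = pos_val mu g.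
  move=> fg; rewrite /pos_val; congr (sup (_ @` _)); apply/seteqP.
  have gg x : Num.max (g x) 0 = g x by rewrite -fg -maxA maxxx.
  by split=> h /= H x; have := H x; rewrite gg fg.
have -> : pos_val mu u = pos_val mu (u - w) + pos_val mu w.
  by rewrite -pos_valD// subrK.
have -> : pos_val mu v = pos_val mu (v - w) + pos_val mu w.
  by rewrite -pos_valD// subrK.
rewrite [in RHS]opprD [in RHS]addrACA subrr addr0 /pos_fun; congr (_ - _); apply: E => x.
  change (Num.max (u x - v x) 0 = u x - Num.min (u x) (v x)).
  case: (leP (u x) (v x)) => [uv|vu]; first by rewrite subrr max_r// subr_le0.
  by rewrite max_l// subr_ge0 ltW.
change (Num.max (- (u x - v x)) 0 = v x - Num.min (u x) (v x)).
rewrite opprB; case: (leP (u x) (v x)) => [uv|vu]; first by rewrite max_l// subr_ge0.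
by rewrite subrr max_r// subr_le0 ltW.
Qed.

Lemma Cc_split (f : Cc) : exists u : Cc, exists v : Cc,
  [/\ f = u - v, forall x, 0 <= u x & forall x, 0 <= v x].
Proof.
exists (f - Cc_min f 0), (- Cc_min f 0); split.
- by rewrite opprK subrK.
- move=> x; change (0 <= f x - Num.min (f x) 0).
  by rewrite subr_ge0 ge_min lexx.
- move=> x; change (0 <= - Num.min (f x) 0).
  by rewrite oppr_ge0 ge_min lexx orbT.
Qed.

Lemma pos_funP (mu : radon) : pos_fun mu \in is_radon.
Proof.
apply/mem_set; split.
  have P0 (u : Cc) : (forall x, 0 <= u x) -> forall a, 0 <= a ->
      forall x, 0 <= (a *: u : Cc) x.
    by move=> u0 a a0 x; change (0 <= a * u x); rewrite mulr_ge0.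
  have PD (u v : Cc) : (forall x, 0 <= u x) -> (forall x, 0 <= v x) ->
      forall x, 0 <= (u + v : Cc) x by move=> u0 v0 x; exact: addr_ge0.
  move=> a f g; have [u [v [-> u0 v0]]] := Cc_split f.
  have [s [t [-> s0 t0]]] := Cc_split g; rewrite !pos_fun_decomp//.
  have [a0|/ltW a0] := leP 0 a.
    have -> : a *: (u - v) + (s - t) = (a *: u + s) - (a *: v + t).
      by rewrite scalerBr addrACA opprD.
    rewrite pos_fun_decomp; [|by apply: PD => //; exact: P0..].
    rewrite !pos_valD//; [|exact: P0..]; rewrite !pos_valZ//.
    by rewrite mulrBr opprD addrACA.
  rewrite -oppr_ge0 in a0.
  have -> : a *: (u - v) + (s - t) = (- a *: v + s) - (- a *: u + t).
    by rewrite scalerBr !scaleNr opprD opprK [RHS]addrC [RHS]addrACA [- t + _]addrC.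
  rewrite pos_fun_decomp; [|by apply: PD => //; exact: P0..].
  rewrite !pos_valD//; [|exact: P0..]; rewrite !pos_valZ//.
  by rewrite mulrBr !mulNr !opprD !opprK [in RHS](addrC (a * _)) addrACA.
move=> K kK; have [M HM] := radon_bounded mu kK; exists M => f c f0 fc.
have [_ /andP[p0 p1]] := pos_val_has_sup HM f0 fc.
have [||_ /andP[n0 n1]] := @pos_val_has_sup mu K M c (- f) HM.
- by move=> x nKx; change (- f x = 0); rewrite f0// oppr0.
- by move=> x; change (`|- f x| <= c); rewrite normrN.
rewrite /pos_fun ler_norml lerNl opprB !lerBlDr; apply/andP; split.
  by rewrite (le_trans n1)// lerDl.
by rewrite (le_trans p1)// lerDl.
Qed.

(* Riesz: mu^+ = sup (mu, 0), and mu^- = (- mu)^+ *)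
Definition radon_pos (mu : radon) : radon := MkRadon (pos_funP mu).
Definition radon_neg (mu : radon) : radon := radon_pos (- mu).

End Cc.

Section tensor.
Context (R : realType) (X Y : topologicalType).

Lemma Cc_sliceP (F : Cc R (X * Y)%type) (x : X) :
  (fun y => F (x, y)) \in @is_Cc R _.
Proof.
case: F => F /= /set_mem[cF [K kK F0]]; apply/mem_set; split.
  move=> y; apply: (@cvg_comp _ _ _ (fun y => (x, y)) F (nbhs y)); last exact: cF.
  by apply: cvg_pair; [exact: cvg_cst|exact: cvg_id].
exists (snd @` K).
  by apply: continuous_compact => //; apply: continuous_subspaceT => z; exact: cvg_snd.
by move=> y nKy; apply: F0 => Kxy; apply: nKy; exists (x, y).
Qed.

Definition Cc_slice F x := MkCc (Cc_sliceP F x).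

Lemma radon_sliceP (nu : radon R Y) (F : Cc R (X * Y)%type) :
  (fun x => nu (Cc_slice F x)) \in @is_Cc R _.
Proof.
have := CcP F => /set_mem[cF [K kK F0]].
have kK1 : compact (fst @` K).
  by apply: continuous_compact => //; apply: continuous_subspaceT => z; exact: cvg_fst.
have kK2 : compact (snd @` K).
  by apply: continuous_compact => //; apply: continuous_subspaceT => z; exact: cvg_snd.
have [M HM] := radon_bounded nu kK2; apply/mem_set; split; last first.
  exists (fst @` K) => // x nKx; rewrite -(radon0 nu); congr (nu _).
  by apply/val_inj/funext => y /=; apply: F0 => Kxy; apply: nKx; exists (x, y).
move=> x0; apply/cvgrPdist_le => e e0.
pose d := e / (`|M| + 1).
have d0 : 0 < d by rewrite divr_gt0// ltr_wpDl.
have : \forall x \near x0, snd @` K `<=` [set y | `|F (x0, y) - F (x, y)| <= d].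
  move/compact_near_coveringP: kK2 => /(_ X (nbhs x0)); apply => y _.
  have d20 : 0 < d / 2 by rewrite divr_gt0.
  have /cvgrPdist_le/(_ _ d20)[[A B]/= [Ay Bx] AB] := cF (x0, y).
  exists (B, A) => //= -[y' x']/= [By' Ax'].
  have H1 := AB (x0, y') (conj (nbhs_singleton Ay) By').
  have H2 := AB (x', y') (conj Ax' By').
  rewrite (splitr d) -(subrKA (F (x0, y))) (le_trans (ler_normD _ _))// lerD//.
  by rewrite distrC.
apply: filterS => x Hx; rewrite -radonB (@le_trans _ _ (M * d))//.
  have F0' z y : ~ (snd @` K) y -> F (z, y) = 0.
    by move=> nKy; apply: F0 => Kxy; apply: nKy; exists (z, y).
  apply: HM => y; rewrite (_ : Cc_fun _ y = F (x0, y) - F (x, y))//.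
    by move=> nKy; rewrite !F0'// subrr.
  have [Ky|nKy] := pselect ((snd @` K) y); first exact: Hx.
  by rewrite !F0'// subrr normr0 ltW.
rewrite /d mulrA ler_pdivrMr ?ltr_wpDl// mulrC ler_pM2l//.
by rewrite (le_trans (ler_norm _))// lerDl.
Qed.

Definition radon_slice nu F := MkCc (radon_sliceP nu F).

Definition tensor_fun (mu : radon R X) (nu : radon R Y) (F : Cc R (X * Y)%type) : R :=
  mu (radon_slice nu F).

Lemma tensor_funP (mu : radon R X) (nu : radon R Y) :
  tensor_fun mu nu \in @is_radon R _.
Proof.
apply/mem_set; split.
  move=> a F G; rewrite /tensor_fun -radon_linear; congr (mu _).
  apply/val_inj/funext => x /=.
  change (nu (Cc_slice (a *: F + G) x)
    = a * nu (Cc_slice F x) + nu (Cc_slice G x)).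
  by rewrite -radon_linear; congr (nu _); exact/val_inj/funext.
move=> K kK.
have kK1 : compact (fst @` K).
  by apply: continuous_compact => //; apply: continuous_subspaceT => z; exact: cvg_fst.
have kK2 : compact (snd @` K).
  by apply: continuous_compact => //; apply: continuous_subspaceT => z; exact: cvg_snd.
have [M HM] := radon_bounded mu kK1; have [N HN] := radon_bounded nu kK2.
exists (M * N) => F c F0 Fc; rewrite -mulrA; apply: HM => x /=.
  move=> nKx; rewrite -(radon0 nu); congr (nu _); apply/val_inj/funext => y /=.
  by apply: F0 => Kxy; apply: nKx; exists (x, y).
apply: HN => y //= nKy.
by apply: F0 => Kxy; apply: nKy; exists (x, y).
Qed.

(* (mu (x) nu)(F) = \int \int F(x, y) dnu(y) dmu(x) *)
Definition tensor mu nu : radon R (X * Y)%type := MkRadon (tensor_funP mu nu).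

End tensor.

Section integral.
Context (R : realType) (X : topologicalType).
Implicit Types (mu : radon R X) (h : X -> \bar R) (E : set X).
Local Open Scope ereal_scope.

Definition radon_positive mu := forall f : Cc R X,
  (forall x, (0 <= f x)%R) -> (0 <= mu f)%R.

(* \int h dmu for mu >= 0 and h lower semicontinuous, where h >= 0 (the sup may
   then be restricted to f >= 0) or X is compact and h > -oo. *)
Definition lint mu h : \bar R :=
  ereal_sup [set (mu f)%:E | f in [set f : Cc R X | forall x, (f x)%:E <= h x]].

Definition sint_defined mu h :=
  ~ (lint (radon_pos mu) h = +oo /\ lint (radon_neg mu) h = +oo).

(* Outside sint_defined this is +oo - +oo, which is -oo. *)
Definition sint mu h : \bar R := lint (radon_pos mu) h - lint (radon_neg mu) h.

Definition outer_measure mu E : \bar R :=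
  ereal_inf [set lint mu (fun x => (\1_U x)%:E) | U in
    [set U : set X | open U /\ E `<=` U]].

Definition locally_negligible mu E :=
  forall K : set X, compact K -> outer_measure mu (K `&` E) = 0.

(* the nonnegative measures concentrated on E *)
Definition Mplus E : set (radon R X) :=
  [set mu | radon_positive mu /\ locally_negligible mu (~` E)].

End integral.

Record directed := Directed {
  directed_sort :> Type ;
  dle : directed_sort -> directed_sort -> Prop ;
  dle_refl : forall s, dle s s ;
  dle_trans : forall s t u, dle s t -> dle t u -> dle s u ;
  dle_upper : forall s t, exists u, dle s u /\ dle t u ;
  directed_inhabited : inhabited directed_sort }.

Definition tails (S : directed) : set_system S :=
  [set P | exists s0 : S, forall s, dle s0 s -> P s].
Arguments tails : clear implicits.

Section potential.
Context (R : realType) (X : topologicalType) (kappa : X * X -> \bar R).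
Implicit Types (nu : radon R X) (E : set X).
Local Open Scope ereal_scope.

Definition potential_kernel :=
  [/\ lower_semicontinuous kappa, forall z, -oo < kappa z &
      compact [set: X] \/ forall z, 0 <= kappa z].

Definition mutual_energy_defined nu nu1 := sint_defined (tensor nu nu1) kappa.
Definition mutual_energy nu nu1 : \bar R := sint (tensor nu nu1) kappa.
Definition energy nu := mutual_energy nu nu.

Definition potential_defined nu (x : X) := sint_defined nu (fun y => kappa (x, y)).
Definition potential nu (x : X) : \bar R := sint nu (fun y => kappa (x, y)).

Definition finite_energy : set (radon R X) :=
  [set nu | mutual_energy_defined nu nu /\ energy nu \is a fin_num].

Definition positive_definite :=
  (forall x y, kappa (x, y) = kappa (y, x)) /\
  (forall nu, mutual_energy_defined nu nu -> 0 <= energy nu).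

Definition strong_norm nu : R := Num.sqrt (fine (energy nu)).

Definition Eplus E : set (radon R X) := Mplus E `&` finite_energy.

Definition consistent := forall (S : directed) (nu : S -> radon R X),
  (forall s, Eplus setT (nu s)) ->
  (forall e : R, (0 < e)%R -> exists s0 : S, forall s t,
     dle s0 s -> dle s0 t -> (strong_norm (nu s - nu t)%R < e)%R) ->
  forall nu0 : radon R X, cluster (nu @ tails S) nu0 ->
    finite_energy nu0 /\ strong_norm (nu s - nu0)%R @[s --> tails S] --> (0 : R)%R.

Definition inner_capacity E : \bar R :=
  (ereal_inf [set energy nu | nu in
     [set nu | Eplus E nu /\ lint nu (cst 1) = 1]])^-1.

Definition nearly_everywhere E (P : X -> Prop) :=
  inner_capacity [set x | E x /\ ~ P x] = 0.

(* f is only meaningful on its domain D; C(E) > 0 is assumed. *)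
Definition ne_inf E (D : X -> Prop) (f : X -> \bar R) : \bar R :=
  ereal_sup [set q%:E | q in
    [set q : R | nearly_everywhere E (fun x => D x /\ q%:E <= f x)]].

End potential.

Section condenser.
Context (R : realType) (X : topologicalType) (kappa : X * X -> \bar R).
Context (m p : nat).
Notation I := 'I_(m + p).
Implicit Types (A K : I -> set X) (a c tau : I -> R) (g : X -> R).
Implicit Types (mu nu : I -> radon R X) (i : I).
Local Open Scope ereal_scope.

(* Indices are numbered from 0: I^+ is i < m, and I^- is m <= i. *)
Definition alpha i : R := if (i < m)%N then 1%R else (-1)%R.

Definition condenser A :=
  (forall i, A i !=set0) /\
  (forall i j : I, (i < m)%N -> (m <= j)%N -> closure (A i) `&` closure (A j) = set0).

Definition cond_closure A : I -> set X := fun i => closure (A i).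
Definition cond_all A : set X := \bigcup_i A i.
Definition cond_plus A : set X := \bigcup_(i in [set i : I | (i < m)%N]) A i.
Definition cond_minus A : set X := \bigcup_(i in [set i : I | (m <= i)%N]) A i.

Definition signed_sum mu : radon R X := (\sum_(i < m + p) alpha i *: mu i)%R.

Definition M_cond A : set (I -> radon R X) :=
  [set mu | forall i, Mplus (A i) (mu i)].

Definition E_cond A : set (I -> radon R X) :=
  M_cond A `&` [set mu | finite_energy kappa (signed_sum mu)].

Definition cond_dist mu nu : R :=
  strong_norm kappa (signed_sum mu - signed_sum nu)%R.

Definition cond_equiv mu nu := cond_dist mu nu = 0%R.

Definition E_cond_norm A a g : set (I -> radon R X) :=
  E_cond A `&` [set mu | forall i, lint (mu i) (fun x => (g x)%:E) = (a i)%:E].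

Definition min_energy A a g : \bar R :=
  ereal_inf [set energy kappa (signed_sum mu) | mu in E_cond_norm A a g].

Definition capacity A a g : \bar R := (min_energy A a g)^-1.

Definition minimizers A a g : set (I -> radon R X) :=
  E_cond_norm A a g `&`
  [set mu | energy kappa (signed_sum mu) = min_energy A a g].

Definition Gamma_hat_with A a g (nu : radon R X) c :=
  [/\ finite_energy kappa nu,
      forall i, nearly_everywhere kappa (A i) (fun x =>
        potential_defined kappa nu x /\
        (c i * g x)%R%:E <= (alpha i * a i)%R%:E * potential kappa nu x) &
      (1 <= \sum_(i < m + p) c i)%R].

Definition Gamma_hat A a g : set (radon R X) :=
  [set nu | exists c, Gamma_hat_with A a g nu c].

Definition Gamma_hat_minimizers A a g : set (radon R X) :=
  Gamma_hat A a g `&`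
  [set nu | energy kappa nu = ereal_inf (energy kappa @` Gamma_hat A a g)].

(* The definite description of the numbers c_i(omega), omega any minimizer. *)
Definition inner_capacitary_constants A a g : I -> R :=
  xget (fun=> 0%R) [set c | exists2 omega, Gamma_hat_minimizers A a g omega &
    Gamma_hat_with A a g omega c].

Definition exhausting A a g K :=
  [/\ condenser K, forall i, compact (K i), forall i, K i `<=` A i &
      0 < capacity K a g].

(* cap K <= cap A, so that fine loses nothing when cap A < +oo.  The net K is a
   subnet of the family in Kelley's sense. *)
Definition inner_capacitary_distributions A a g : set (I -> radon R X) :=
  [set gamma | E_cond (cond_closure A) gamma /\
    exists (S : directed) (K : S -> I -> set X) (lambda : S -> I -> radon R X),
    [/\ forall s, exhausting A a g (K s),
        forall K0, exhausting A a g K0 ->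
          exists s0 : S, forall s, dle s0 s -> forall i, K0 i `<=` K s i,
        forall s, minimizers (K s) (fun i => a i * fine (capacity (K s) a g))%R g
                    (lambda s),
        forall i, lambda s i @[s --> tails S] --> gamma i &
        cond_dist (lambda s) gamma @[s --> tails S] --> (0 : R)%R]].

End condenser.

(* Main.v *)
(* Let V be the capacity of A and rho the signed measure of nu.  An inequality
   that holds nearly everywhere may be integrated against a measure of finite
   energy with compact support; hence every lam in E(A, a, g) with compact
   carriers satisfies
     kappa(lam, rho) >= sum_i tau_i = (V + |rho|^2) / (2 V),
   that is, |V lam - rho|^2 <= V^2 |lam|^2 - V.  The energies of such lam
   approximate the infimum 1 / V over E(A, a, g), so V lam converges strongly to
   rho along every minimizing net.  This applies to the nets that define the
   capacitary distributions, and it yields |rho|^2 = V and sum_i tau_i = 1.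
   In the same way kappa(rho, omega) >= V for all omega in Gamma_hat, so rho is
   a minimizer there and all minimizers are equivalent to it.  Finally
   alpha_i kappa(lam^i, rho) tends to tau_i along a minimizing sequence and is
   bounded below by every constant that is admissible for the index i, in
   particular by C_i; as sum_i C_i >= 1, C_i = tau_i. *)

(* Two obstacles shape the proof. The set where an inequality fails nearly everywhere need not be
   measurable, so the inequality cannot simply be integrated over its complement. Instead, if the
   integrated inequality fails, a compact subset of the exceptional set is exhibited that carries a
   nonzero part of lam; this calls for test measures with compact carriers, for restrictions of
   functionals to compact sets, and for the approximation of members of E(A, a, g) by such test
   measures. The energy of a signed measure rho is defined by the Jordan decomposition of rho (x)
   rho, which hides its bilinearity. With p and n the parts of rho, that decomposition is shown to
   consist of p (x) p + n (x) n and p (x) n + n (x) p. Positive definiteness then makes all mixed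
   terms finite, and the energy becomes a real quadratic form subject to the Cauchy-Schwarz
   inequality. The prescribed sum (V + |rho|^2) / (2 V) is an extreme case of that inequality: it is
   at least |rho| / sqrt V by the inequality of arithmetic and geometric means, while near
   minimizers bound it from above by the same number. Hence |rho|^2 = V. *)
Require Import Defs.
From mathcomp Require Import all_boot all_order all_algebra.
From mathcomp Require Import all_classical all_reals all_analysis.
From mathcomp Require Import ring lra.

Set Implicit Arguments.
Unset Strict Implicit.
Unset Printing Implicit Defensive.

Import Order.TTheory GRing.Theory Num.Theory.
Import numFieldNormedType.Exports.

Local Open Scope classical_set_scope.
Local Open Scope ring_scope.

(** * Continuous functions with compact support *)

Section compactly_supported.
Context (R : realType) (X : topologicalType).
Implicit Types (f g h : Cc R X) (K U : set X).

Lemma Cc_cont f : continuous f.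
Proof. by case: f => f /= /set_mem[]. Qed.

Lemma Cc_supp f : exists2 K, compact K & forall x, ~ K x -> f x = 0.
Proof. by case: f => f /= /set_mem[]. Qed.

Lemma Cc_near_gt f x (r : R) : r < f x -> \forall y \near x, r < f y.
Proof. by apply: cvgr_gt; exact: Cc_cont. Qed.

Lemma Cc_near_lt f x (r : R) : f x < r -> \forall y \near x, f y < r.
Proof. by apply: cvgr_lt; exact: Cc_cont. Qed.

Lemma CcDE f g x : (f + g) x = f x + g x. Proof. by []. Qed.
Lemma CcBE f g x : (f - g) x = f x - g x. Proof. by []. Qed.
Lemma CcNE f x : (- f) x = - f x. Proof. by []. Qed.
Lemma CcZE (a : R) f x : (a *: f) x = a * f x. Proof. by []. Qed.
Lemma Cc0E x : (0 : Cc R X) x = 0. Proof. by []. Qed.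
Lemma Cc_minE f g x : Cc_min f g x = Num.min (f x) (g x). Proof. by []. Qed.

Definition CcE := (CcBE, CcDE, CcNE, CcZE, Cc0E, Cc_minE).

Lemma Cc_ext f g : (forall x, f x = g x) -> f = g.
Proof. by move=> fg; exact/val_inj/funext. Qed.

Definition Cc_max f g : Cc R X := - Cc_min (- f) (- g).

Lemma Cc_maxE f g x : Cc_max f g x = Num.max (f x) (g x).
Proof. by rewrite /Cc_max !CcE -oppr_max opprK. Qed.

Lemma Cc_mulP (k : X -> R) f : continuous k -> (fun x => k x * f x) \in @is_Cc R X.
Proof.
move=> ck; apply/mem_set; split.
  by move=> x; apply: cvgM; [exact: ck|exact: Cc_cont].
by have [K kK f0] := Cc_supp f; exists K => // x /f0 ->; rewrite mulr0.
Qed.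

Definition Cc_mul (k : X -> R) (ck : continuous k) f := MkCc (Cc_mulP f ck).

Lemma Cc_mulE (k : X -> R) (ck : continuous k) f x : Cc_mul ck f x = k x * f x.
Proof. by []. Qed.

(** The final segments of [D] generate a filter, to which the near-covering form of compactness is
    applied. This replaces the extraction of finite subcovers throughout. *)
Lemma compact_directed K (T : Type) (D : set T) (P : T -> X -> Prop)
    (le : T -> T -> Prop) :
  compact K -> D !=set0 ->
  (forall s, D s -> le s s) ->
  (forall s t u, le s t -> le t u -> le s u) ->
  (forall s t, D s -> D t -> exists u, [/\ D u, le s u & le t u]) ->
  (forall s t x, D s -> D t -> le s t -> P s x -> P t x) ->
  (forall x, K x -> exists2 t, D t & \forall x' \near x, P t x') ->
  exists2 t, D t & forall x, K x -> P t x.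
Proof.
move=> /compact_near_coveringP kK [t0 Dt0] rle tle dir mono loc.
pose F : set_system T := [set A | exists2 t, D t & forall s, D s -> le t s -> A s].
have FF : Filter F.
  split.
  - by exists t0.
  - move=> A B [s Ds As] [t Dt Bt]; have [u [Du su tu]] := dir _ _ Ds Dt.
    by exists u => // v Dv uv; split; [apply: As|apply: Bt] => //; exact: tle uv.
  - by move=> A B AB [s Ds As]; exists s => // t Dt st; apply: AB; exact: As.
have [] := kK T F (fun t x => D t -> P t x) FF.
  move=> x /loc[t Dt Px]; exists ([set x' | P t x'], [set s | D s /\ le t s]) => /=.
    by split => //=; exists t => // s Ds ts.
  by move=> [x' s] /= [Ptx' [Ds ts]] _; exact: mono Ptx'.
by move=> t Dt Ht; exists t => // x Kx; apply: Ht => //; exact: rle.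
Qed.

Hypotheses (hX : hausdorff_space X) (lcX : locally_compact [set: X]).

Lemma compact_nbhs (x : X) : exists V, [/\ nbhs x V, compact V & closed V].
Proof.
have := lcX; move=> /(_ x I).
move=> [V nV [kV cV]]; exists V; split => //.
have : \forall y \near x, [set: X] y -> V y := nV.
by apply: filterS => y; apply.
Qed.

(** Complete regularity separates x from the complement of [U] intersected with the interior of a
    compact neighbourhood; the latter forces compact support. *)
Lemma Cc_bump (x : X) (U : set X) : open U -> U x ->
  exists f : Cc R X, [/\ f x = 1, forall y, 0 <= f y <= 1 & forall y, ~ U y -> f y = 0].
Proof.
move=> oU Ux; have [V [nV kV cV]] := compact_nbhs x.
pose B : set X := ~` (U `&` V°).
have cB : closed B by apply: open_closedC; apply: openI => //; exact: open_interior.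
have nBx : ~ B x by move/contrapT: (nV) => _; apply; split.
have [k [ck k01 k0 k1]] := (@uniform_separatorP X R [set x] B).1
  (@locally_compact_completely_regular X R lcX hX _ _ cB nBx).
have k01' y : 0 <= 1 - k y <= 1.
  have /k01/= : range k (k y) by exists y.
  by rewrite in_itv/= subr_ge0 lerBlDr lerDl => /andP[-> ->].
have kB y : B y -> 1 - k y = 0 by move=> By; rewrite (k1 (k y)) ?subrr//; exists y.
have kP : (fun y => 1 - k y) \in @is_Cc R X.
  apply/mem_set; split; first by move=> y; apply: cvgB; [exact: cvg_cst|exact: ck].
  by exists V => // y nVy; apply: kB => -[_ /interior_subset].
exists (MkCc kP); split => //=; first by rewrite (k0 (k x)) ?subr0//; exists x.
by move=> y nUy; apply: kB => -[].
Qed.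

Lemma Cc_minrP (f : Cc R X) (c : R) : 0 <= c ->
  (fun x => Num.min (f x) c) \in @is_Cc R X.
Proof.
move=> c0; apply/mem_set; split.
  move=> x; apply: (@continuous_min _ _ (f : X -> R) (fun=> c)).
    exact: Cc_cont.
  exact: cst_continuous.
by have [K kK f0] := Cc_supp f; exists K => // x /f0 ->; rewrite min_l.
Qed.

(** Sums of bumps are directed upwards, so that one of them is at least 1 on all of K; it is then
    cut off at 1. *)
Lemma Cc_urysohn K U : compact K -> open U -> K `<=` U ->
  exists f : Cc R X, [/\ forall x, K x -> f x = 1, forall x, 0 <= f x <= 1 &
    forall x, ~ U x -> f x = 0].
Proof.
move=> kK oU KU.
pose D : set (Cc R X) :=
  [set f | (forall x, 0 <= f x) /\ forall x, ~ U x -> f x = 0].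
have [||||||f [f0 fU] fK] := @compact_directed K (Cc R X) D
    (fun f x => 1 <= f x) (fun f g => forall x, f x <= g x) kK.
- by exists 0; split.
- by [].
- by move=> f g h fg gh x; exact: le_trans (gh x).
- move=> f g [f0 fU] [g0 gU]; exists (f + g); split.
  + by split=> x; rewrite CcE ?addr_ge0// => nUx; rewrite fU// gU// addr0.
  + by move=> x; rewrite CcE lerDl.
  + by move=> x; rewrite CcE lerDr.
- by move=> f g x _ _ fg; move/le_trans; exact.
- move=> x Kx; have [f [fx f01 fU]] := Cc_bump oU (KU _ Kx).
  (* The factor 2 gives values above 1 wherever the bump exceeds 1/2. *)
  exists (2%:R *: f).
    split=> y; rewrite CcE; first by have /andP[? _] := f01 y; rewrite mulr_ge0.
    by move=> nUy; rewrite fU// mulr0.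
  have : \forall y \near x, 2^-1 < f y.
    by apply: Cc_near_gt; rewrite fx invf_lt1// ltr1n.
  by apply: filterS => y; rewrite CcE => fy; lra.
exists (MkCc (Cc_minrP f ler01)); split => x /=.
- by move=> Kx; rewrite min_r//; exact: fK.
- by rewrite le_min f0 ler01 ge_min lexx orbT.
- by move=> nUx; rewrite fU// min_l.
Qed.

Lemma Cc_cutoff K : compact K ->
  exists f : Cc R X, (forall x, K x -> f x = 1) /\ forall x, 0 <= f x <= 1.
Proof.
move=> kK; have [||f [fK f01 _]] := @Cc_urysohn K setT kK.
- exact: openT.
- by [].
- by exists f.
Qed.

Lemma radon_positive_le (mu : radon R X) f g : radon_positive mu ->
  (forall x, f x <= g x) -> mu f <= mu g.
Proof.
move=> mu0 fg; rewrite -subr_ge0 -radonB; apply: mu0 => x.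
by rewrite !CcE subr_ge0.
Qed.

(** Dini's theorem for a directed family of lower semicontinuous functions: by compactness one
    member exceeds f up to a uniform error. It serves to interchange integrals and directed
    suprema. *)
Lemma dini (mu : radon R X) (T : Type) (D : set T) (u : T -> X -> \bar R)
    (f0 f : Cc R X) (e : R) :
  radon_positive mu -> D !=set0 ->
  (forall s, D s -> lower_semicontinuous (u s)) ->
  (forall s x, D s -> ((f0 x)%:E <= u s x)%E) ->
  (forall s t, D s -> D t -> exists w, [/\ D w, forall x, (u s x <= u w x)%E &
     forall x, (u t x <= u w x)%E]) ->
  (forall x r, r < f x -> exists2 s, D s & (r%:E < u s x)%E) ->
  0 < e ->
  exists2 s, D s & exists2 f' : Cc R X, (forall x, ((f' x)%:E <= u s x)%E) &
    mu f - e <= mu f'.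
Proof.
move=> mu0 D0 lscu uf0 dir supu e0.
(* The witness will be [f1 - d *: chi]. On the supports it is [f1 - d], below [u s] by compactness;
   elsewhere it is at most 0 = f0, hence below every [u s]. The choice of d keeps the loss d * mu
   chi below e. *)
pose f1 := Cc_max f f0.
have [K1 kK1 f10] := Cc_supp f1; have [K2 kK2 f00] := Cc_supp f0.
have [chi [chiK chi01]] := Cc_cutoff (compactU kK1 kK2).
have chi0 x : 0 <= chi x by have /andP[] := chi01 x.
have muchi0 : 0 <= mu chi by exact: mu0.
pose d := e / (mu chi + 1).
have d0 : 0 < d by rewrite divr_gt0// ltr_wpDl.
have [||||||s Ds us] := @compact_directed (K1 `|` K2) T D
    (fun s x => ((f1 x - d)%:E < u s x)%E) (fun s t => forall x, (u s x <= u t x)%E) _ D0.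
- exact: compactU.
- by [].
- by move=> s t w st tw x; exact: le_trans (tw x).
- by move=> s t Ds Dt; have [w [Dw sw tw]] := dir _ _ Ds Dt; exists w.
- by move=> s t x _ _ st /lt_le_trans; apply.
- move=> x _; have [s Ds us] : exists2 s, D s & ((f1 x - d / 2)%:E < u s x)%E.
    have [f0x|fx] := leP (f x) (f0 x).
      have [s Ds] := D0; exists s => //; apply: lt_le_trans (uf0 _ x Ds).
      rewrite lte_fin Cc_maxE max_r// ltrBlDr ltrDl divr_gt0//.
    by apply: supu; rewrite Cc_maxE max_l 1?ltW// ltrBlDr ltrDl divr_gt0.
  exists s => //; have [V nV Vu] := lscu _ Ds _ _ us.
  have : \forall y \near x, f1 y < f1 x + d / 2.
    by apply: Cc_near_lt; rewrite ltrDl divr_gt0.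
  move: nV; apply: filterS2 => y /Vu Vy fy; apply: le_lt_trans Vy.
  by rewrite lee_fin; lra.
exists s => //; exists (f1 - d *: chi).
  move=> x; have [Kx|nKx] := pselect ((K1 `|` K2) x).
    by rewrite !CcE chiK// mulr1 ltW//; exact: us.
  move/not_orP : nKx => [nK1 nK2]; apply: le_trans (uf0 _ _ Ds).
  by rewrite CcBE CcZE f10// f00// sub0r lee_fin oppr_le0 mulr_ge0// ltW.
rewrite radonB radonZ lerB//.
  by apply: radon_positive_le => // x; rewrite Cc_maxE le_max lexx.
by rewrite /d mulrAC ler_pdivrMr ?ltr_wpDl// ler_pM2l// lerDl.
Qed.

End compactly_supported.

Arguments Cc_cont {R X} f.

Arguments radon_pos : simpl never.
Arguments radon_neg : simpl never.
Arguments tensor : simpl never.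

(** * Jordan decompositions and products of Radon measures *)

Section radon_order.
Context (R : realType) (X : topologicalType).
Implicit Types (mu nu : radon R X) (f g h : Cc R X).

Lemma radonDE mu nu f : (mu + nu) f = mu f + nu f. Proof. by []. Qed.
Lemma radonBE mu nu f : (mu - nu) f = mu f - nu f. Proof. by []. Qed.
Lemma radonNE mu f : (- mu) f = - mu f. Proof. by []. Qed.
Lemma radonZE (a : R) mu f : (a *: mu) f = a * mu f. Proof. by []. Qed.
Lemma radon0E f : (0 : radon R X) f = 0. Proof. by []. Qed.
Definition radonE := (radonBE, radonDE, radonNE, radonZE, radon0E).

Lemma radon_ext mu nu : (forall f, (forall x, 0 <= f x) -> mu f = nu f) -> mu = nu.
Proof.
move=> H; apply/val_inj/funext => f /=; have [u [v [-> u0 v0]]] := Cc_split f.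
by rewrite !radonB !H.
Qed.

Lemma radon_positive0 : radon_positive (0 : radon R X).
Proof. by move=> f _; rewrite radon0E. Qed.

Lemma radon_positiveD mu nu : radon_positive mu -> radon_positive nu ->
  radon_positive (mu + nu).
Proof. by move=> mu0 nu0 f f0; rewrite radonE addr_ge0 ?mu0 ?nu0. Qed.

Lemma radon_positiveZ (a : R) mu : 0 <= a -> radon_positive mu ->
  radon_positive (a *: mu).
Proof. by move=> a0 mu0 f f0; rewrite radonE mulr_ge0 ?mu0. Qed.

Lemma radon_positive_sum n (P : pred 'I_n) (mu : 'I_n -> radon R X) :
  (forall i, P i -> radon_positive (mu i)) ->
  radon_positive (\sum_(i < n | P i) mu i).
Proof.
move=> H; elim/big_ind : _ => [|m1 m2|//]; [|exact: radon_positiveD].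
exact: radon_positive0.
Qed.

Lemma radon_posE mu f : (forall x, 0 <= f x) -> radon_pos mu f = pos_val mu f.
Proof.
move=> f0; rewrite -[f in LHS]subr0.
have := @pos_fun_decomp _ _ mu f 0 f0 (fun x => lexx _).
rewrite /= => ->; rewrite -(scale0r (0 : Cc R X)) pos_valZ// ?mul0r ?subr0//.
Qed.

Lemma radon_pos_ge0 mu : radon_positive (radon_pos mu).
Proof.
move=> f f0; rewrite radon_posE// -(radon0 mu); apply: pos_val_ge => x.
by rewrite lexx f0.
Qed.

Lemma radon_neg_ge0 mu : radon_positive (radon_neg mu).
Proof. exact: radon_pos_ge0. Qed.

Lemma radon_pos_neg mu : radon_pos mu - radon_neg mu = mu.
Proof.
apply: radon_ext => f f0; rewrite radonE /radon_neg !radon_posE//.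
apply/eqP; rewrite subr_eq addrC -subr_eq; apply/eqP.
apply/eqP; rewrite eq_le; apply/andP; split.
  rewrite lerBlDr; apply: pos_val_le => // h hf.
  have := @pos_val_ge _ _ (- mu) f (f - h).
  rewrite radonE radonB opprB lerBlDr => H; rewrite H// => x.
  by rewrite CcBE subr_ge0 lerBlDr lerDl andbC; exact: hf.
apply: pos_val_le => // h hf; rewrite radonE lerBrDr -lerBrDl opprK addrC.
rewrite -lerBlDl -radonB; apply: pos_val_ge => x.
by rewrite CcBE subr_ge0 lerBlDr lerDl andbC; exact: hf.
Qed.

Lemma radon_pos_le mu (m1 m2 : radon R X) : radon_positive m1 -> radon_positive m2 ->
  mu = m1 - m2 -> radon_positive (m1 - radon_pos mu).
Proof.
move=> m10 m20 -> f f0; rewrite radonBE subr_ge0 radon_posE//.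
apply: pos_val_le => // h hf; rewrite radonE lerBlDr ler_wpDr//.
  by apply: m20 => x; have /andP[] := hf x.
by apply: radon_positive_le => // x; have /andP[] := hf x.
Qed.

Lemma radon_neg_le mu (m1 m2 : radon R X) : radon_positive m1 -> radon_positive m2 ->
  mu = m1 - m2 -> radon_positive (m2 - radon_neg mu).
Proof.
move=> m10 m20 e; rewrite /radon_neg; apply: (@radon_pos_le _ m2 m1) => //.
by rewrite e opprB.
Qed.

(** A substitute for the Hahn decomposition: if mu h is within e of the supremum mu^+(f), then mu h
    = mu^+(h) - mu^-(h) gives mu^+(f - h) + mu^-(h) <= e. *)
Lemma radon_pos_approx mu f (e : R) : (forall x, 0 <= f x) -> 0 < e ->
  exists h, [/\ forall x, 0 <= h x <= f x, radon_neg mu h <= e &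
    radon_pos mu (f - h) <= e].
Proof.
move=> f0 e0; have [_ [h hf <-]] := sup_adherent e0 (pos_val_sup mu f).
rewrite -/(pos_val mu f) -radon_posE// => mh.
have {}hf x : 0 <= h x <= f x by have := hf x; rewrite /= max_l.
have h0 x : 0 <= h x by have /andP[] := hf x.
have fh x : 0 <= (f - h) x by rewrite CcBE subr_ge0; have /andP[] := hf x.
have p0 := radon_pos_ge0 mu fh; have n0 := radon_neg_ge0 mu h0.
have muh : mu h = radon_pos mu h - radon_neg mu h by rewrite -radonBE radon_pos_neg.
have pfh : radon_pos mu (f - h) = radon_pos mu f - radon_pos mu h by exact: radonB.
by exists h; split; [exact: hf|lra|lra].
Qed.

(** Minimality of the positive part gives [radon_pos mu <= m1]; test functions below f that nearly
    recover m1 f give the converse. The Jordan decompositions of products and of condenser charges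
    are identified by this criterion. *)
Lemma radon_posP mu (m1 m2 : radon R X) : radon_positive m1 -> radon_positive m2 ->
  mu = m1 - m2 ->
  (forall f (e : R), (forall x, 0 <= f x) -> 0 < e ->
    exists2 h : Cc R X, forall x, 0 <= h x <= f x & m1 f - e <= mu h) ->
  radon_pos mu = m1 /\ radon_neg mu = m2.
Proof.
move=> m10 m20 e H.
have E : radon_pos mu = m1.
  apply: radon_ext => f f0; apply/eqP; rewrite eq_le; apply/andP; split.
    by have := radon_pos_le m10 m20 e f0; rewrite radonE subr_ge0.
  apply/ler_addgt0Pr => d d0; have [h hf mh] := H f d f0 d0.
  rewrite -lerBlDr (le_trans mh)// radon_posE//; exact: pos_val_ge.
split=> //; have := radon_pos_neg mu; rewrite E [X in _ = X]e.
by move/addrI/oppr_inj.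
Qed.

Lemma radon_pos_id mu : radon_positive mu -> radon_pos mu = mu /\ radon_neg mu = 0.
Proof.
move=> mu0; apply: (@radon_posP mu mu 0) => //; first by rewrite subr0.
move=> f e f0 e0; exists f; first by move=> x; rewrite f0 lexx.
by rewrite lerBlDr lerDl ltW.
Qed.

End radon_order.

Section tensor_positive.
Context (R : realType) (X Y : topologicalType).
Implicit Types (mu : radon R X) (nu : radon R Y).

Lemma tensorE mu nu (F : Cc R (X * Y)%type) :
  tensor mu nu F = mu (radon_slice nu F).
Proof. by []. Qed.

Lemma tensorDl mu mu' nu : tensor (mu + mu') nu = tensor mu nu + tensor mu' nu.
Proof. exact/val_inj/funext. Qed.

Lemma tensor0l nu : tensor (0 : radon R X) nu = 0.
Proof. exact/val_inj/funext. Qed.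

Lemma tensorZl (a : R) mu nu : tensor (a *: mu) nu = a *: tensor mu nu.
Proof. exact/val_inj/funext. Qed.

Lemma tensorDr mu nu nu' : tensor mu (nu + nu') = tensor mu nu + tensor mu nu'.
Proof.
apply/val_inj/funext => F; change (mu (radon_slice (nu + nu') F) =
  mu (radon_slice nu F) + mu (radon_slice nu' F)).
by rewrite -radonD; congr (mu _); exact: Cc_ext.
Qed.

Lemma tensorZr (a : R) mu nu : tensor mu (a *: nu) = a *: tensor mu nu.
Proof.
apply/val_inj/funext => F; change (mu (radon_slice (a *: nu) F) =
  a * mu (radon_slice nu F)).
by rewrite -radonZ; congr (mu _); exact: Cc_ext.
Qed.

Lemma tensor_positive mu nu : radon_positive mu -> radon_positive nu ->
  radon_positive (tensor mu nu).
Proof.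
by move=> mu0 nu0 F F0; rewrite tensorE; apply: mu0 => x; apply: nu0 => y; exact: F0.
Qed.

Lemma Cc_prodP (h : Cc R X) (k : Cc R Y) :
  (fun z : X * Y => h z.1 * k z.2) \in @is_Cc R (X * Y)%type.
Proof.
have [K kK h0] := Cc_supp h; have [L kL k0] := Cc_supp k; apply/mem_set; split.
  move=> z; apply: cvgM.
    by apply: (cvg_comp _ _ cvg_fst); exact: Cc_cont.
  by apply: (cvg_comp _ _ cvg_snd); exact: Cc_cont.
exists (K `*` L); first exact: compact_setX.
move=> [x y] /= /not_andP[/h0 ->|/k0 ->]; first by rewrite mul0r.
by rewrite mulr0.
Qed.

Definition Cc_prod h k : Cc R (X * Y)%type := MkCc (Cc_prodP h k).

Lemma Cc_prodE h k z : Cc_prod h k z = h z.1 * k z.2. Proof. by []. Qed.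

Lemma tensor_prod mu nu h k : tensor mu nu (Cc_prod h k) = mu h * nu k.
Proof.
rewrite tensorE mulrC -radonZ; congr (mu _); apply: Cc_ext => x.
rewrite CcZE mulrC.
by change (nu (Cc_slice (Cc_prod h k) x) = h x * nu k); rewrite -radonZ; congr (nu _); exact: Cc_ext.
Qed.

Lemma compact_proj (K : set (X * Y)) : compact K ->
  exists K1 K2, [/\ compact K1, compact K2 & K `<=` K1 `*` K2].
Proof.
move=> kK; exists (fst @` K), (snd @` K); split.
- by apply: continuous_compact => //; apply: continuous_subspaceT => z; exact: cvg_fst.
- by apply: continuous_compact => //; apply: continuous_subspaceT => z; exact: cvg_snd.
- by move=> z Kz; split; exists z.
Qed.

End tensor_positive.

Section tensor_square.
Context (R : realType) (X : topologicalType).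
Hypotheses (hX : hausdorff_space X) (lcX : locally_compact [set: X]).

(* With h in C_c almost equal to 1 where rho > 0 and almost equal to 0 where
   rho < 0, F (h (x) h + (1 - h) (x) (1 - h)) almost attains the positive part. *)
Lemma tensor_square_jordan (rho : radon R X) :
  let p := radon_pos rho in let n := radon_neg rho in
  radon_pos (tensor rho rho) = tensor p p + tensor n n /\
  radon_neg (tensor rho rho) = tensor p n + tensor n p.
Proof.
move=> p n.
have p0 : radon_positive p by exact: radon_pos_ge0.
have n0 : radon_positive n by exact: radon_neg_ge0.
have E : tensor rho rho = (tensor p p + tensor n n) - (tensor p n + tensor n p).
  rewrite -[in LHS](radon_pos_neg rho) -/p -/n -(scaleN1r n).
  rewrite tensorDl !tensorDr !tensorZl !tensorZr !scaleN1r opprK.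
  by rewrite [- tensor n p + _]addrC addrACA opprD.
have P0 := radon_positiveD (tensor_positive p0 p0) (tensor_positive n0 n0).
have Q0 := radon_positiveD (tensor_positive p0 n0) (tensor_positive n0 p0).
have approx := radon_pos_approx rho; rewrite -/p -/n in approx.
apply: radon_posP => // F e F0 e0; clearbody p n.
have [K [c [kK F0K Fc]]] := Cc_bounded F.
have [K1 [K2 [kK1 kK2 KK]]] := compact_proj kK.
have [chi [chi1 chi01]] := Cc_cutoff R hX lcX (compactU kK1 kK2).
have chi0 x : 0 <= chi x by have /andP[] := chi01 x.
pose M := p chi + n chi.
have M0 : 0 <= M by rewrite addr_ge0 ?p0 ?n0.
pose d := e / (4 * `|c| * M + 1).
have D0 : 0 < 4 * `|c| * M + 1 by rewrite ltr_wpDl// !mulr_ge0.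
have d0 : 0 < d by rewrite divr_gt0.
have [h [hchi nh pk]] := approx _ _ chi0 d0.
pose k := chi - h; rewrite -/k in pk.
have h0 x : 0 <= h x by have /andP[] := hchi x.
have k0 x : 0 <= k x by rewrite CcBE subr_ge0; have /andP[] := hchi x.
have hk x : h x + k x = chi x by rewrite CcBE addrC subrK.
pose w (z : X * X) := h z.1 * h z.2 + k z.1 * k z.2.
have cw : continuous w := @Cc_cont _ _ (Cc_prod h h + Cc_prod k k).
pose H := Cc_mul cw F.
have Fle z : F z <= `|c|.
  by rewrite (le_trans (ler_norm _))// (le_trans (Fc z))// ler_norm.
(* On K both values of chi are 1, so 1 = (h + k) (x) (h + k) there; the diagonal terms make up H and
   the mixed ones are the error. *)
have FH z : F z = H z + F z * (h z.1 * k z.2 + k z.1 * h z.2).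
  rewrite /H Cc_mulE /w; have [Kz|nKz] := pselect (K z); last by rewrite F0K//; ring.
  have [z1 z2] := KK _ Kz.
  have : chi z.1 = 1 by apply: chi1; left.
  have : chi z.2 = 1 by apply: chi1; right.
  rewrite -!hk => e2 e1; rewrite -[LHS]mulr1 -[X in _ * X = _]mulr1 -{1}e1 -e2; ring.
have w0 z : 0 <= w z by rewrite addr_ge0 ?mulr_ge0.
have w'0 z : 0 <= h z.1 * k z.2 + k z.1 * h z.2 by rewrite addr_ge0 ?mulr_ge0.
exists H.
  by move=> z; rewrite (FH z) lerDl !mulr_ge0.
rewrite lerBlDr {1}E radonE.
have PB (T : radon R (X * X)%type) : radon_positive T ->
    T F <= T H + `|c| * (T (Cc_prod h k) + T (Cc_prod k h)).
  move=> T0; rewrite -radonD -radonZ -radonD; apply: radon_positive_le => // z.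
  by rewrite {1}FH !CcE lerD2l ler_wpM2r.
have QB (T : radon R (X * X)%type) : radon_positive T ->
    T H <= `|c| * (T (Cc_prod h h) + T (Cc_prod k k)).
  move=> T0; rewrite -radonD -radonZ; apply: radon_positive_le => // z.
  by rewrite /H Cc_mulE !CcE mulrC ler_wpM2r.
have ph := p0 _ h0; have pk0 := p0 _ k0; have nh0 := n0 _ h0; have nk := n0 _ k0.
have pchi : p chi = p h + p k by rewrite radonB addrC subrK.
have nchi : n chi = n h + n k by rewrite radonB addrC subrK.
have := PB _ P0; have := QB _ Q0; rewrite !radonE !tensor_prod => B1 B2.
have c0 := normr_ge0 c.
(* The sum factors as 2 |c| (p h + n k) (p k + n h), where p h + n k <= M and both p k and n h are
   at most d. *)
have B3 : `|c| * (p h * p k + n h * n k + (p k * p h + n k * n h)) +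
    `|c| * (p h * n h + n h * p h + (p k * n k + n k * p k)) <= 4 * `|c| * M * d.
  have -> : `|c| * (p h * p k + n h * n k + (p k * p h + n k * n h)) +
    `|c| * (p h * n h + n h * p h + (p k * n k + n k * p k)) =
    `|c| * (2 * (p h * (p k + n h) + n k * (p k + n h))) by ring.
  have -> : 4 * `|c| * M * d = `|c| * (2 * (M * (d + d))) by ring.
  rewrite ler_wpM2l// ler_wpM2l// -mulrDl ler_pM ?addr_ge0//; last exact: lerD.
  by rewrite /M pchi nchi; lra.
have B4 : 4 * `|c| * M * d <= e.
  rewrite /d mulrA ler_pdivrMr// mulrC ler_pM2l// lerDl//.
lra.
Qed.

End tensor_square.

(** * Interchange of the order of integration for continuous functions with compact support *)

Section fubini.
Context (R : realType) (X Y : topologicalType).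
Hypotheses (hX : hausdorff_space X) (lcX : locally_compact [set: X]).
Hypotheses (hY : hausdorff_space Y) (lcY : locally_compact [set: Y]).

Lemma Cc_swapP (F : Cc R (X * Y)%type) :
  (fun z : Y * X => F (z.2, z.1)) \in @is_Cc R (Y * X)%type.
Proof.
have [K kK F0] := Cc_supp F; have [K1 [K2 [kK1 kK2 KK]]] := compact_proj kK.
apply/mem_set; split.
  move=> z; apply: (@cvg_comp _ _ _ (fun z : Y * X => (z.2, z.1)) F
    (nbhs z) (nbhs (z.2, z.1))).
    by apply: cvg_pair; [exact: cvg_snd|exact: cvg_fst].
  exact: Cc_cont.
exists (K2 `*` K1); first exact: compact_setX.
by move=> [y x] /= nK; apply: F0 => /KK[/= ? ?]; apply: nK; split.
Qed.

Definition Cc_swap F : Cc R (Y * X)%type := MkCc (Cc_swapP F).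

Lemma Cc_sliceV (F : Cc R (X * Y)%type) (y : Y) :
  (fun x => F (x, y)) \in @is_Cc R X.
Proof. exact: (CcP (Cc_slice (Cc_swap F) y)). Qed.

(* F is uniformly close to finite sums of products, for which the two iterated
   integrals agree.  The sums are normalized by a partition of unity, whence the
   weight w. *)
Lemma tensor_swap (mu : radon R X) (nu : radon R Y) (F : Cc R (X * Y)%type) :
  tensor nu mu (Cc_swap F) = tensor mu nu F.
Proof.
have [K kK F0] := Cc_supp F; have [K1 [K2 [kK1 kK2 KK]]] := compact_proj kK.
have [psi [psi1 psi01]] := Cc_cutoff R hY lcY kK2.
have [L2 kL2 psi0] := Cc_supp psi.
have F0l x y : ~ K1 x -> F (x, y) = 0 by move=> nx; apply: F0 => /KK[].
have F0r x y : ~ K2 y -> F (x, y) = 0 by move=> nx; apply: F0 => /KK[].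
pose swapped (G : Cc R (X * Y)%type) := tensor nu mu (Cc_swap G) = tensor mu nu G.
have key (e : R) : 0 < e -> exists G : Cc R (X * Y)%type, [/\ swapped G,
    forall z, ~ (K1 `*` L2) z -> G z = 0 & forall z, `|F z - G z| <= e].
  move=> e0.
  (* Asking for the estimate with every weight w makes [D] stable under sums and postpones the
     normalization until u is known. *)
  pose D : set (Cc R Y) := [set u | [/\ forall y, 0 <= u y, forall y, ~ L2 y -> u y = 0 &
    forall w : Y -> R, continuous w -> (forall y, 0 <= w y) ->
    exists G : Cc R (X * Y)%type, [/\ swapped G,
      forall x y, ~ K1 x -> G (x, y) = 0 &
      forall x y, `|F (x, y) * u y * w y - G (x, y)| <= e * (u y * w y)]]].
  have [||||||u [u0 uL uw] uK] := @compact_directed Y K2 (Cc R Y) D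
      (fun u y => 1 <= u y) (fun u v => forall y, u y <= v y) kK2.
  - exists 0; split => // w _ _; exists 0; split => //.
      rewrite /swapped; have -> : Cc_swap 0 = 0 by exact: Cc_ext.
      by rewrite !radon0.
    by move=> x y; rewrite !Cc0E mulr0 mul0r subr0 normr0 mulr0.
  - by [].
  - by move=> u v w uv vw y; exact: le_trans (vw y).
  - move=> u v [u0 uL uw] [v0 vL vw]; exists (u + v); split.
    + split=> [y|y nL|w cw w0]; rewrite ?CcE ?addr_ge0//.
        by rewrite uL// vL// addr0.
      have [G [sG G1 HG]] := uw w cw w0; have [H [sH H1 HH]] := vw w cw w0.
      exists (G + H); split.
      * rewrite /swapped; have -> : Cc_swap (G + H) = Cc_swap G + Cc_swap H by exact: Cc_ext.
        by rewrite !radonD sG sH.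
      * by move=> x y nx; rewrite CcE G1// H1// addr0.
      * move=> x y; rewrite !CcE.
        have -> : F (x, y) * (u y + v y) * w y - (G (x, y) + H (x, y)) =
          (F (x, y) * u y * w y - G (x, y)) + (F (x, y) * v y * w y - H (x, y)) by ring.
        rewrite (le_trans (ler_normD _ _))//.
        by have := HG x y; have := HH x y; lra.
    + by move=> y; rewrite CcE lerDl.
    + by move=> y; rewrite CcE lerDr.
  - by move=> u v y _ _ uv; move/le_trans; exact.
  - move=> y0 Ky0.
    have : \forall y \near y0, K1 `<=` [set x | `|F (x, y0) - F (x, y)| <= e].
      move/compact_near_coveringP: kK1 => /(_ Y (nbhs y0)); apply => x _.
      have d20 : 0 < e / 2 by rewrite divr_gt0.
      have /cvgrPdist_le/(_ _ d20)[[A B]/= [Ax By] AB] := @Cc_cont _ _ F (x, y0).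
      exists (A, B) => //= -[x' y']/= [Ax' By'].
      have H1 := AB (x', y0) (conj Ax' (nbhs_singleton By)).
      have H2 := AB (x', y') (conj Ax' By').
      rewrite (splitr e) -(subrKA (F (x, y0))) (le_trans (ler_normD _ _))// lerD//.
      by rewrite distrC.
    rewrite -nbhs_nearE nbhsE => -[U [oU Uy0] UF].
    have [f [fy0 f01 fU]] := Cc_bump R hY lcY oU Uy0.
    have f0 y : 0 <= f y by have /andP[] := f01 y.
    have p0 y : 0 <= psi y by have /andP[] := psi01 y.
    have [u uE] : exists u : Cc R Y, forall y, u y = 2 * (psi y * f y).
      by exists (2%:R *: Cc_mul (Cc_cont psi) f).
    have u0 y : 0 <= u y by rewrite uE !mulr_ge0.
    exists u.
      split=> // [y nL|w cw w0]; first by rewrite uE psi0// mul0r mulr0.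
      exists (Cc_prod (MkCc (Cc_sliceV F y0)) (Cc_mul cw u)); split.
      + rewrite /swapped tensor_prod mulrC -tensor_prod; congr (tensor _ _ _).
        by apply: Cc_ext => z; rewrite Cc_prodE mulrC.
      + by move=> x y nx; rewrite Cc_prodE/= F0l// mul0r.
      + move=> x y; rewrite Cc_prodE Cc_mulE/=.
        have -> : F (x, y) * u y * w y - F (x, y0) * (w y * u y) =
          (F (x, y) - F (x, y0)) * (u y * w y) by ring.
        rewrite normrM [X in _ * X]ger0_norm ?mulr_ge0//.
        have [Uy|nUy] := pselect (U y); last first.
          by rewrite uE fU// mulr0 mulr0 mul0r mulr0 mulr0.
        have [K1x|nK1x] := pselect (K1 x); last first.
          by rewrite !F0l// subrr normr0 mul0r !mulr_ge0// ltW.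
        by rewrite ler_wpM2r ?mulr_ge0// distrC; exact: UF.
    have : \forall y \near y0, 2^-1 < (Cc_mul (Cc_cont psi) f) y.
      by apply: Cc_near_gt; rewrite Cc_mulE fy0 psi1// mulr1 invf_lt1// ltr1n.
    by apply: filterS => y; rewrite Cc_mulE uE => H; lra.
  (* With the weight 1 / m, the product u / m is 1 on K2, where F lives, and at most 1
     everywhere. *)
  pose m y := Num.max (u y) 1.
  have m1 y : 1 <= m y by rewrite le_max lexx orbT.
  have mpos y : 0 < m y by exact: lt_le_trans (m1 y).
  have cm : continuous (fun y => (m y)^-1).
    move=> y; apply: cvgV; first by rewrite gt_eqF.
    by apply: (@continuous_max _ _ (u : Y -> R) (fun=> 1)); [exact: Cc_cont|exact: cst_continuous].
  have [|G [sG G1 HG]] := uw _ cm; first by move=> y; rewrite invr_ge0 ltW.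
  have um y : u y / m y <= 1 by rewrite ler_pdivrMr// mul1r le_max lexx.
  have FE x y : F (x, y) * u y * (m y)^-1 = F (x, y).
    have [Ky|nKy] := pselect (K2 y); last by rewrite F0r// !mul0r.
    by rewrite /m max_l ?uK// mulfK// gt_eqF// (lt_le_trans _ (uK _ Ky)).
  exists G; split => // -[x y].
    move=> /= /not_andP[/G1//|nL].
    have := HG x y; rewrite F0r; last by move=> /psi1; rewrite psi0// => /eqP; rewrite eq_sym oner_eq0.
    by rewrite uL// !mul0r mulr0 sub0r normrN normr_le0 => /eqP.
  by rewrite -{1}FE (le_trans (HG _ _))// -[leRHS]mulr1 ler_wpM2l// ltW.
have kKL : compact (K1 `*` L2) by exact: compact_setX.
have [M1 HM1] := radon_bounded (tensor mu nu) kKL.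
have kLK : compact (L2 `*` K1) by exact: compact_setX.
have [M2 HM2] := radon_bounded (tensor nu mu) kLK.
apply/eqP; rewrite -subr_eq0 -normr_le0; apply/ler_addgt0Pr => e e0; rewrite add0r.
pose d := e / (`|M1| + `|M2| + 1).
have d0 : 0 < d by rewrite divr_gt0// ltr_wpDl// addr_ge0.
have [G [sG G0 FG]] := key d d0.
have FG0 z : ~ (K1 `*` L2) z -> (F - G) z = 0.
  move=> nz; rewrite CcE G0// subr0; case: z nz => x y /= /not_andP[/F0l//|nL].
  by apply: F0r => /psi1; rewrite psi0// => /eqP; rewrite eq_sym oner_eq0.
have -> : tensor nu mu (Cc_swap F) - tensor mu nu F =
    tensor nu mu (Cc_swap (F - G)) - tensor mu nu (F - G).
  have -> : Cc_swap (F - G) = Cc_swap F - Cc_swap G by exact: Cc_ext.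
  by rewrite !radonB sG; ring.
rewrite (le_trans (ler_normB _ _))//.
have B1 : `|tensor mu nu (F - G)| <= M1 * d by apply: HM1.
have B2 : `|tensor nu mu (Cc_swap (F - G))| <= M2 * d.
  apply: HM2 => -[y x]; last exact: FG.
  by move=> nz; apply: (FG0 (x, y)) => -[/= ? ?]; apply: nz; split.
apply: (le_trans (lerD B2 B1)); rewrite -mulrDl /d mulrA ler_pdivrMr; last first.
  by rewrite ltr_wpDl// addr_ge0.
rewrite mulrC ler_pM2l//; have := ler_norm M1; have := ler_norm M2; lra.
Qed.

End fubini.

(** * Lower integrals and potentials *)

Section lower_integral.
Context (R : realType) (X : topologicalType).
Implicit Types (mu nu : radon R X) (f : Cc R X) (h : X -> \bar R).
Local Open Scope ereal_scope.

(* This covers both cases of a kernel: h >= 0, and h > -oo lower semicontinuous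
   on a compact space. *)
Definition minorized h := exists f0 : Cc R X, forall x, (f0 x)%:E <= h x.

Lemma lint_ge mu f h : (forall x, (f x)%:E <= h x) -> (mu f)%:E <= lint mu h.
Proof. by move=> fh; apply: ereal_sup_ubound; exists f. Qed.

Lemma lint_le mu h (r : \bar R) :
  (forall f, (forall x, (f x)%:E <= h x) -> (mu f)%:E <= r) -> lint mu h <= r.
Proof. by move=> H; apply: ge_ereal_sup => _ [f fh <-]; exact: H. Qed.

Lemma lint_gtNy mu h : minorized h -> -oo < lint mu h.
Proof. by move=> [f0 f0h]; apply: lt_le_trans (lint_ge mu f0h); exact: ltNyr. Qed.

Lemma lint_fin_num mu h : minorized h -> lint mu h < +oo -> lint mu h \is a fin_num.
Proof. by move=> /(lint_gtNy mu) h1 h2; rewrite fin_real// h1. Qed.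

(** The maximum of two minorants of h is again a minorant, so that both suprema are approached by
    one function. [minorized h] excludes the value -oo. *)
Lemma lintD mu nu h : radon_positive mu -> radon_positive nu -> minorized h ->
  lint (mu + nu)%R h = lint mu h + lint nu h.
Proof.
move=> mu0 nu0 [f0 f0h]; apply/eqP; rewrite eq_le; apply/andP; split.
  apply: lint_le => f fh.
  by rewrite radonE EFinD leeD// lint_ge.
have H f1 f2 : (forall x, (f1 x)%:E <= h x) -> (forall x, (f2 x)%:E <= h x) ->
    (mu f1)%:E + (nu f2)%:E <= lint (mu + nu)%R h.
  move=> f1h f2h; apply: (@le_trans _ _ ((mu + nu)%R (Cc_max f1 f2))%:E).
    rewrite radonE EFinD leeD// lee_fin; apply: radon_positive_le => // x.
      by rewrite Cc_maxE le_max lexx.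
    by rewrite Cc_maxE le_max lexx orbT.
  by apply: lint_ge => x; rewrite Cc_maxE EFin_max ge_max f1h f2h.
have := lint_gtNy (mu + nu)%R (ex_intro _ f0 f0h).
case: (lint (mu + nu)%R h) H => [l| |//] H _; last by rewrite leey.
have nule f1 : (forall x, (f1 x)%:E <= h x) -> lint nu h <= l%:E - (mu f1)%:E.
  by move=> f1h; apply: lint_le => f2 f2h; rewrite leeBrDr// addeC; exact: H.
have nufin : lint nu h \is a fin_num.
  apply: lint_fin_num; first by exists f0.
  by apply: le_lt_trans (nule _ f0h) _; rewrite -EFinB ltry.
rewrite -leeBrDr//; apply: lint_le => f1 f1h.
by rewrite leeBrDr// addeC -leeBrDr//; exact: nule.
Qed.

Lemma lintZ (a : R) mu h : (0 < a)%R -> lint (a *: mu)%R h = a%:E * lint mu h.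
Proof.
have le b nu : (0 < b)%R -> lint (b *: nu)%R h <= b%:E * lint nu h.
  move=> b0; apply: lint_le => f fh.
  by rewrite radonE EFinM lee_pmul2l// lint_ge.
move=> a0; apply/eqP; rewrite eq_le le//=.
rewrite -{1}(scale1r mu) -(@mulVf _ a) ?gt_eqF// -scalerA.
rewrite -lee_pdivlMl// (le_trans (le _ _ _))// ?invr_gt0//.
Qed.

Lemma lint0 h : minorized h -> lint (0 : radon R X)%R h = 0.
Proof.
move=> [f0 f0h]; apply/eqP; rewrite eq_le; apply/andP; split.
  by apply: lint_le => f _; rewrite radon0E.
by apply: le_trans (lint_ge _ f0h); rewrite radon0E.
Qed.

Lemma lint_part mu nu h : radon_positive mu -> radon_positive nu -> minorized h ->
  lint (mu + nu)%R h < +oo -> lint mu h < +oo /\ lint nu h < +oo.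
Proof.
move=> mu0 nu0 hm; rewrite lintD//.
have := lint_gtNy mu hm; have := lint_gtNy nu hm.
by case: (lint mu h) => [?||]; case: (lint nu h) => [?||]//=; rewrite !ltry.
Qed.

Lemma minorized_ge0 h : (forall x, 0 <= h x) -> minorized h.
Proof. by move=> h0; exists 0%R => x; exact: h0. Qed.

End lower_integral.

Lemma lte_EFin_between (R : realType) (r : R) (x : \bar R) : (r%:E < x)%E ->
  exists2 s : R, r < s & (s%:E < x)%E.
Proof.
case: x => [t||] //= rt; last by exists (r + 1); rewrite ?ltrDl ?ltry.
rewrite lte_fin in rt; exists ((r + t) / 2); first by lra.
by rewrite lte_fin; lra.
Qed.

Section kernel.
Context (R : realType) (X : topologicalType).
Hypotheses (hX : hausdorff_space X) (lcX : locally_compact [set: X]).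
Variable kappa : X * X -> \bar R.
Hypothesis hkappa : potential_kernel kappa.
Implicit Types (mu nu : radon R X) (F : Cc R (X * X)%type).
Local Open Scope ereal_scope.

(** On a compact space constants have compact support, and a lower semicontinuous function without
    the value -oo is bounded below there. *)
Lemma kernel_minorized : minorized kappa.
Proof.
have [lsck kNy [kX|k0]] := hkappa; last exact: minorized_ge0.
have kXX : compact [set: X * X] by rewrite -setXTT; exact: compact_setX.
have [||||||n _ Hn] := @compact_directed _ [set: X * X] nat setT
    (fun n z => (- n%:R)%:E < kappa z) leq kXX.
- by exists 0%N.
- by [].
- by move=> s t u; exact: leq_trans.
- by move=> s t _ _; exists (maxn s t); rewrite leq_maxl leq_maxr.
- move=> s t z _ _ st; apply: le_lt_trans.
  by rewrite lee_fin lerN2 ler_nat.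
- move=> z _; have [n nz] : exists n : nat, (- n%:R)%:E < kappa z.
    have := kNy z; case: (kappa z) => [r| |//] _; last by exists 0%N; rewrite ltry.
    exists (Num.truncn `|r|).+1; rewrite lte_fin ltrNl.
    by rewrite (le_lt_trans (ler_norm _))// normrN truncnS_gt.
  exists n => //; have [V nV VP] := lsck _ _ nz.
  exact: filterS nV.
have cP : (fun=> - n%:R : R)%R \in @is_Cc R (X * X)%type.
  by apply/mem_set; split; [exact: cst_continuous|exists setT => // z []].
by exists (MkCc cP) => z /=; rewrite ltW//; exact: Hn.
Qed.

(** A multiple of a product of two bumps is added to F0, supported where F0 plus that multiple still
    lies below the kernel. *)
Lemma kernel_approx F0 (x y : X) (r : R) : (forall z, (F0 z)%:E <= kappa z) ->
  r%:E < kappa (x, y) ->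
  exists F, [/\ forall z, (F0 z <= F z)%R, forall z, (F z)%:E <= kappa z &
     (r < F (x, y))%R].
Proof.
move=> F0k rk; have [rF|Fr] := ltP r (F0 (x, y)); first by exists F0.
have [r2 rr2 r2k] := lte_EFin_between rk.
(* This c raises F0 at (x, y) to the midpoint of r and r2; nearby, F0 + c stays below r2. *)
pose c := ((r + r2) / 2 - F0 (x, y))%R.
have c0 : (0 <= c)%R by rewrite /c; lra.
have [lsck _ _] := hkappa.
have [V nV Vk] := lsck _ _ r2k.
have : \forall z \near (x, y), (F0 z + c < r2)%R /\ V z.
  have : \forall z \near (x, y), (F0 z < F0 (x, y) + (r2 - r) / 2)%R.
    by apply: Cc_near_lt; lra.
  by move: nV; apply: filterS2 => z Vz Fz; split=> //; rewrite /c; lra.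
move=> [[A B] /= [nA nB] AB].
move: nA nB; rewrite !nbhsE => -[A' [oA Ax] A'A] [B' [oB By] B'B].
have [f [fx f01 f0]] := Cc_bump R hX lcX oA Ax.
have [k [ky k01 k0]] := Cc_bump R hX lcX oB By.
have fk0 z : (0 <= Cc_prod f k z)%R.
  by rewrite Cc_prodE; have /andP[? _] := f01 z.1; have /andP[? _] := k01 z.2; exact: mulr_ge0.
exists (F0 + c *: Cc_prod f k)%R; split.
- by move=> z; rewrite !CcE lerDl mulr_ge0.
- move=> z; rewrite !CcE.
  have [Az|nAz] := pselect (A' z.1); last by rewrite Cc_prodE f0// mul0r mulr0 addr0.
  have [Bz|nBz] := pselect (B' z.2); last by rewrite Cc_prodE k0// !mulr0 addr0.
  have [|Fz Vz] := AB z; first by split; [exact: A'A|exact: B'B].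
  apply: le_trans (ltW (Vk _ Vz)); rewrite lee_fin (le_trans _ (ltW Fz))// lerD2l.
  rewrite ler_piMr// Cc_prodE; have /andP[? ?] := f01 z.1; have /andP[? ?] := k01 z.2.
  exact: mulr_ile1.
- by rewrite !CcE Cc_prodE/= fx ky /c; lra.
Qed.

Definition lpot nu (x : X) : \bar R := lint nu (fun y => kappa (x, y)).

Lemma lpot_ge nu F x : (forall z, (F z)%:E <= kappa z) ->
  (radon_slice nu F x)%:E <= lpot nu x.
Proof. by move=> Fk; apply: lint_ge => y; exact: Fk. Qed.

Lemma lpot_minorized nu : minorized (lpot nu).
Proof.
have [F0 F0k] := kernel_minorized; exists (radon_slice nu F0) => x.
exact: lpot_ge.
Qed.

Section minorant.
Variable F0 : Cc R (X * X)%type.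
Hypothesis F0k : forall z, (F0 z)%:E <= kappa z.

(** Fixing the lower bound F0 gives the directed family the common minorant that [dini] requires. *)
Let D : set (Cc R (X * X)%type) :=
  [set F | (forall z, (F0 z <= F z)%R) /\ forall z, (F z)%:E <= kappa z].

Let D0 : D !=set0.
Proof. by exists F0; split. Qed.

Let D_max F G : D F -> D G -> D (Cc_max F G).
Proof.
move=> [F0F Fk] [F0G Gk]; split=> z; rewrite Cc_maxE; first by rewrite le_max F0F.
by rewrite EFin_max ge_max Fk Gk.
Qed.

Let lpot_approx nu x (r : R) : radon_positive nu -> r%:E < lpot nu x ->
  exists2 F, D F & (r < radon_slice nu F x)%R.
Proof.
move=> nu0 /ereal_sup_gt[_ [f fk <-]]; rewrite lte_fin => rf.
have e0 : (0 < (nu f - r) / 2)%R by lra.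
have [||||F DF [f' f'F nf']] := @dini R X hX lcX nu (Cc R (X * X)%type) D
   (fun F y => (F (x, y))%:E) (Cc_slice F0 x) f _ nu0 D0 _ _ _ _ e0.
- move=> F DF y a; rewrite lte_fin => aF.
  exists [set y | (a < F (x, y))%R]; last by move=> ?.
  exact: (@Cc_near_gt _ _ (Cc_slice F x)).
- by move=> F y [F0F _]; rewrite lee_fin; exact: F0F.
- move=> F G DF DG; exists (Cc_max F G); split; first exact: D_max.
    by move=> y; rewrite lee_fin Cc_maxE le_max lexx.
  by move=> y; rewrite lee_fin Cc_maxE le_max lexx orbT.
- move=> y s sf; have sk : s%:E < kappa (x, y) by apply: lt_le_trans (fk y); rewrite lte_fin.
  by have [F [F0F Fk sF]] := kernel_approx F0k sk; exists F.
exists F => //; apply: (@lt_le_trans _ _ (nu f')); first lra.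
by apply: radon_positive_le => // y; rewrite -lee_fin; exact: f'F.
Qed.

Lemma lpot_lsc_from nu : radon_positive nu -> lower_semicontinuous (lpot nu).
Proof.
move=> nu0 x a /(lpot_approx nu0)[F [_ Fk] aF].
exists [set x | (a < radon_slice nu F x)%R]; first exact: Cc_near_gt.
by move=> y /= aFy; apply: lt_le_trans (lpot_ge nu y Fk); rewrite lte_fin.
Qed.

(** The potential is the directed supremum of the continuous functions [radon_slice nu F], by
    [lpot_approx]; a second use of [dini] takes this supremum out of the integral with respect to
    mu. *)
Lemma tonelli_from mu nu : radon_positive mu -> radon_positive nu ->
  lint (tensor mu nu) kappa = lint mu (lpot nu).
Proof.
move=> mu0 nu0; apply/eqP; rewrite eq_le; apply/andP; split.
  by apply: lint_le => F Fk; rewrite tensorE; apply: lint_ge => x; exact: lpot_ge.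
apply: lint_le => f fu; apply/lee_addgt0Pr => e e0.
have [||||F [_ DF] [f' f'F nf']] := @dini R X hX lcX mu (Cc R (X * X)%type) D
   (fun F x => (radon_slice nu F x)%:E) (radon_slice nu F0) f _ mu0 D0 _ _ _ _ e0.
- move=> F DF x a; rewrite lte_fin => aF.
  exists [set x | (a < radon_slice nu F x)%R]; last by move=> ?.
  exact: Cc_near_gt.
- move=> F x [F0F _]; rewrite lee_fin.
  by apply: radon_positive_le => // y; exact: F0F.
- move=> F G DF DG; exists (Cc_max F G); split; first exact: D_max.
    move=> x; rewrite lee_fin; apply: radon_positive_le => // y.
    by change (F (x, y) <= Cc_max F G (x, y))%R; rewrite Cc_maxE le_max lexx.
  move=> x; rewrite lee_fin; apply: radon_positive_le => // y.
  by change (G (x, y) <= Cc_max F G (x, y))%R; rewrite Cc_maxE le_max lexx orbT.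
- move=> x s sf; apply: lpot_approx => //.
  by apply: lt_le_trans (fu x); rewrite lte_fin.
rewrite -leeBlDr// -EFinB; apply: (@le_trans _ _ (tensor mu nu F)%:E); last exact: lint_ge.
rewrite lee_fin tensorE (le_trans nf')//.
by apply: radon_positive_le => // x; rewrite -lee_fin; exact: f'F.
Qed.

End minorant.

Lemma lpot_lsc nu : radon_positive nu -> lower_semicontinuous (lpot nu).
Proof. by have [F0 F0k] := kernel_minorized; exact: (lpot_lsc_from F0k). Qed.

Lemma tonelli mu nu : radon_positive mu -> radon_positive nu ->
  lint (tensor mu nu) kappa = lint mu (lpot nu).
Proof. by have [F0 F0k] := kernel_minorized; exact: (tonelli_from F0k). Qed.

Lemma lint_tensorC mu nu : (forall x y, kappa (x, y) = kappa (y, x)) ->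
  lint (tensor mu nu) kappa = lint (tensor nu mu) kappa.
Proof.
move=> sk; have le m n : lint (tensor m n) kappa <= lint (tensor n m) kappa.
  apply: lint_le => F Fk; rewrite -tensor_swap//; apply: lint_ge => -[x y].
  by rewrite sk; exact: Fk.
by apply/eqP; rewrite eq_le !le.
Qed.

End kernel.

(** * Restrictions to compact sets *)

Section restriction.
Context (R : realType) (X : topologicalType).
Implicit Types (mu nu : radon R X) (f h w : Cc R X) (K L A : set X).

(* mu >= 0, and the support of mu lies in the closure of L. *)
Definition carried mu L :=
  forall f, (forall x, L x -> 0 <= f x) -> 0 <= mu f.

Lemma carried_positive mu L : carried mu L -> radon_positive mu.
Proof. by move=> c f f0; apply: c => x _. Qed.

Lemma carried_le mu L f h : carried mu L -> (forall x, L x -> f x <= h x) -> mu f <= mu h.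
Proof.
move=> c fh; rewrite -subr_ge0 -radonB; apply: c => x Lx.
by rewrite CcBE subr_ge0 fh.
Qed.

(** J is extended through differences of positive functions. Domination by mu supplies the bound on
    each compact set, since both parts of f are bounded by |f|; hence the constant M + M. *)
Lemma radon_extend (J : Cc R X -> R) mu : radon_positive mu ->
  (forall f, (forall x, 0 <= f x) -> 0 <= J f <= mu f) ->
  (forall f h, (forall x, 0 <= f x) -> (forall x, 0 <= h x) -> J (f + h) = J f + J h) ->
  (forall (a : R) f, 0 < a -> (forall x, 0 <= f x) -> J (a *: f) = a * J f) ->
  exists nu, forall f, (forall x, 0 <= f x) -> nu f = J f.
Proof.
move=> mu0 Jmu JD JZ.
pose p f := Cc_max f 0; pose n f := Cc_max (- f) 0.
have p0 f x : 0 <= p f x by rewrite Cc_maxE le_max lexx orbT.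
have n0 f x : 0 <= n f x by rewrite Cc_maxE le_max lexx orbT.
have pn f x : f x = p f x - n f x.
  by rewrite /p /n !Cc_maxE CcNE Cc0E; case: (leP (f x) 0) => f0;
    [rewrite max_l ?oppr_ge0// sub0r opprK|rewrite max_r ?subr0// oppr_le0 ltW].
pose ext f := J (p f) - J (n f).
have extB (u v : Cc R X) : (forall x, 0 <= u x) -> (forall x, 0 <= v x) -> ext (u - v) = J u - J v.
  move=> u0 v0; have H : p (u - v) + v = u + n (u - v).
    by apply: Cc_ext => x; rewrite !CcDE; have := pn (u - v) x; rewrite CcBE; lra.
  have : J (p (u - v)) + J v = J u + J (n (u - v)) by rewrite -!JD// H.
  by rewrite /ext; lra.
have addp (u v : Cc R X) : (forall x, 0 <= u x) -> (forall x, 0 <= v x) -> forall x, 0 <= (u + v : Cc R X) x.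
  by move=> u0 v0 x; rewrite CcDE addr_ge0.
have J0 : J 0 = 0.
  by apply/eqP; rewrite eq_le andbC; have := Jmu 0 (fun x => lexx _); rewrite radon0.
have JZ0 (a : R) (u : Cc R X) : 0 <= a -> (forall x, 0 <= u x) -> J (a *: u) = a * J u.
  rewrite le_eqVlt => /predU1P[<- _|]; last exact: JZ.
  by rewrite scale0r mul0r.
have scp (a : R) (u : Cc R X) : 0 <= a -> (forall x, 0 <= u x) -> forall x, 0 <= (a *: u : Cc R X) x.
  by move=> a0 u0 x; rewrite CcZE mulr_ge0.
have pnE f : f = p f - n f by apply: Cc_ext => x; rewrite CcBE.
have extP : ext \in @is_radon R X.
  apply/mem_set; split.
    move=> a f h; rewrite {1}(pnE f) {1}(pnE h).
    have [a0|/ltW a0] := leP 0 a.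
      have -> : a *: (p f - n f) + (p h - n h) = (a *: p f + p h) - (a *: n f + n h).
        by rewrite scalerBr addrACA opprD.
      rewrite extB; [|by apply: addp => //; exact: scp..].
      rewrite (JD _ _ (scp _ _ a0 (p0 f)) (p0 h)) (JD _ _ (scp _ _ a0 (n0 f)) (n0 h)).
      by rewrite !JZ0// /ext; ring.
    rewrite -oppr_ge0 in a0.
    have -> : a *: (p f - n f) + (p h - n h) = (- a *: n f + p h) - (- a *: p f + n h).
      generalize (p f) (n f) (p h) (n h) => P N P' N'.
      by apply: Cc_ext => x; rewrite !(CcBE, CcDE, CcZE); ring.
    rewrite extB; [|by apply: addp => //; exact: scp..].
    rewrite (JD _ _ (scp _ _ a0 (n0 f)) (p0 h)) (JD _ _ (scp _ _ a0 (p0 f)) (n0 h)).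
    by rewrite !JZ0// /ext; ring.
  move=> K kK; have [M HM] := radon_bounded mu kK; exists (M + M) => f c f0 fc.
  have fle (u : Cc R X) : (forall x, `|u x| <= `|f x|) -> mu u <= M * c.
    move=> uf; rewrite (le_trans (ler_norm _))// HM// => x.
      by move=> /f0 fx; apply/eqP; rewrite -normr_le0 -(normr0 R) -fx.
    exact: le_trans (fc x).
  have /andP[pJ0 pJ] := Jmu _ (p0 f); have /andP[nJ0 nJ] := Jmu _ (n0 f).
  have pf : mu (p f) <= M * c.
    apply: fle => x; rewrite /p Cc_maxE Cc0E.
    by case: (leP (f x) 0); rewrite ?normr0.
  have nf : mu (n f) <= M * c.
    apply: fle => x; rewrite /n Cc_maxE Cc0E CcNE.
    by case: (leP (- f x) 0); rewrite ?normr0 ?normrN.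
  rewrite /ext (le_trans (ler_normB _ _))// !ger0_norm// mulrDl.
  by rewrite lerD//; [exact: le_trans pf|exact: le_trans nf].
exists (MkRadon extP) => f f0 /=.
have : ext (f - 0) = J f - J 0 by exact: extB.
by rewrite subr0 J0 subr0.
Qed.

(* For L closed, nu is the measure 1_L mu. *)
Definition is_restriction mu L nu :=
  [/\ carried nu L, radon_positive (mu - nu) &
   forall f (r : R), (forall x, 0 <= f x) ->
     (forall h, (forall x, 0 <= h x) -> (forall x, L x -> f x <= h x) -> r <= mu h) ->
     r <= nu f].

(** For f >= 0 the value nu f is the infimum of mu h over h >= 0 with h >= f on L, that is, an upper
    integral of f over L. *)
Lemma ex_restriction mu L : radon_positive mu -> exists nu, is_restriction mu L nu.
Proof.
move=> mu0.
pose S f := [set mu h | h in [set h : Cc R X | (forall x, 0 <= h x) /\ forall x, L x -> f x <= h x]].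
have Sf f : (forall x, 0 <= f x) -> S f (mu f) by move=> f0; exists f.
have Slb f : lbound (S f) 0 by move=> _ [h [h0 _] <-]; exact: mu0.
pose J f := inf (S f).
have J_le f h : (forall x, 0 <= h x) -> (forall x, L x -> f x <= h x) -> J f <= mu h.
  by move=> h0 fh; apply: ge_inf; [exists 0; exact: Slb|exists h].
have le_J f r : (forall x, 0 <= f x) ->
    (forall h, (forall x, 0 <= h x) -> (forall x, L x -> f x <= h x) -> r <= mu h) -> r <= J f.
  move=> f0 H; apply: lb_le_inf; first by exists (mu f); exact: Sf.
  by move=> _ [h [h0 fh] <-]; exact: H.
have J0 f : (forall x, 0 <= f x) -> 0 <= J f by move=> f0; apply: (le_J) => // h h0 _; exact: mu0.
have [|||nu nuE] := @radon_extend J mu mu0.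
- by move=> f f0; rewrite J0//= J_le.
- move=> f g f0 g0; apply/eqP; rewrite eq_le; apply/andP; split; last first.
    apply: (le_J) => [x|h h0 fgh]; first by rewrite CcDE addr_ge0.
    (* On L the minimum of h and f equals f, and what remains of h dominates g. *)
    rewrite -[h](subrK (Cc_min h f)) radonD addrC lerD//; apply: J_le => x.
    + by rewrite CcBE Cc_minE subr_ge0 ge_min lexx.
    + move=> Lx; rewrite CcBE Cc_minE; have := fgh x Lx; rewrite CcDE.
      by have := g0 x; case: (leP (h x) (f x)); lra.
    + by rewrite Cc_minE le_min h0 f0.
    + move=> Lx; rewrite Cc_minE le_min lexx andbT.
      by have := fgh x Lx; have := g0 x; rewrite CcDE; lra.
  rewrite -lerBlDr; apply: (le_J) => // h h0 fh.
  rewrite lerBlDr -lerBlDl; apply: (le_J) => // k k0 gk.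
  rewrite lerBlDl -radonD; apply: J_le => x; first by rewrite CcDE addr_ge0.
  by move=> Lx; rewrite !CcDE lerD ?fh ?gk.
- have le (b : R) f : 0 < b -> (forall x, 0 <= f x) -> J (b *: f) <= b * J f.
    move=> b0 f0; rewrite -ler_pdivrMl//; apply: (le_J) => // h h0 fh.
    rewrite ler_pdivrMl// -radonZ; apply: J_le => x; first by rewrite CcZE mulr_ge0// ltW.
    by move=> Lx; rewrite !CcZE ler_pM2l// fh.
  move=> a f a0 f0; apply/eqP; rewrite eq_le le//=.
  rewrite -ler_pdivlMl// -{1}(scale1r f) -(@mulVf _ a) ?gt_eqF// -scalerA le ?invr_gt0//.
  by move=> x; rewrite CcZE mulr_ge0// ltW.
exists nu; split.
- move=> f fL; have [p0 n0] : (forall x, 0 <= Cc_max f 0 x) /\ (forall x, 0 <= Cc_max (- f) 0 x).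
    by split=> x; rewrite Cc_maxE le_max lexx orbT.
  have -> : f = Cc_max f 0 - Cc_max (- f) 0.
    apply: Cc_ext => x; rewrite CcBE !Cc_maxE CcNE Cc0E.
    by case: (leP (f x) 0) => h; [rewrite max_l ?oppr_ge0// sub0r opprK|rewrite max_r ?subr0// oppr_le0 ltW].
  rewrite radonB subr_ge0 !nuE// (@le_trans _ _ 0) ?J0//.
  rewrite -(radon0 mu); apply: J_le => // x Lx.
  by rewrite Cc_maxE CcNE Cc0E ge_max oppr_le0 fL//= lexx.
- by move=> f f0; rewrite radonBE subr_ge0 nuE//; apply: J_le.
- by move=> f r f0 H; rewrite nuE//; exact: le_J.
Qed.

(** Divided by its bound, f lies below the indicator of an open set of arbitrarily small measure. *)
Lemma negligible_vanish mu A f : radon_positive mu -> locally_negligible mu A ->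
  (forall x, 0 <= f x) -> (forall x, ~ A x -> f x = 0) -> mu f = 0.
Proof.
move=> mu0 nA f0 fA; apply/eqP; rewrite eq_le mu0// andbT; apply/ler_addgt0Pr => e e0.
have [K [c [kK fK fc]]] := Cc_bounded f.
have c0 : 0 < `|c| + 1 by rewrite ltr_wpDl.
have : (Defs.outer_measure mu (K `&` A) < (e / (`|c| + 1))%:E)%E.
  by rewrite nA// lte_fin divr_gt0.
move/ereal_inf_lt => [_ [U [oU KU] <-]] lt.
have : ((mu ((`|c| + 1)^-1 *: f))%:E <= lint mu (fun x => (\1_U x)%:E))%E.
  apply: lint_ge => x; rewrite CcZE lee_fin.
  have [Kx|nKx] := pselect (K x); last by rewrite fK// mulr0 ler0n.
  have [Ax|nAx] := pselect (A x); last by rewrite fA// mulr0 ler0n.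
  rewrite indicE mem_set; last exact: KU.
  rewrite mulrC ler_pdivrMr// mul1r (le_trans (ler_norm _))// (le_trans (fc x))//.
  by rewrite (le_trans (ler_norm _))// lerDl.
move=> /le_lt_trans/(_ lt); rewrite lte_fin radonZ mulrC ltr_pM2r ?invr_gt0// add0r.
exact: ltW.
Qed.

Lemma Mplus_carried mu A : Mplus A mu -> carried mu A.
Proof.
move=> [mu0 nA] f fA.
have -> : f = Cc_max f 0 - Cc_max (- f) 0.
  apply: Cc_ext => x; rewrite CcBE !Cc_maxE CcNE Cc0E.
  by case: (leP (f x) 0) => h; [rewrite max_l ?oppr_ge0// sub0r opprK|rewrite max_r ?subr0// oppr_le0 ltW].
rewrite radonB (negligible_vanish mu0 nA (f := Cc_max (- f) 0)) ?subr0.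
- by apply: mu0 => x; rewrite Cc_maxE le_max lexx orbT.
- by move=> x; rewrite Cc_maxE le_max lexx orbT.
- by move=> x /contrapT Ax; rewrite Cc_maxE CcNE Cc0E max_r// oppr_le0 fA.
Qed.

(** For closed L the complement is itself an admissible open set in the outer measure, and every
    minorant of its indicator is at most 0 on L. *)
Lemma carried_Mplus mu L A : closed L -> L `<=` A -> carried mu L -> Mplus A mu.
Proof.
move=> cL LA c; have mu0 := carried_positive c; split => // K kK.
apply/eqP; rewrite eq_le; apply/andP; split.
  apply: (@le_trans _ _ (lint mu (fun x => (\1_(~` L) x)%:E))).
    apply: ereal_inf_lbound; exists (~` L) => //; split; first exact: closed_openC.
    by move=> x [_ nA] /LA.
  apply: lint_le => f fL; rewrite lee_fin -(radon0 mu).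
  apply: (carried_le c) => x Lx; rewrite Cc0E -lee_fin (le_trans (fL x))//.
  by rewrite indicE memNset//; exact.
apply: le_ereal_inf_tmp => _ [U _ <-].
have -> : (0 = (mu 0)%:E)%E by rewrite radon0.
by apply: lint_ge => x; rewrite lee_fin.
Qed.

Hypothesis hX : hausdorff_space X.

(** Local negligibility yields an open U of small measure that contains the points of K outside A;
    hence K minus U is a compact subset of A. *)
Lemma Mplus_approx mu A f (e : R) : Mplus A mu -> (forall x, 0 <= f x) -> 0 < e ->
  exists K nu, [/\ compact K, K `<=` A, is_restriction mu K nu & (mu - nu) f <= e].
Proof.
move=> [mu0 nA] f0 e0.
have [K [c [kK fK fc]]] := Cc_bounded f.
have c0 : 0 < `|c| + 1 by rewrite ltr_wpDl.
have : (Defs.outer_measure mu (K `&` ~` A) < (e / (`|c| + 1))%:E)%E.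
  by rewrite nA// lte_fin divr_gt0.
move/ereal_inf_lt => [_ [U [oU KU] <-]] lt.
have kL : compact (K `\` U).
  apply: (subclosed_compact _ kK); last by move=> x [].
  rewrite setDE; apply: closedI; first exact: compact_closed.
  exact: open_closedC.
have [nu nuP] := ex_restriction (K `\` U) mu0.
exists (K `\` U), nu; split => //.
  by move=> x [Kx nUx]; apply: contrapT => nAx; apply: nUx; exact: KU.
have [_ _ H] := nuP; rewrite radonBE lerBlDl -lerBlDr; apply: H => // h h0 fh.
rewrite lerBlDr -lerBlDl -radonB.
have : ((mu ((`|c| + 1)^-1 *: (f - h)))%:E <= lint mu (fun x => (\1_U x)%:E))%E.
  apply: lint_ge => x; rewrite CcZE CcBE lee_fin mulrC ler_pdivrMr//.
  have [Ux|nUx] := pselect (U x).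
    rewrite indicE mem_set// mul1r; have := fc x; have := ler_norm (f x).
    by have := h0 x; have := ler_norm c; lra.
  rewrite indicE memNset// mul0r subr_le0.
  by have [Kx|nKx] := pselect (K x); [exact: fh|rewrite fK].
move=> /le_lt_trans/(_ lt); rewrite lte_fin radonZ mulrC ltr_pM2r ?invr_gt0//.
exact: ltW.
Qed.

End restriction.

(** * Integration against measures with compact carriers *)

Section carried_integral.
Context (R : realType) (X : topologicalType).
Hypotheses (hX : hausdorff_space X) (lcX : locally_compact [set: X]).
Implicit Types (lam nu : radon R X) (f h w chi : Cc R X) (K L : set X).

(** A minorant of u on the whole space is needed, while f lies below u on K only. Therefore f - d is
    glued to a global minorant u0 by a function psi supported in the open set where f - d < u. *)
Lemma lint_carried_ge lam K f (u : X -> \bar R) : compact K -> carried lam K ->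
  lower_semicontinuous u -> minorized u ->
  (forall x, K x -> ((f x)%:E <= u x)%E) -> ((lam f)%:E <= lint lam u)%E.
Proof.
move=> kK clam lu [u0 u0u] fu; have lam0 := carried_positive clam.
have [chi [chi1 chi01]] := Cc_cutoff R hX lcX kK.
have chi0 : 0 <= lam chi by apply: lam0 => x; have /andP[] := chi01 x.
apply/lee_addgt0Pr => e e0.
pose d := e / (lam chi + 1).
have d0 : 0 < d by rewrite divr_gt0// ltr_wpDl.
pose O := [set x | ((f x - d)%:E < u x)%E].
have oO : open O.
  rewrite openE => x Ox; have [r fr ru] := lte_EFin_between Ox.
  have [V nV Vu] := lu _ _ ru.
  have : \forall y \near x, f y < r + d by apply: Cc_near_lt; lra.
  move: nV; apply: filterS2 => y Vy fy; apply: lt_trans (Vu _ Vy).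
  by rewrite lte_fin; lra.
have KO : K `<=` O.
  move=> x Kx; apply: lt_le_trans (fu x Kx).
  by rewrite lte_fin ltrBlDr ltrDl.
have [psi [psi1 psi01 psi0]] := Cc_urysohn R hX lcX kK oO KO.
pose t x := Num.max (f x - d - u0 x) 0.
have ct : continuous t.
  move=> x; apply: (@continuous_max _ _ (fun x => f x - d - u0 x) (fun=> 0)).
    by apply: cvgB; [apply: cvgB; [exact: Cc_cont|exact: cvg_cst]|exact: Cc_cont].
  exact: cst_continuous.
(* Where psi = 1 this is the maximum of u0 and f - d; elsewhere it lies between u0 and that
   maximum. *)
pose q := u0 + Cc_mul ct psi.
have qu x : ((q x)%:E <= u x)%E.
  rewrite CcDE Cc_mulE.
  have [Ox|nOx] := pselect (O x); last by rewrite psi0// mulr0 addr0.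
  apply: (@le_trans _ _ (Num.max (f x - d) (u0 x))%:E).
    rewrite lee_fin; have /andP[p0 p1] := psi01 x.
    have t0 : 0 <= t x by rewrite le_max lexx orbT.
    apply: (@le_trans _ _ (u0 x + t x)); first by rewrite lerD2l ler_piMr.
    by rewrite /t; case: (leP (f x - d - u0 x) 0) => H; rewrite le_max; apply/orP; [right|left]; lra.
  by rewrite EFin_max ge_max u0u andbT ltW.
apply: (@le_trans _ _ ((lam q)%:E + e%:E)%E); last by rewrite leeD2r// lint_ge.
rewrite -EFinD lee_fin -lerBlDr.
apply: (@le_trans _ _ (lam (f - d *: chi))).
  rewrite radonB radonZ lerD2l lerN2 /d mulrAC ler_pdivrMr ?ltr_wpDl//.
  by rewrite ler_pM2l// lerDl.
apply: (carried_le clam) => x Kx; rewrite CcBE CcZE CcDE Cc_mulE chi1// psi1// !mulr1.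
by rewrite /t; case: (leP (f x - d - u0 x) 0); lra.
Qed.

(** This turns the integral of g, which need not have compact support, into the value of lam at a
    test function. *)
Lemma lint_carried_cont lam K chi (k : X -> R) (ck : continuous k) :
  carried lam K -> (forall x, 0 <= k x) ->
  (forall x, K x -> chi x = 1) -> (forall x, 0 <= chi x <= 1) ->
  lint lam (fun x => (k x)%:E) = (lam (Cc_mul ck chi))%:E.
Proof.
move=> clam k0 chi1 chi01; apply/eqP; rewrite eq_le; apply/andP; split.
  apply: lint_le => f fk; rewrite lee_fin; apply: (carried_le clam) => x Kx.
  by rewrite Cc_mulE chi1// mulr1 -lee_fin.
by apply: lint_ge => x; rewrite Cc_mulE lee_fin ler_piMr//; have /andP[] := chi01 x.
Qed.

(* A Chebyshev estimate: f <= u has almost the integral of u, hence u - f <= d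
   off a small open set. *)
Lemma carried_truncate lam K f (u : X -> \bar R) (d : R) :
  compact K -> carried lam K -> lower_semicontinuous u ->
  (forall x, ((f x)%:E <= u x)%E) -> 0 < d ->
  (lint lam u <= (lam f + d ^+ 2)%:E)%E ->
  exists L nu, [/\ compact L, L `<=` K, is_restriction lam L nu,
    forall x, L x -> (u x <= (f x + d)%:E)%E &
    forall w (c : R), 0 < c -> (forall x, w x <= c) -> (lam - nu) w <= c * d].
Proof.
move=> kK clam lu fu d0 lamu; have lam0 := carried_positive clam.
pose U := [set x | ((f x + d)%:E < u x)%E].
have oU : open U.
  rewrite openE => x Ux; have [r fr ru] := lte_EFin_between Ux.
  have [V nV Vu] := lu _ _ ru.
  have : \forall y \near x, f y < r - d by apply: Cc_near_lt; lra.
  move: nV; apply: filterS2 => y Vy fy; apply: lt_trans (Vu _ Vy).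
  by rewrite lte_fin; lra.
have kL : compact (K `\` U).
  apply: (subclosed_compact _ kK); last by move=> x [].
  rewrite setDE; apply: closedI; first exact: compact_closed.
  exact: open_closedC.
have [nu nuP] := ex_restriction (K `\` U) lam0.
exists (K `\` U), nu; split; [exact: kL|by move=> x []|exact: nuP| |].
  by move=> x [_ /negP]; rewrite -leNgt.
move=> w c c0 wc; have [_ sig0 H] := nuP.
apply: (@le_trans _ _ ((lam - nu) (Cc_max w 0))).
  by apply: radon_positive_le => // x; rewrite Cc_maxE le_max lexx.
rewrite radonBE lerBlDr addrC -lerBlDr; apply: H => [x|h h0 wh].
  by rewrite Cc_maxE le_max lexx orbT.
rewrite lerBlDr addrC -lerBlDr -radonB.
pose q := Cc_max (Cc_max w 0 - h) 0.
apply: (@le_trans _ _ (lam q)).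
  by apply: radon_positive_le => // x; rewrite Cc_maxE le_max lexx.
(* On U this holds because u > f + d and q <= c; on the rest of K because q = 0. As f is optimal up
   to d^2, it follows that (d / c) lam q <= d^2. *)
have : ((lam (f + (d / c) *: q))%:E <= lint lam u)%E.
  apply: (lint_carried_ge kK clam lu); first by exists f.
  move=> x Kx; rewrite CcDE CcZE /q !(Cc_maxE _ 0) CcBE Cc_maxE Cc0E.
  have [Ux|nUx] := pselect (U x).
    apply: le_trans (ltW Ux); rewrite lee_fin lerD2l mulrAC ler_pdivrMr// ler_pM2l//.
    rewrite ge_max (ltW c0) andbT lerBlDr.
    by have := h0 x; have := wc x; case: (leP (w x) 0); lra.
  have := wh x (conj Kx nUx); rewrite Cc_maxE Cc0E => whx.
  by rewrite [Num.max (_ - _) 0]max_r ?subr_le0// mulr0 addr0.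
move=> /le_trans/(_ lamu); rewrite lee_fin radonD lerD2l radonZ => Hq.
by rewrite -(ler_pM2l (divr_gt0 d0 c0)) (le_trans Hq)// expr2 mulrA divfK ?gt_eqF.
Qed.

Lemma lint_approx lam (u : X -> \bar R) f0 (e : R) : radon_positive lam ->
  (forall x, ((f0 x)%:E <= u x)%E) -> (lint lam u < +oo)%E -> 0 < e ->
  exists f, [/\ forall x, f0 x <= f x, forall x, ((f x)%:E <= u x)%E &
    (lint lam u <= (lam f + e)%:E)%E].
Proof.
move=> lam0 f0u lamoo e0.
have fin : lint lam u \is a fin_num by apply: lint_fin_num => //; exists f0.
have := @ub_ereal_sup_adherent _ _ _ e0 fin.
move=> [_ [f fu <-]] lt.
exists (Cc_max f f0); split.
- by move=> x; rewrite Cc_maxE le_max lexx orbT.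
- by move=> x; rewrite Cc_maxE EFin_max ge_max fu f0u.
- have : lam f <= lam (Cc_max f f0).
    by apply: radon_positive_le => // x; rewrite Cc_maxE le_max lexx.
  move: lt; rewrite /lint; move: fin; rewrite /lint.
  set s := ereal_sup _; move: s => [s||]// _.
  by rewrite -EFinB !lte_fin !lee_fin; lra.
Qed.

(* If [\int u - \int v < \int k], then u - v < k on a compact set that carries
   a nonzero part of lam and on which u and v are almost continuous. *)
Lemma carried_null_le lam K (u v : X -> \bar R) (k : X -> R) (ck : continuous k)
    chi (N : set X) :
  compact K -> carried lam K ->
  lower_semicontinuous u -> minorized u -> (lint lam u < +oo)%E ->
  lower_semicontinuous v -> minorized v -> (lint lam v < +oo)%E ->
  (forall x, K x -> chi x = 1) ->
  (forall x (r s : R), K x -> u x = r%:E -> v x = s%:E -> r - s < k x -> N x) ->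
  (forall L nu, compact L -> L `<=` N -> L `<=` K -> carried nu L ->
     radon_positive (lam - nu) -> nu = 0) ->
  lam (Cc_mul ck chi) <= fine (lint lam u) - fine (lint lam v).
Proof.
move=> kK clam lu [u0 u0u] luoo lv [v0 v0v] lvoo chi1 HN Hnull.
have lam0 := carried_positive clam.
have ufin : lint lam u \is a fin_num by apply: lint_fin_num => //; exists u0.
have vfin : lint lam v \is a fin_num by apply: lint_fin_num => //; exists v0.
set a := fine (lint lam u); set b := fine (lint lam v).
have aE : lint lam u = a%:E by rewrite fineK.
have bE : lint lam v = b%:E by rewrite fineK.
apply/ler_addgt0Pr => e e0.
have e20 : 0 < e / 2 by rewrite divr_gt0.
(* The minorant k0 is fixed before d, which depends on its bound c2. The minorant h found later
   depends on d, so its own bound could not enter into the choice of d. *)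
have [k0 [_ k0v k0b]] := lint_approx lam0 v0v lvoo e20.
rewrite bE lee_fin in k0b.
have bnd w : exists2 c : R, 0 < c & forall x, `|w x| <= c.
  have [_ [c [_ _ Hc]]] := Cc_bounded w; exists (`|c| + 1); first by rewrite ltr_wpDl.
  by move=> x; have := Hc x; have := ler_norm c; lra.
have [c1 c10 Hc1] := bnd u0; have [c2 c20 Hc2] := bnd k0.
have [c3 c30 Hc3] := bnd (Cc_mul ck chi).
have [chi' [chi'1 chi'01]] := Cc_cutoff R hX lcX kK.
have M0 : 0 <= lam chi' by apply: lam0 => x; have /andP[] := chi'01 x.
(* The first three terms bound the values of u0, k0 and k chi on the discarded part of lam, the
   fourth is the cost of the slack 2 d; together the errors are at most C d = e / 2. *)
pose C := 2 * c1 + 2 * c2 + 2 * c3 + 2 * lam chi' + 1.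
have C0 : 0 < C by rewrite /C; lra.
pose d := e / 2 / C.
have d0 : 0 < d by rewrite divr_gt0.
have dC : C * d = e / 2 by rewrite /d mulrC divfK// gt_eqF.
have d20 : 0 < d ^+ 2 by rewrite exprn_gt0.
have [f [_ fu fa]] := lint_approx lam0 u0u luoo d20.
have [h [k0h hv hb]] := lint_approx lam0 k0v lvoo d20.
have [L1 [nu1 [kL1 L1K nu1P uf nu1w]]] := carried_truncate kK clam lu fu d0 fa.
have [cnu1 sig10 _] := nu1P.
have nu10 := carried_positive cnu1.
(* Near optimality of h passes from lam to its part nu1, because h is also a minorant for the
   remainder lam - nu1. *)
have hb1 : (lint nu1 v <= (nu1 h + d ^+ 2)%:E)%E.
  have : lint lam v = (lint nu1 v + lint (lam - nu1)%R v)%E.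
    by rewrite -lintD//; [congr (lint _ _); rewrite addrC subrK|exists v0].
  have := lint_ge (lam - nu1) hv; move: hb; rewrite bE radonBE.
  have := @lint_gtNy _ _ nu1 v (ex_intro _ _ v0v).
  case: (lint nu1 v) => [r| |]//; case: (lint (lam - nu1)%R v) => [s| |]//= _.
  by rewrite !lee_fin => H1 H2 [H3]; lra.
have [L2 [nu [kL2 L2L1 nuP vh nuw]]] := carried_truncate kL1 cnu1 lv hv d0 hb1.
have [cnu sig20 _] := nuP.
have nu0 := carried_positive cnu.
have sig (w : Cc R X) (c : R) : 0 < c -> (forall x, `|w x| <= c) -> lam w - nu w <= 2 * c * d.
  move=> c0 wc; have wc' x : w x <= c by rewrite (le_trans (ler_norm _)).
  by have := nu1w w c c0 wc'; have := nuw w c c0 wc'; rewrite !radonBE; lra.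
have signu : radon_positive (lam - nu).
  move=> w w0; have := sig10 w w0; have := sig20 w w0; rewrite !radonBE; lra.
(* On L2 both u and v are finite and u - v <= f - h + d. The slack 2 d therefore makes L' a subset
   of N, and the non-strict inequality makes it closed in L2. *)
pose L' := [set x | L2 x /\ f x - h x + 2 * d <= k x].
have kL' : compact L'.
  apply: (subclosed_compact _ kL2); last by move=> x [].
  have -> : L' = L2 `&` [set x | k x - (f x - h x) >= 2 * d].
    by apply/seteqP; split=> x [L2x H]; split => //; move: H; rewrite /=; lra.
  apply: closedI; first exact: compact_closed.
  apply: (@preimage_closed _ _ (fun x => k x - (f x - h x)) [set r | r >= 2 * d]).
    by move=> x _; apply: cvgB; [exact: ck|exact: (Cc_cont (f - h))].
  exact: closed_ge.
have L'N : L' `<=` N.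
  move=> x [L2x Hx].
  have ux := uf x (L2L1 _ L2x); have vx := vh x L2x; have ux' := fu x; have vx' := hv x.
  move: ux vx ux' vx'; case E1: (u x) => [r||]//; case E2: (v x) => [s||]//.
  rewrite !lee_fin => ? ? ? ?; apply: (HN x r s) => //; first exact: L1K (L2L1 _ L2x).
  by lra.
have [rho [crho sigrho rhoH]] := ex_restriction L' nu0.
have rho0 : rho = 0.
  apply: (Hnull L') => //; first by move=> x [L2x _]; exact: L1K (L2L1 _ L2x).
  by move=> w w0; have := signu w w0; have := sigrho w w0; rewrite !radonBE; lra.
(* Outside L', this is negative on L2, so that a positive value nu D would have to come from the
   restriction of nu to L', which vanishes. *)
pose D := Cc_mul ck chi - (2 * d) *: chi' - (f - h).
have nuD : nu D <= 0.
  apply/ler_addgt0Pr => r r0; rewrite add0r leNgt; apply/negP => Dr.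
  have : r <= rho (Cc_max D 0).
    apply: rhoH => [x|h' h'0 Dh']; first by rewrite Cc_maxE le_max lexx orbT.
    rewrite (le_trans (ltW Dr))//; apply: (carried_le cnu) => x L2x.
    have [L'x|nL'x] := pselect (L' x).
      by rewrite (le_trans _ (Dh' x L'x))// Cc_maxE le_max lexx.
    rewrite (le_trans _ (h'0 x))// /D !CcBE CcZE Cc_mulE.
    have Kx := L1K _ (L2L1 _ L2x); rewrite chi1// chi'1//.
    have [//|lt] := leP (f x - h x + 2 * d) (k x); first by move=> ?; case: nL'x.
    by lra.
  by rewrite rho0 radon0E leNgt r0.
move: nuD; rewrite /D !radonB radonZ => nuD.
have s1 := sig _ _ c10 Hc1; have s2 := sig _ _ c20 Hc2; have s3 := sig _ _ c30 Hc3.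
have chi'nu : nu chi' <= lam chi'.
  by rewrite -subr_ge0 -radonBE; apply: signu => x; have /andP[] := chi'01 x.
have hk0 : nu k0 <= nu h by apply: radon_positive_le.
have s1' : - (2 * c1 * d) <= lam u0 - nu u0.
  have Hc1N x : `|(- u0) x| <= c1 by rewrite CcNE normrN.
  have := sig _ _ c10 Hc1N; rewrite -[- u0]scaleN1r !radonZ; lra.
have fa' : nu f + (lam u0 - nu u0) <= a.
  rewrite -lee_fin -aE.
  have -> : lam = nu + (lam - nu) by rewrite addrC subrK.
  rewrite lintD//; last by exists u0.
  rewrite EFinD leeD//; first exact: lint_ge.
  have -> : (nu + (lam - nu)) u0 - nu u0 = (lam - nu) u0 by rewrite !radonE; lra.
  exact: lint_ge.
have dchi : d * nu chi' <= d * lam chi' by rewrite ler_pM2l.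
move: dC; rewrite /C => dC; lra.
Qed.

End carried_integral.

(** * The energy form *)

Lemma discriminant_le (R : realType) (a b c : R) : 0 <= c ->
  (forall t, 0 <= a - 2 * t * b + t ^+ 2 * c) -> b ^+ 2 <= a * c.
Proof.
rewrite le_eqVlt => /predU1P[<-|c0] H.
  have [->|b0] := eqVneq b 0; first by rewrite mulr0 expr0n.
  (* At this t the expression would be -1. *)
  have := H ((a + 1) / (2 * b)); rewrite mulr0 addr0.
  have -> : 2 * ((a + 1) / (2 * b)) * b = a + 1 by field; rewrite b0.
  by lra.
have := H (b / c).
have -> : a - 2 * (b / c) * b + (b / c) ^+ 2 * c = (a * c - b ^+ 2) / c.
  by field; rewrite gt_eqF.
by rewrite pmulr_lge0 ?invr_gt0// subr_ge0.
Qed.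

Section energy_form.
Context (R : realType) (X : topologicalType).
Hypotheses (hX : hausdorff_space X) (lcX : locally_compact [set: X]).
Variable kappa : X * X -> \bar R.
Hypotheses (hkappa : potential_kernel kappa) (pdkappa : positive_definite kappa).
Implicit Types (mu nu sigma rho : radon R X).

Local Notation lintk T := (lint T%R kappa).

Let kmin : minorized kappa := kernel_minorized hkappa.

Definition pos_finite_energy mu :=
  radon_positive mu /\ (lintk (tensor mu mu) < +oo)%E.
Local Notation Ep := pos_finite_energy.

Let lintk_tensorDl mu mu' nu : radon_positive mu -> radon_positive mu' ->
  radon_positive nu ->
  (lintk (tensor (mu + mu') nu) = lintk (tensor mu nu) + lintk (tensor mu' nu))%E.
Proof. by move=> *; rewrite tensorDl lintD//; exact: tensor_positive. Qed.

Let lintk_tensorDr mu nu nu' : radon_positive mu -> radon_positive nu ->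
  radon_positive nu' ->
  (lintk (tensor mu (nu + nu')) = lintk (tensor mu nu) + lintk (tensor mu nu'))%E.
Proof. by move=> *; rewrite tensorDr lintD//; exact: tensor_positive. Qed.

Let lintk_gtNy T : (-oo < lintk T)%E.
Proof. exact: lint_gtNy. Qed.

Let lte_addy (x y : \bar R) : (-oo < x)%E -> (-oo < y)%E -> (x + y < +oo)%E ->
  (x < +oo)%E /\ (y < +oo)%E.
Proof. by case: x => [x||]; case: y => [y||]//=; rewrite !ltry. Qed.

Let lintk_add_gtNy S T : (-oo < lintk S + lintk T)%E.
Proof.
have := lintk_gtNy S; have := lintk_gtNy T.
by case: (lintk S) => [?||]//; case: (lintk T) => [?||]//= _ _; rewrite ltNyr.
Qed.

Let lintk_parts mu nu : radon_positive mu -> radon_positive nu ->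
  (lintk (tensor (mu + nu) (mu + nu)) < +oo)%E ->
  [/\ (lintk (tensor mu mu) < +oo)%E, (lintk (tensor mu nu) < +oo)%E,
      (lintk (tensor nu mu) < +oo)%E & (lintk (tensor nu nu) < +oo)%E].
Proof.
move=> mu0 nu0; rewrite lintk_tensorDl ?lintk_tensorDr//; last exact: radon_positiveD.
move/lte_addy => [||]; try exact: lintk_add_gtNy.
by move=> /lte_addy[//|//|? ?] /lte_addy[].
Qed.

Lemma pos_finite_energy_part mu nu : radon_positive mu -> radon_positive nu ->
  Ep (mu + nu) -> Ep mu.
Proof. by move=> mu0 nu0 [_ /(lintk_parts mu0 nu0)[]]. Qed.

Lemma pos_finite_energy_le mu nu : radon_positive mu -> radon_positive (nu - mu) ->
  Ep nu -> Ep mu.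
Proof.
move=> mu0 numu0 nuE; apply: (@pos_finite_energy_part mu (nu - mu)) => //.
by rewrite addrC subrK.
Qed.

Let square_pos rho (p := radon_pos rho) (n := radon_neg rho) :
  (lintk (radon_pos (tensor rho rho)) = lintk (tensor p p) + lintk (tensor n n))%E.
Proof.
have [-> _] := tensor_square_jordan hX lcX rho.
by rewrite lintD//; apply: tensor_positive; exact: radon_pos_ge0.
Qed.

Let square_neg rho (p := radon_pos rho) (n := radon_neg rho) :
  (lintk (radon_neg (tensor rho rho)) = lintk (tensor p n) + lintk (tensor n p))%E.
Proof.
have [_ ->] := tensor_square_jordan hX lcX rho.
by rewrite lintD//; apply: tensor_positive; exact: radon_pos_ge0.
Qed.

(* The positive definiteness of kappa, applied to mu - nu. *)
Lemma mutual_fin mu nu : Ep mu -> Ep nu -> lintk (tensor mu nu) \is a fin_num.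
Proof.
move=> muE nuE; have [mu0 _] := muE; have [nu0 _] := nuE.
apply: lint_fin_num => //.
have [_ pd] := pdkappa.
pose rho := mu - nu; pose p := radon_pos rho; pose n := radon_neg rho.
have p0 : radon_positive p by exact: radon_pos_ge0.
have n0 : radon_positive n by exact: radon_neg_ge0.
have pmu : radon_positive (mu - p) by exact: (@radon_pos_le _ _ rho mu nu).
have nnu : radon_positive (nu - n) by exact: (@radon_neg_le _ _ rho mu nu).
have pE := pos_finite_energy_le p0 pmu muE.
have nE := pos_finite_energy_le n0 nnu nuE.
(* The common part s of mu and nu, removed in rho. Its mixed terms with p and n occur in the finite
   energies of mu = p + s and nu = n + s; only those between p and n require positive
   definiteness. *)
have sig : mu - p = nu - n.
  apply/eqP; rewrite subr_eq -addrA [- n + p]addrC [nu + _]addrC -subr_eq.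
  by rewrite radon_pos_neg.
pose s := mu - p.
have muE' : mu = p + s by rewrite /s addrC subrK.
have nuE' : nu = n + s by rewrite /s sig addrC subrK.
have s0 : radon_positive s by [].
clearbody s.
have posfin : (lintk (radon_pos (tensor rho rho)) < +oo)%E.
  by rewrite square_pos lte_add_pinfty//; [case: pE|case: nE].
have : (lintk (radon_neg (tensor rho rho)) < +oo)%E.
  rewrite ltey; apply/eqP => negoo.
  (* With a finite positive part, an infinite negative part would give a defined energy equal to
     -oo. *)
  have : mutual_energy_defined kappa rho rho.
    by move=> [poo _]; rewrite poo ltxx in posfin.
  move/pd; rewrite /energy /mutual_energy /sint negoo.
  by case: (lintk _) posfin => [?||].
rewrite square_neg => /lte_addy[//|//|pn _].
have [_] := muE; rewrite muE' => /(lintk_parts p0 s0)[_ ps _ ss].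
have [_] := nuE; rewrite nuE' => /(lintk_parts n0 s0)[_ _ sn _].
rewrite lintk_tensorDl ?lintk_tensorDr//; last exact: radon_positiveD.
by rewrite !lte_add_pinfty.
Qed.

Definition pos_mutual mu nu : R := fine (lintk (tensor mu nu)).
Local Notation e := pos_mutual.

Lemma pos_mutualE mu nu : Ep mu -> Ep nu -> lintk (tensor mu nu) = (e mu nu)%:E.
Proof. by move=> muE nuE; rewrite fineK//; exact: mutual_fin. Qed.

Lemma pos_mutualC mu nu : e mu nu = e nu mu.
Proof. by rewrite /e lint_tensorC//; case: pdkappa. Qed.

Lemma pos_finite_energyD mu nu : Ep mu -> Ep nu -> Ep (mu + nu).
Proof.
move=> muE nuE; have [mu0 mu1] := muE; have [nu0 nu1] := nuE.
split; first exact: radon_positiveD.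
rewrite lintk_tensorDl ?lintk_tensorDr//; last exact: radon_positiveD.
by rewrite !lte_add_pinfty// (pos_mutualE muE nuE, pos_mutualE nuE muE) ltry.
Qed.

Lemma pos_finite_energy0 : Ep 0.
Proof.
split; first exact: radon_positive0.
by rewrite tensor0l lint0.
Qed.

Lemma pos_finite_energyZ (a : R) mu : 0 <= a -> Ep mu -> Ep (a *: mu).
Proof.
rewrite le_eqVlt => /predU1P[<- _|a0 [mu0 mu1]].
  by rewrite scale0r; exact: pos_finite_energy0.
split; first by apply: radon_positiveZ => //; exact: ltW.
rewrite tensorZl tensorZr !lintZ//.
have := lintk_gtNy (tensor mu mu); move: mu1.
by case: (lintk _) => // r _ _; rewrite -!EFinM ltry.
Qed.

Lemma pos_mutualDl mu mu' nu : Ep mu -> Ep mu' -> Ep nu ->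
  e (mu + mu') nu = e mu nu + e mu' nu.
Proof.
move=> muE mu'E nuE; apply: EFin_inj; rewrite EFinD -!pos_mutualE//; last exact: pos_finite_energyD.
by apply: lintk_tensorDl; [case: muE|case: mu'E|case: nuE].
Qed.

Lemma pos_mutualZl (a : R) mu nu : 0 <= a -> e (a *: mu) nu = a * e mu nu.
Proof.
rewrite le_eqVlt => /predU1P[<-|a0].
  by rewrite scale0r mul0r /e tensor0l lint0.
rewrite /e tensorZl lintZ//; case: (lintk _) => [r||]//=.
  by rewrite gt0_muley ?lte_fin// mulr0.
by rewrite gt0_muleNy ?lte_fin// mulr0.
Qed.

(** The scalar product as a real number, expanded over the Jordan parts of both arguments. Its
    diagonal is identified with the energy in [energy_mutual]. *)
Definition mutual rho sigma : R :=
  (e (radon_pos rho) (radon_pos sigma) - e (radon_neg rho) (radon_pos sigma)) -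
  (e (radon_pos rho) (radon_neg sigma) - e (radon_neg rho) (radon_neg sigma)).
Local Notation B := mutual.

Definition jordan_finite rho := Ep (radon_pos rho) /\ Ep (radon_neg rho).
Local Notation F := jordan_finite.

Lemma jordan_finiteB m1 m2 : Ep m1 -> Ep m2 -> F (m1 - m2).
Proof.
move=> m1E m2E; have [m10 _] := m1E; have [m20 _] := m2E; split.
  apply: (@pos_finite_energy_le _ m1) => //; first exact: radon_pos_ge0.
  exact: (@radon_pos_le _ _ _ m1 m2).
apply: (@pos_finite_energy_le _ m2) => //; first exact: radon_neg_ge0.
exact: (@radon_neg_le _ _ _ m1 m2).
Qed.

Lemma jordan_finite_pos mu : Ep mu -> F mu.
Proof. by move=> muE; rewrite -(subr0 mu); apply: jordan_finiteB => //; exact: pos_finite_energy0. Qed.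

(** Every decomposition into positive measures of finite energy gives the same value, because p + m2
    = m1 + n. Bilinearity rests on this, as Jordan parts are not additive. *)
Let jordan_mutual m1 m2 sigma : Ep m1 -> Ep m2 -> Ep sigma ->
  e (radon_pos (m1 - m2)) sigma - e (radon_neg (m1 - m2)) sigma = e m1 sigma - e m2 sigma.
Proof.
move=> m1E m2E sE; have [pE nE] := jordan_finiteB m1E m2E.
have H : e (radon_pos (m1 - m2)) sigma + e m2 sigma =
    e m1 sigma + e (radon_neg (m1 - m2)) sigma.
  rewrite -!pos_mutualDl//; congr (e _ _); apply/eqP.
  by rewrite -subr_eq addrAC radon_pos_neg subrK.
lra.
Qed.

Let half rho sigma := e (radon_pos rho) sigma - e (radon_neg rho) sigma.

Let halfE rho sigma : B rho sigma = half rho (radon_pos sigma) - half rho (radon_neg sigma).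
Proof. by []. Qed.

Lemma mutualC rho sigma : B rho sigma = B sigma rho.
Proof.
rewrite /B ![e (radon_pos rho) _]pos_mutualC ![e (radon_neg rho) _]pos_mutualC; lra.
Qed.

Lemma mutual_pos mu sigma : Ep mu -> F sigma ->
  B mu sigma = e mu (radon_pos sigma) - e mu (radon_neg sigma).
Proof.
move=> [mu0 _] _; have [p n] := radon_pos_id mu0.
by rewrite /B p n /e !tensor0l !lint0// !subr0.
Qed.

Lemma mutual_pos_pos mu nu : Ep mu -> Ep nu -> B mu nu = e mu nu.
Proof.
move=> muE nuE; rewrite mutual_pos//; last exact: jordan_finite_pos.
have [nu0 _] := nuE; have [-> ->] := radon_pos_id nu0.
by rewrite [X in _ - X]pos_mutualC /e tensor0l lint0// subr0.
Qed.

Lemma jordan_finiteD rho sigma : F rho -> F sigma -> F (rho + sigma).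
Proof.
move=> [rp rn] [sp sn]; rewrite -(radon_pos_neg rho) -(radon_pos_neg sigma).
by rewrite addrACA -opprD; apply: jordan_finiteB; exact: pos_finite_energyD.
Qed.

Lemma mutualDl r1 r2 sigma : F r1 -> F r2 -> F sigma ->
  B (r1 + r2) sigma = B r1 sigma + B r2 sigma.
Proof.
move=> [p1 n1] [p2 n2] [sp sn].
have H s : Ep s -> half (r1 + r2) s = half r1 s + half r2 s.
  move=> sE; rewrite /half -{1 2}(radon_pos_neg r1) -{1 2}(radon_pos_neg r2).
  rewrite addrACA -opprD jordan_mutual//; [|exact: pos_finite_energyD..].
  by rewrite !pos_mutualDl//; ring.
rewrite !halfE !H//.
generalize (half r1 (radon_pos sigma)) (half r1 (radon_neg sigma)) => x y.
by generalize (half r2 (radon_pos sigma)) (half r2 (radon_neg sigma)) => z t; ring.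
Qed.

Lemma jordan_finiteZ (a : R) rho : F rho -> F (a *: rho).
Proof.
move=> [rp rn]; have [a0|/ltW a0] := leP 0 a.
  rewrite -(radon_pos_neg rho) scalerBr.
  by apply: jordan_finiteB; exact: pos_finite_energyZ.
rewrite -(radon_pos_neg rho) -[a]opprK scaleNr -scalerN opprB scalerBr.
by apply: jordan_finiteB; apply: pos_finite_energyZ => //; rewrite oppr_ge0.
Qed.

Lemma mutualZl (a : R) rho sigma : F rho -> F sigma -> B (a *: rho) sigma = a * B rho sigma.
Proof.
move=> [rp rn] [sp sn].
have H s : Ep s -> half (a *: rho) s = a * half rho s.
  move=> sE; rewrite /half; have [a0|/ltW a0] := leP 0 a.
    rewrite -{1 2}(radon_pos_neg rho) scalerBr jordan_mutual//; [|exact: pos_finite_energyZ..].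
    by rewrite !pos_mutualZl// mulrBr.
  have b0 : 0 <= - a by rewrite oppr_ge0.
  rewrite -{1 2}(radon_pos_neg rho) -[a in LHS]opprK scaleNr -scalerN opprB scalerBr.
  rewrite jordan_mutual//; [|exact: pos_finite_energyZ..].
  by rewrite !pos_mutualZl//; ring.
by rewrite !halfE !H//; ring.
Qed.

Lemma jordan_finiteN rho : F rho -> F (- rho).
Proof. by rewrite -scaleN1r; exact: jordan_finiteZ. Qed.

Lemma jordan_finite_sub rho sigma : F rho -> F sigma -> F (rho - sigma).
Proof. by move=> ? ?; apply: jordan_finiteD => //; exact: jordan_finiteN. Qed.

Lemma mutualBl r1 r2 sigma : F r1 -> F r2 -> F sigma ->
  B (r1 - r2) sigma = B r1 sigma - B r2 sigma.
Proof.
move=> *; rewrite mutualDl//; last exact: jordan_finiteN.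
by rewrite -scaleN1r mutualZl// mulN1r.
Qed.

Lemma jordan_finite0 : F 0.
Proof. exact/jordan_finite_pos/pos_finite_energy0. Qed.

Lemma mutual0l sigma : F sigma -> B 0 sigma = 0.
Proof.
move=> sF; have := mutualZl 0 jordan_finite0 sF.
by rewrite scale0r mul0r.
Qed.

Lemma jordan_finite_sum n (rho : 'I_n -> radon R X) :
  (forall i, F (rho i)) -> F (\sum_(i < n) rho i).
Proof.
move=> H; elim/big_ind : _ => [|r1 r2|//]; first exact: jordan_finite0.
exact: jordan_finiteD.
Qed.

Lemma mutual_suml n (rho : 'I_n -> radon R X) sigma :
  (forall i, F (rho i)) -> F sigma ->
  B (\sum_(i < n) rho i) sigma = \sum_(i < n) B (rho i) sigma.
Proof.
move=> H sF; elim: n rho H => [|n IH] rho H; first by rewrite !big_ord0 mutual0l.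
by rewrite !big_ord_recr/= mutualDl ?IH//; exact: jordan_finite_sum.
Qed.

Let lintk_square_pos rho (p := radon_pos rho) (n := radon_neg rho) : F rho ->
  (lintk (radon_pos (tensor rho rho)) = (e p p + e n n)%:E)%E.
Proof. by move=> [? ?]; rewrite square_pos EFinD !pos_mutualE. Qed.

Let lintk_square_neg rho (p := radon_pos rho) (n := radon_neg rho) : F rho ->
  (lintk (radon_neg (tensor rho rho)) = (e p n + e n p)%:E)%E.
Proof. by move=> [? ?]; rewrite square_neg EFinD !pos_mutualE. Qed.

Lemma energy_mutual rho : F rho -> energy kappa rho = (B rho rho)%:E.
Proof.
move=> rF; rewrite /energy /mutual_energy /sint lintk_square_pos// lintk_square_neg//.
by rewrite -EFinB; congr (_%:E); rewrite /B; ring.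
Qed.

(** A finite difference forces the integral over the positive part of rho (x) rho to be finite, and
    that part is p (x) p + n (x) n. *)
Lemma finite_energyP rho : finite_energy kappa rho <-> F rho.
Proof.
split=> [[_]|rF]; last first.
  split; last by rewrite energy_mutual.
  by rewrite /mutual_energy_defined /sint_defined lintk_square_pos// => -[].
rewrite /energy /mutual_energy /sint => fin.
have : (lintk (radon_pos (tensor rho rho)) < +oo)%E.
  move: fin; case: (lintk (radon_pos _)) => [r||]; rewrite ?ltry//.
  by case: (lintk _).
by rewrite square_pos => /lte_addy[//|//|? ?]; split; split => //; exact: radon_pos_ge0.
Qed.

Lemma mutual_ge0 rho : F rho -> 0 <= B rho rho.
Proof.
move=> rF; rewrite -lee_fin -energy_mutual//.
by have [_] := pdkappa; apply; have /finite_energyP[] := rF.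
Qed.

Lemma mutual_sq_sub rho sigma (t : R) : F rho -> F sigma ->
  B (rho - t *: sigma) (rho - t *: sigma) =
  B rho rho - 2 * t * B rho sigma + t ^+ 2 * B sigma sigma.
Proof.
move=> rF sF; have tF := jordan_finiteZ t sF.
have dF := jordan_finite_sub rF tF.
rewrite mutualBl// ![B _ (rho - _)]mutualC !mutualBl// !mutualZl//.
rewrite ![B _ (t *: _)]mutualC !mutualZl// [B sigma rho]mutualC.
by generalize (B rho rho) (B rho sigma) (B sigma sigma) => x y z; ring.
Qed.

Lemma mutual_cauchy_schwarz rho sigma : F rho -> F sigma ->
  B rho sigma ^+ 2 <= B rho rho * B sigma sigma.
Proof.
move=> rF sF; apply: discriminant_le => [|t]; first exact: mutual_ge0.
rewrite -mutual_sq_sub//; apply: mutual_ge0.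
by apply: jordan_finite_sub => //; exact: jordan_finiteZ.
Qed.

Local Opaque radon_pos radon_neg tensor lint mutual pos_mutual.
Implicit Types (f h chi : Cc R X).

Lemma strong_norm_mutual rho : F rho -> strong_norm kappa rho = Num.sqrt (B rho rho).
Proof. by move=> rF; rewrite /strong_norm energy_mutual. Qed.

Lemma sqr_strong_norm rho : F rho -> strong_norm kappa rho ^+ 2 = B rho rho.
Proof. by move=> rF; rewrite strong_norm_mutual// sqr_sqrtr//; exact: mutual_ge0. Qed.

Lemma strong_norm_ge0 rho : 0 <= strong_norm kappa rho.
Proof. exact: sqrtr_ge0. Qed.

Lemma mutualZZ (a : R) rho : F rho -> B (a *: rho) (a *: rho) = a ^+ 2 * B rho rho.
Proof.
move=> rF; rewrite (mutualZl a rF (jordan_finiteZ a rF)).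
by rewrite [B rho _]mutualC (mutualZl a rF rF) mulrA expr2.
Qed.

Lemma strong_normZ (a : R) rho : F rho -> strong_norm kappa (a *: rho) = `|a| * strong_norm kappa rho.
Proof.
move=> rF; rewrite !strong_norm_mutual//; last exact: jordan_finiteZ.
by rewrite mutualZZ// sqrtrM ?sqr_ge0// sqrtr_sqr.
Qed.

Lemma mutual_sqD rho sigma : F rho -> F sigma ->
  B (rho + sigma) (rho + sigma) = B rho rho + 2 * B rho sigma + B sigma sigma.
Proof.
move=> rF sF; have := mutual_sq_sub (-1) rF sF.
by rewrite scaleN1r opprK => ->; ring.
Qed.

Lemma mutual_le_norm rho sigma : F rho -> F sigma ->
  `|B rho sigma| <= strong_norm kappa rho * strong_norm kappa sigma.
Proof.
move=> rF sF; rewrite -(@ler_pXn2r _ 2)// ?nnegrE ?mulr_ge0 ?strong_norm_ge0//.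
by rewrite exprMn !sqr_strong_norm// real_normK ?num_real//; exact: mutual_cauchy_schwarz.
Qed.

Lemma strong_normD rho sigma : F rho -> F sigma ->
  strong_norm kappa (rho + sigma) <= strong_norm kappa rho + strong_norm kappa sigma.
Proof.
move=> rF sF; rewrite -(@ler_pXn2r _ 2)// ?nnegrE ?addr_ge0 ?strong_norm_ge0//.
rewrite sqr_strong_norm; last exact: jordan_finiteD.
rewrite mutual_sqD// -(sqr_strong_norm rF) -(sqr_strong_norm sF).
by have := le_trans (ler_norm _) (mutual_le_norm rF sF); lra.
Qed.

Lemma strong_norm_sum n (rho : 'I_n -> radon R X) : (forall i, F (rho i)) ->
  strong_norm kappa (\sum_(i < n) rho i) <= \sum_(i < n) strong_norm kappa (rho i).
Proof.
move=> H; elim: n rho H => [|n IH] rho H.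
  by rewrite !big_ord0 strong_norm_mutual ?mutual0l ?sqrtr0//; exact: jordan_finite0.
rewrite !big_ord_recr/= (le_trans (strong_normD _ _))//; first exact: jordan_finite_sum.
by rewrite lerD2r IH.
Qed.

(** A nonzero nu, divided by its mass nu chi, would compete with finite energy in the definition of
    the capacity of N, where the infimum is +oo. *)
Lemma capacity_zero_null (N L : set X) nu : inner_capacity kappa N = 0%E ->
  compact L -> L `<=` N -> carried nu L -> Ep nu -> nu = 0.
Proof.
move=> /eqP; rewrite /inner_capacity inve_eq0 => /eqP capN kL LN cnu nuE.
have [chi [chi1 chi01]] := Cc_cutoff R hX lcX kL.
have nu0 := carried_positive cnu.
have M0 : 0 <= nu chi by apply: nu0 => x; have /andP[] := chi01 x.
have [Meq|Mneq] := eqVneq (nu chi) 0.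
  apply: radon_ext => f f0; rewrite radon0E; apply/eqP; rewrite eq_le nu0// andbT.
  have [_ [c [_ _ fc]]] := Cc_bounded f.
  have -> : 0 = nu (c *: chi) by rewrite radonZ Meq mulr0.
  apply: (carried_le cnu) => x Lx; rewrite CcZE chi1// mulr1.
  exact: le_trans (ler_norm _) (fc x).
have Mpos : 0 < nu chi by rewrite lt_neqAle eq_sym Mneq.
pose nu' := (nu chi)^-1 *: nu.
have cnu' : carried nu' L by move=> f fL; rewrite radonZE mulr_ge0 ?invr_ge0//; exact: cnu.
have nu'E : Ep nu' by apply: pos_finite_energyZ => //; rewrite invr_ge0.
have nu'F := jordan_finite_pos nu'E.
have : (ereal_inf [set energy kappa nu | nu in [set nu | Eplus kappa N nu /\
    lint nu (cst 1%E) = 1%E]] <= energy kappa nu')%E.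
  apply: ereal_inf_lbound; exists nu' => //; split.
    split; last by apply/finite_energyP.
    by apply: carried_Mplus cnu' => //; exact: compact_closed.
  have c1 : continuous ((fun=> 1) : X -> R) by exact: cst_continuous.
  have := lint_carried_cont c1 cnu' _ chi1 chi01.
  rewrite /cst => ->//; congr (_%:E).
  rewrite radonZE (_ : Cc_mul _ _ = chi) ?mulVf//.
  by apply: Cc_ext => x; rewrite Cc_mulE mul1r.
by rewrite capN energy_mutual// leye_eq.
Qed.

Lemma pos_mutual_tonelli mu nu : Ep mu -> Ep nu ->
  lint mu (lpot kappa nu) = (e mu nu)%:E.
Proof. by move=> muE nuE; rewrite -pos_mutualE// tonelli//; [case: muE|case: nuE]. Qed.

(* u - v >= k nearly everywhere integrates, because the exceptional set carries
   no nonzero measure of finite energy. *)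
Lemma nearly_everywhere_integral lam rho (E K : set X) (k : X -> R) (ck : continuous k)
    chi (b : R) :
  Ep lam -> compact K -> K `<=` E -> carried lam K -> F rho -> b != 0 ->
  (forall x, K x -> chi x = 1) ->
  nearly_everywhere kappa E (fun x => potential_defined kappa rho x /\
    (k x)%:E <= b%:E * potential kappa rho x)%E ->
  lam (Cc_mul ck chi) <= b * B lam rho.
Proof.
move=> lamE kK KE clam rF b0 chi1 ne.
have [pE nE] := rF; set p := radon_pos rho in pE *; set n := radon_neg rho in nE *.
have [p0 _] := pE; have [n0 _] := nE.
have lamp := pos_mutual_tonelli lamE pE; have lamn := pos_mutual_tonelli lamE nE.
have Hnull L nu : compact L -> L `<=` [set x | E x /\ ~ (potential_defined kappa rho x /\
    (k x)%:E <= b%:E * potential kappa rho x)%E] -> L `<=` K -> carried nu L ->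
    radon_positive (lam - nu) -> nu = 0.
  move=> kL LN _ cnu lamnu; apply: (capacity_zero_null ne kL LN cnu).
  by apply: pos_finite_energy_le lamE => //; exact: carried_positive cnu.
(* Division by |b| reduces to the factors 1 and -1; for negative b the potentials of the two Jordan
   parts exchange their roles. *)
have ckb : continuous (fun x => `|b|^-1 * k x).
  by move=> x; apply: cvgM; [exact: cvg_cst|exact: ck].
have nb0 : 0 < `|b| by rewrite normr_gt0.
have lamk : lam (Cc_mul ckb chi) = `|b|^-1 * lam (Cc_mul ck chi).
  by rewrite -radonZ; congr (lam _); apply: Cc_ext => x; rewrite CcZE !Cc_mulE mulrA.
have lamn0 : (lint lam (lpot kappa n) < +oo)%E by rewrite lamn ltry.
have lamp0 : (lint lam (lpot kappa p) < +oo)%E by rewrite lamp ltry.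
have lscp : lower_semicontinuous (lpot kappa p) by exact: lpot_lsc.
have lscn : lower_semicontinuous (lpot kappa n) by exact: lpot_lsc.
have minp : minorized (lpot kappa p) by exact: lpot_minorized.
have minn : minorized (lpot kappa n) by exact: lpot_minorized.
have potE x r s : lpot kappa p x = r%:E -> lpot kappa n x = s%:E ->
    potential kappa rho x = (r - s)%:E.
  by rewrite /potential /sint -/p -/n /lpot => -> ->.
rewrite mutual_pos// -/p -/n.
have [bpos|bneg] := ltP 0 b.
  have := carried_null_le hX lcX ckb kK clam lscp minp lamp0 lscn minn lamn0 chi1 _ Hnull.
  rewrite lamp lamn/= lamk gtr0_norm// ler_pdivrMl//; apply.
  move=> x r s Kx pr ns; rewrite ltr_pdivlMl// => lt; split; first exact: KE.
  by move=> [_]; rewrite (potE _ _ _ pr ns) -EFinM lee_fin leNgt lt.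
have {}bneg : b < 0 by rewrite lt_neqAle b0.
have := carried_null_le hX lcX ckb kK clam lscn minn lamn0 lscp minp lamp0 chi1 _ Hnull.
rewrite lamp lamn/= lamk ltr0_norm// ler_pdivrMl ?oppr_gt0//.
have -> : - b * (e lam n - e lam p) = b * (e lam p - e lam n) by ring.
apply=> x r s Kx nr ps; rewrite ltr_pdivlMl ?oppr_gt0// => lt; split; first exact: KE.
move=> [_]; rewrite (potE _ _ _ ps nr) -EFinM lee_fin leNgt => /negP; apply.
by move: lt; rewrite mulNr -mulrN opprB.
Qed.

Lemma carried_eq mu (L : set X) f h : carried mu L -> (forall x, L x -> f x = h x) ->
  mu f = mu h.
Proof.
by move=> c fh; apply/eqP; rewrite eq_le !(carried_le c)// => x Lx; rewrite fh.
Qed.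

(** * Strong approximation by measures with compact carriers and the same g-mass *)

Section compact_approximation.
Variable g : X -> R.
Hypothesis g0 : forall x, 0 < g x.

Let gE := (fun x => (g x)%:E).

Let gmin : minorized gE.
Proof. by apply: minorized_ge0 => x; rewrite lee_fin ltW. Qed.

(* Restrict mu to a compact set K and renormalize. *)
Lemma compact_approx mu (A : set X) (a eta : R) :
  Ep mu -> Mplus A mu -> 0 < a -> lint mu gE = a%:E -> 0 < eta ->
  exists K mu', [/\ compact K, K `<=` A, carried mu' K, Ep mu' &
    lint mu' gE = a%:E /\ B (mu' - mu) (mu' - mu) <= eta].
Proof.
move=> muE muA a0 mug eta0; have [mu0 _] := muE.
have [F0 F0k] := kmin.
have [K0 [c [kK0 F0K Fc]]] := Cc_bounded F0.
have [K1 [K2 [kK1 kK2 KK]]] := compact_proj kK0.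
have [chi [chi1 chi01]] := Cc_cutoff R hX lcX (compactU kK1 kK2).
have chi0 x : 0 <= chi x by have /andP[] := chi01 x.
have muchi0 : 0 <= mu chi by exact: mu0.
have E0 := mutual_ge0 (jordan_finite_pos muE); set E := B mu mu in E0.
(* The bound on the energy of t nu - mu will be 2 (t - 1)^2 |nu|^2 + 2 |sig|^2; inserting |nu|^2 <=
   2 E + 2 |sig|^2 and the bounds on t yields the coefficients 16 E / a and 6. *)
pose C := 16 * E / a + 6 * (2 + `|c| * mu chi) + 1.
have C0 : 0 < C.
  have : 0 <= 16 * E / a by rewrite divr_ge0 ?mulr_ge0// ltW.
  have : 0 <= `|c| * mu chi by rewrite mulr_ge0.
  by rewrite /C; lra.
pose d := Num.min (a / 4) (eta / C).
have d0 : 0 < d by rewrite lt_min !divr_gt0.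
have da : d <= a / 4 by rewrite ge_min lexx.
have dC : C * d <= eta by rewrite mulrC -ler_pdivlMr// ge_min lexx orbT.
have [f0 fu0] : minorized (lpot kappa mu) by exact: lpot_minorized.
have lsu : (lint mu (lpot kappa mu) < +oo)%E by rewrite pos_mutual_tonelli// ltry.
have [f [_ fu fa]] := lint_approx mu0 fu0 lsu d0.
have mugoo : (lint mu gE < +oo)%E by rewrite mug ltry.
have [fg [fg0 fgg fga]] := @lint_approx _ _ mu gE 0 d mu0 (fun x => ltW (g0 x)) mugoo d0.
(* A single test function controls three losses on the discarded part sig: energy with mu, mass
   where the kernel may be negative, and g-mass. *)
pose w := Cc_max f 0 + chi + fg.
have f'0 x : 0 <= Cc_max f 0 x by rewrite Cc_maxE le_max lexx orbT.
have w0 x : 0 <= w x by rewrite /w CcDE CcDE addr_ge0 ?addr_ge0//; exact: fg0.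
have [K [nu [kK KA nuP sigw]]] := Mplus_approx hX muA w0 d0.
have [cnu sig0 _] := nuP; have nu0 := carried_positive cnu.
set sig := mu - nu in sig0 sigw.
have munu : mu = nu + sig by rewrite /sig addrC subrK.
have nuE : Ep nu by exact: pos_finite_energy_le sig0 muE.
have sigE : Ep sig.
  by apply: pos_finite_energy_le muE => //; rewrite munu addrK.
clearbody sig.
have nuF := jordan_finite_pos nuE; have sigF := jordan_finite_pos sigE.
have muF := jordan_finite_pos muE.
have s1 : 0 <= sig (Cc_max f 0) by exact: sig0.
have s2 : 0 <= sig chi by exact: sig0.
have s3 : 0 <= sig fg by apply: sig0 => x; exact: fg0.
move: sigw; rewrite /w !radonD => sigw.
(* This is kappa(sig, mu) - kappa(sig, nu). The first term is small because f is nearly optimal for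
   the potential of mu; the second is bounded below through the minorant F0. *)
have ss : B sig sig <= (2 + `|c| * mu chi) * d.
  have -> : B sig sig = e sig mu - e sig nu.
    have -> : e sig mu = e nu sig + e sig sig by rewrite munu pos_mutualC pos_mutualDl.
    by rewrite [e nu sig]pos_mutualC mutual_pos_pos// addrAC subrr add0r.
  have H1 : e sig mu <= 2 * d.
    have : lint mu (lpot kappa mu) = (lint nu (lpot kappa mu) + lint sig (lpot kappa mu))%E.
      by rewrite -lintD -?munu//; exact: lpot_minorized.
    rewrite !pos_mutual_tonelli// => -[es]; move: fa; rewrite pos_mutual_tonelli// lee_fin.
    have : nu f <= e nu mu by rewrite -lee_fin -pos_mutual_tonelli//; exact: lint_ge.
    have : sig f <= sig (Cc_max f 0).
      by apply: radon_positive_le => // x; rewrite Cc_maxE le_max lexx.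
    have : mu f = nu f + sig f by rewrite munu.
    by lra.
  have H2 : - (`|c| * mu chi * d) <= e sig nu.
    have : ((tensor sig nu F0)%:E <= lint (tensor sig nu) kappa)%E by exact: lint_ge.
    rewrite pos_mutualE// lee_fin; apply: le_trans.
    have T0 : radon_positive (tensor sig nu) by exact: tensor_positive.
    have : tensor sig nu (- `|c| *: Cc_prod chi chi) <= tensor sig nu F0.
      apply: radon_positive_le => // z; rewrite CcZE Cc_prodE mulNr.
      have [Kz|nKz] := pselect (K0 z); last first.
        by rewrite F0K// oppr_le0 !mulr_ge0.
      have [z1 z2] := KK _ Kz; rewrite (chi1 z.1); last by left.
      rewrite (chi1 z.2); last by right.
      rewrite !mulr1 lerNl (le_trans _ (ler_norm c))// (le_trans _ (Fc z))//.
      by rewrite -normrN ler_norm.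
    apply: le_trans; rewrite radonZ tensor_prod mulNr lerN2 -mulrA ler_wpM2l//.
    rewrite mulrC ler_pM//; first exact: nu0.
      by rewrite munu radonDE lerDl.
    by lra.
  lra.
have a'oo : (lint nu gE < +oo)%E.
  have [|] := @lint_part _ _ nu sig gE nu0 sig0 gmin; last by [].
  by rewrite -munu.
have a'fin : lint nu gE \is a fin_num by exact: lint_fin_num.
set a' := fine (lint nu gE).
have a'E : lint nu gE = a'%:E by rewrite fineK.
have a'a : a' <= a.
  rewrite -lee_fin -a'E -mug [in leRHS]munu lintD// leeDl//.
  have -> : (0 = (sig 0)%:E)%E by rewrite radon0.
  by apply: lint_ge => x; rewrite lee_fin; exact: ltW.
have a'ge : a - 2 * d <= a'.
  have : nu fg <= a' by rewrite -lee_fin -a'E lint_ge.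
  have : mu fg = nu fg + sig fg by rewrite munu.
  by move: fga; rewrite mug lee_fin; lra.
have a'0 : 0 < a' by lra.
(* Since d <= a / 4, the mass a' is at least a / 2, whence t - 1 <= 4 d / a <= 1. *)
pose t := a / a'.
have t0 : 0 < t by rewrite divr_gt0.
have t1 : 0 <= t - 1 by rewrite subr_ge0 ler_pdivlMr// mul1r.
have t2 : t - 1 <= 4 * d / a.
  have -> : t - 1 = (a - a') / a' by rewrite /t; field; rewrite gt_eqF.
  rewrite ler_pdivrMr// mulrAC ler_pdivlMr//.
  have : (a - a') * a <= 2 * d * a by rewrite ler_pM2r//; lra.
  have : 4 * d * (a / 2) <= 4 * d * a' by rewrite ler_pM2l ?mulr_gt0//; lra.
  lra.
have t3 : t - 1 <= 1.
  by rewrite (le_trans t2)// ler_pdivrMr// mul1r; lra.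
exists K, (t *: nu); split => //.
- by move=> h hK; rewrite radonZE mulr_ge0 ?cnu// ltW.
- by apply: pos_finite_energyZ => //; exact: ltW.
split; first by rewrite lintZ// a'E -EFinM /t divfK// gt_eqF.
have -> : t *: nu - mu = (t - 1) *: nu - 1 *: sig.
  by rewrite munu scale1r scalerBl scale1r opprD addrA.
have tnF := jordan_finiteZ (t - 1) nuF.
have par x y : F x -> F y -> B (x - 1 *: y) (x - 1 *: y) <= 2 * B x x + 2 * B y y.
  move=> xF yF; rewrite mutual_sq_sub//.
  have := mutual_ge0 (jordan_finiteD xF yF); rewrite mutual_sqD//.
  by generalize (B x x) (B x y) (B y y) => ? ? ?; lra.
have := par _ _ tnF sigF; move=> /le_trans; apply.
have nn : B nu nu <= 2 * E + 2 * B sig sig.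
  have -> : nu = mu - 1 *: sig by rewrite scale1r munu addrK.
  exact: par.
rewrite mutualZZ//.
have ss0 := mutual_ge0 sigF; have nn0 := mutual_ge0 nuF.
have t4 : (t - 1) ^+ 2 <= 4 * d / a.
  by rewrite (le_trans _ t2)// expr2 ler_piMl.
have t5 : (t - 1) ^+ 2 <= 1 by rewrite expr_le1.
have T0 : 0 <= (t - 1) ^+ 2 by rewrite sqr_ge0.
have H1 : (t - 1) ^+ 2 * B nu nu <= 4 * d / a * (2 * E) + 2 * B sig sig.
  apply: (le_trans (ler_wpM2l T0 nn)); rewrite mulrDr lerD//.
    by rewrite ler_wpM2r// mulr_ge0.
  by rewrite ler_piMl// mulr_ge0.
have H2 : 16 * E / a * d + 6 * (2 + `|c| * mu chi) * d + d <= eta.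
  by rewrite -!mulrDl -[X in _ + X]mul1r; move: dC; rewrite /C; lra.
have H3 : 4 * d / a * (2 * E) = 8 * E / a * d by field; rewrite gt_eqF.
have H4 : 16 * E / a * d = 2 * (8 * E / a * d) by field; rewrite gt_eqF.
have d0' := ltW d0; move: H1 H2 ss; rewrite H3 H4.
by generalize (8 * E / a * d) (B sig sig) ((t - 1) ^+ 2 * B nu nu) ((2 + `|c| * mu chi)) => *; lra.
Qed.

End compact_approximation.

(** * Condensers *)

Section condenser_energy.
Context (m p : nat).
Notation I := 'I_(m + p).
Implicit Types (A K : I -> set X) (lam : I -> radon R X) (i : I).

Let plus i : bool := (i < m)%N.

Lemma signed_sumE lam : signed_sum lam =
  \sum_(i < m + p | plus i) lam i - \sum_(i < m + p | ~~ plus i) lam i.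
Proof.
rewrite /signed_sum (bigID plus)/= -sumrN; congr (_ + _); apply: eq_bigr => i.
  by rewrite /alpha /plus => ->; rewrite scale1r.
by rewrite /alpha /plus => /negbTE ->; rewrite scaleN1r.
Qed.

Let part_le (P : pred I) lam i : (forall i, radon_positive (lam i)) -> P i ->
  radon_positive (\sum_(j < m + p | P j) lam j - lam i).
Proof.
move=> lam0 Pi; rewrite (bigD1 i)//= [lam i + _]addrC addrK.
exact: radon_positive_sum.
Qed.

(* The positive and the negative charges sit on disjoint closed sets, so that
   they form the Jordan decomposition of the signed sum. *)
Lemma signed_sum_jordan A lam : condenser A -> M_cond A lam ->
  radon_pos (signed_sum lam) = \sum_(i < m + p | plus i) lam i /\
  radon_neg (signed_sum lam) = \sum_(i < m + p | ~~ plus i) lam i.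
Proof.
move=> [_ dA] lamA; have lam0 i : radon_positive (lam i) by case: (lamA i).
have clam i : carried (lam i) (A i) by exact: Mplus_carried.
apply: radon_posP; [exact: radon_positive_sum|exact: radon_positive_sum|exact: signed_sumE|].
move=> f e f0 e0.
have [S kS fS] := Cc_supp f.
pose Fp := \bigcup_(i in [set i : I | plus i]) closure (A i).
pose Fm := \bigcup_(i in [set i : I | ~~ plus i]) closure (A i).
have cFp : closed Fp.
  by apply: closed_bigcup; [exact: finite_finset|move=> i _; exact: closed_closure].
have cFm : closed Fm.
  by apply: closed_bigcup; [exact: finite_finset|move=> i _; exact: closed_closure].
have kSF : compact (S `&` Fp) by exact: compact_closedI.
have dF : S `&` Fp `<=` ~` Fm.
  move=> x [_ [i /= ip ix]] [j /= jm jx].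
  have : (closure (A i) `&` closure (A j)) x by split.
  by rewrite dA//; rewrite /plus -leqNgt in jm.
(* Multiplication by phi leaves the integral of f over the positive plates unchanged and makes that
   over the negative plates vanish, so the supremum is attained. *)
have [phi [phi1 phi01 phi0]] := Cc_urysohn R hX lcX kSF (closed_openC cFm) dF.
have h0 x : 0 <= Cc_mul (Cc_cont phi) f x <= f x.
  by rewrite Cc_mulE; have /andP[? ?] := phi01 x; rewrite mulr_ge0//= ler_piMl.
exists (Cc_mul (Cc_cont phi) f) => //.
rewrite signed_sumE radonBE.
have sumE (P : pred I) h : (\sum_(i < m + p | P i) lam i) h = \sum_(i < m + p | P i) lam i h.
  elim/big_ind2 : _ => [|m1 r1 m2 r2 <- <-|//]; first exact: radon0E.
  exact: radonDE.
rewrite !sumE [X in _ <= _ - X]big1 ?subr0.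
  rewrite lerBlDr ler_wpDr ?(ltW e0)//; apply: ler_sum => i ip.
  apply: (carried_le (clam i)) => x Ax; rewrite Cc_mulE.
  have [Sx|nSx] := pselect (S x); last by rewrite fS// mulr0.
  rewrite phi1 ?mul1r//; split=> //; exists i => //; exact: subset_closure.
move=> i im; rewrite -(radon0 (lam i)); apply: (carried_eq (clam i)) => x Ax.
rewrite Cc_mulE phi0 ?mul0r//; apply; exists i => //; exact: subset_closure.
Qed.

(** By [signed_sum_jordan] each charge is dominated by a Jordan part of the signed sum, so finite
    energy of the sum passes to the coordinates. *)
Lemma E_cond_pos_finite A lam : condenser A -> E_cond kappa A lam ->
  forall i, Ep (lam i).
Proof.
move=> cA [lamA /finite_energyP[pE nE]] i.
have lam0 j : radon_positive (lam j) by case: (lamA j).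
have [ep en] := signed_sum_jordan cA lamA.
rewrite ep in pE; rewrite en in nE.
have [ip|im] := boolP (plus i).
  by apply: pos_finite_energy_le pE => //; exact: part_le.
by apply: pos_finite_energy_le nE => //; exact: part_le.
Qed.

Lemma signed_sum_finite lam : (forall i, Ep (lam i)) -> F (signed_sum lam).
Proof.
move=> lamE; apply: jordan_finite_sum => i; apply: jordan_finiteZ.
exact: jordan_finite_pos.
Qed.

Lemma mutual_signed_sum lam rho : (forall i, Ep (lam i)) -> F rho ->
  B (signed_sum lam) rho = \sum_(i < m + p) alpha R i * B (lam i) rho.
Proof.
move=> lamE rF; have lamF i : F (lam i) by exact: jordan_finite_pos.
rewrite mutual_suml//; last by move=> i; exact: jordan_finiteZ.
by apply: eq_bigr => i _; rewrite mutualZl.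
Qed.

Lemma signed_sumB lam lam' : signed_sum lam - signed_sum lam' =
  \sum_(i < m + p) alpha R i *: (lam i - lam' i).
Proof. by rewrite /signed_sum -sumrB; apply: eq_bigr => i _; rewrite scalerBr. Qed.

Lemma signed_sumZ (c : R) lam : signed_sum (fun i => c *: lam i) = c *: signed_sum lam.
Proof.
rewrite /signed_sum scaler_sumr; apply: eq_bigr => i _.
by rewrite !scalerA mulrC.
Qed.

Lemma norm_alpha i : `|alpha R i| = 1.
Proof. by rewrite /alpha; case: ifP => _; rewrite ?normrN normr1. Qed.

Lemma alpha_neq0 i : alpha R i != 0.
Proof. by rewrite -normr_gt0 norm_alpha. Qed.

Section normalized.
Variable g : X -> R.
Hypothesis g0 : forall x, 0 < g x.
Variables (a : I -> R).
Hypothesis a0 : forall i, 0 < a i.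
Variable A : I -> set X.
Hypothesis hA : condenser A.

Let gE := (fun x => (g x)%:E).

(* The measures of E(A, a, g) with compact carriers inside A. *)
Definition compactly_carried lam K :=
  [/\ forall i, compact (K i), forall i, K i `<=` A i, forall i, K i !=set0,
      forall i, carried (lam i) (K i) & forall i, Ep (lam i) /\ lint (lam i) gE = (a i)%:E].

Lemma compactly_carried_E_cond lam K : compactly_carried lam K ->
  E_cond_norm kappa K a g lam.
Proof.
move=> [kK _ _ cl lE]; split; last by move=> i; have [] := lE i.
split; first by move=> i; apply: carried_Mplus (cl i) => //; exact: compact_closed.
by apply/finite_energyP; apply: signed_sum_finite => i; have [] := lE i.
Qed.

Lemma compactly_carried_approx lam (e : R) : E_cond_norm kappa A a g lam -> 0 < e ->
  exists K lam', compactly_carried lam' K /\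
   strong_norm kappa (signed_sum lam' - signed_sum lam) <= e.
Proof.
move=> [lamA lamg] e0; have lamE := E_cond_pos_finite hA lamA.
(* The successor makes n positive for every index set; m + p errors of size e / n stay below e. *)
pose n : R := (m + p).+1%:R.
have n0 : 0 < n by rewrite ltr0n.
pose eta := (e / n) ^+ 2.
have eta0 : 0 < eta by rewrite exprn_gt0// divr_gt0.
have H i : exists Kl : set X * radon R X,
    [/\ compact Kl.1, Kl.1 `<=` A i, carried Kl.2 Kl.1, Ep Kl.2 &
    lint Kl.2 gE = (a i)%:E /\ B (Kl.2 - lam i) (Kl.2 - lam i) <= eta].
  have [K [l H]] := compact_approx g0 (lamE i) (lamA.1 i) (a0 i) (lamg i) eta0.
  by exists (K, l).
have [Kl HKl] := choice H.
exists (fun i => (Kl i).1), (fun i => (Kl i).2); split.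
  split; try by move=> i; have [? ? ? ? []] := HKl i.
  (* An empty carrier would force the zero measure, contrary to the mass a_i > 0; condensers must
     have nonempty plates. *)
  move=> i; have [kK _ cK lE [lg _]] := HKl i; apply/set0P/eqP => K0.
  have l0 : (Kl i).2 = 0.
    apply: radon_ext => f f0; rewrite radon0E -(radon0 (Kl i).2).
    by apply: (carried_eq cK) => x; rewrite K0.
  move: lg; rewrite l0 lint0; first by move=> [] /eqP; rewrite eq_sym gt_eqF.
  by apply: minorized_ge0 => x; rewrite lee_fin ltW.
have dF i : F ((Kl i).2 - lam i).
  by apply: jordan_finite_sub; apply: jordan_finite_pos => //; have [] := HKl i.
rewrite signed_sumB (le_trans (strong_norm_sum _))//.
  by move=> i; exact: jordan_finiteZ.
apply: (@le_trans _ _ (\sum_(i < m + p) e / n)).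
  apply: ler_sum => i _; rewrite strong_normZ// norm_alpha mul1r.
  rewrite strong_norm_mutual//; have [_ _ _ _ [_ le]] := HKl i.
  rewrite -[leRHS](@ger0_norm _ (e / n)); last by rewrite divr_ge0// ltW.
  by rewrite -sqrtr_sqr ler_wsqrtr.
rewrite sumr_const card_ord -mulr_natr mulrAC ler_pdivrMr// ler_pM2l// ler_nat.
exact: leqW.
Qed.

End normalized.

End condenser_energy.

(** * The extremal problem *)

Section extremal_problem.
Context (m p : nat).
Notation I := 'I_(m + p).
Implicit Types (K : I -> set X) (lam : I -> radon R X) (i : I).
Variables (g : X -> R) (cg : continuous g).
Hypothesis g0 : forall x, 0 < g x.
Variables (a : I -> R).
Hypothesis a0 : forall i, 0 < a i.
Variable A : I -> set X.
Hypothesis hA : condenser A.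

Let gE := (fun x => (g x)%:E).
Local Notation R_ := signed_sum.

Definition potential_bound rho i (c : R) :=
  nearly_everywhere kappa (A i) (fun x => potential_defined kappa rho x /\
    ((c * g x)%R%:E <= (alpha R i * a i)%R%:E * potential kappa rho x)%E).

(** The factor s is there for the minimizers in the capacitary nets, whose masses are a_i times a
    capacity. *)
Lemma potential_bound_mass rho i c (lam : radon R X) (K : set X) (s : R) :
  potential_bound rho i c -> F rho -> Ep lam -> compact K -> K `<=` A i ->
  carried lam K -> lint lam gE = (a i * s)%:E -> c * s <= alpha R i * B lam rho.
Proof.
move=> ne rF lamE kK KA clam lamg.
have [chi [chi1 chi01]] := Cc_cutoff R hX lcX kK.
have ckg : continuous (fun x => c * g x).
  by move=> x; apply: cvgM; [exact: cvg_cst|exact: cg].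
have b0 : alpha R i * a i != 0 by rewrite mulf_neq0 ?alpha_neq0 ?gt_eqF.
have := nearly_everywhere_integral ckg lamE kK KA clam rF b0 chi1 ne.
have -> : lam (Cc_mul ckg chi) = c * lam (Cc_mul cg chi).
  by rewrite -radonZ; congr (lam _); apply: Cc_ext => x; rewrite CcZE !Cc_mulE mulrA.
have [->] : (lam (Cc_mul cg chi))%:E = (a i * s)%:E.
  by rewrite -lamg -(lint_carried_cont cg clam _ chi1 chi01)// => x; exact: ltW.
rewrite (_ : c * (a i * s) = a i * (c * s)); last by ring.
by rewrite (_ : _ * _ * _ = a i * (alpha R i * B lam rho)) ?ler_pM2l//; ring.
Qed.

Lemma potential_bound_carried rho i c lam K : potential_bound rho i c -> F rho ->
  compactly_carried g a A lam K -> c <= alpha R i * B (lam i) rho.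
Proof.
move=> ne rF [kK KA _ cl lE]; have [lamE lamg] := lE i.
rewrite -[c]mulr1; apply: (potential_bound_mass ne rF lamE (kK i) (KA i) (cl i)).
by rewrite mulr1.
Qed.

Lemma potential_bound_sum rho c lam K : (forall i, potential_bound rho i (c i)) -> F rho ->
  compactly_carried g a A lam K -> \sum_(i < m + p) c i <= B (R_ lam) rho.
Proof.
move=> ne rF lc; rewrite mutual_signed_sum//; last by case: lc => _ _ _ _ lE i; have [] := lE i.
by apply: ler_sum => i _; exact: potential_bound_carried lc.
Qed.

Lemma compactly_carried_finite lam K : compactly_carried g a A lam K -> F (R_ lam).
Proof. by move=> [_ _ _ _ lE]; apply: signed_sum_finite => i; have [] := lE i. Qed.

Lemma E_cond_norm_sub K K' b lam : (forall i, K i `<=` K' i) ->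
  E_cond_norm kappa K b g lam -> E_cond_norm kappa K' b g lam.
Proof.
move=> KK' [[lK lE] lg]; split => //; split => // i; have [l0 lN] := lK i.
split=> // L kL; apply/eqP; rewrite eq_le; apply/andP; split; last first.
  apply: le_ereal_inf_tmp => _ [U _ <-].
  have -> : (0 = (lam i 0)%:E)%E by rewrite radon0.
  by apply: lint_ge => x; rewrite lee_fin.
rewrite -(lN L kL); apply: ereal_inf_le_tmp => _ [U [oU LU] <-].
exists U => //; split => // x [Lx nKx]; apply: LU; split => // /KK'//.
Qed.

Variable V : R.
Hypothesis V0 : 0 < V.
Hypothesis minV : min_energy kappa A a g = (V^-1)%:E.

Lemma min_energy_le lam : E_cond_norm kappa A a g lam -> V^-1 <= B (R_ lam) (R_ lam).
Proof.
move=> lA; have [[_ /finite_energyP lF] _] := lA.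
by rewrite -lee_fin -minV -energy_mutual//; apply: ereal_inf_lbound; exists lam.
Qed.

Lemma near_minimizer (e : R) : 0 < e -> exists K lam,
  compactly_carried g a A lam K /\ B (R_ lam) (R_ lam) <= V^-1 + e.
Proof.
move=> e0; have e20 : 0 < e / 2 by rewrite divr_gt0.
have : (min_energy kappa A a g < (V^-1 + e / 2)%:E)%E by rewrite minV lte_fin ltrDl.
move=> /ereal_inf_lt[_ [l lA <-]].
have [[_ /finite_energyP lF] _] := lA; rewrite energy_mutual// lte_fin => lt.
have N0 := strong_norm_ge0 (R_ l); set N := strong_norm kappa (R_ l) in N0.
(* Chosen so that (N + d)^2 <= N^2 + d (2 N + 1) <= N^2 + e / 2. *)
pose d := Num.min 1 (e / 2 / (2 * N + 1)).
have D0 : 0 < 2 * N + 1 by rewrite ltr_wpDl// mulr_ge0.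
have d0 : 0 < d by rewrite lt_min ltr01 divr_gt0.
have d1 : d <= 1 by rewrite ge_min lexx.
have dN : d * (2 * N + 1) <= e / 2 by rewrite -ler_pdivlMr// ge_min lexx orbT.
have [K [lam [lc dist]]] := compactly_carried_approx g0 a0 hA lA d0.
exists K, lam; split => //; have lamF := compactly_carried_finite lc.
rewrite -sqr_strong_norm//.
have le : strong_norm kappa (R_ lam) <= N + d.
  have -> : R_ lam = (R_ lam - R_ l) + R_ l by rewrite subrK.
  rewrite (le_trans (strong_normD _ _))//; first exact: jordan_finite_sub.
  by rewrite addrC lerD2l.
apply: (@le_trans _ _ ((N + d) ^+ 2)).
  by rewrite ler_pXn2r// ?nnegrE ?strong_norm_ge0// addr_ge0// ltW.
have NN : N ^+ 2 = B (R_ l) (R_ l) by rewrite sqr_strong_norm.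
have dd : d ^+ 2 <= d by rewrite expr2 ler_piMl// ltW.
by rewrite sqrrD NN; lra.
Qed.

(** The carriers of a near minimizer thus belong to the family that every capacitary net eventually
    dominates. Their minimal energy lies between 1 / V and the energy of lam, so the inverse is
    positive. *)
Lemma exhausting_carried K lam : compactly_carried g a A lam K -> exhausting kappa A a g K.
Proof.
move=> lc; have [kK KA K0 _ _] := lc; have lamF := compactly_carried_finite lc.
split => //.
  split=> // i j im jm; rewrite -subset0 => x [xi xj].
  have [_ dA] := hA; rewrite -(dA i j im jm).
  by split; [exact: closureS (KA i) _ xi|exact: closureS (KA j) _ xj].
have lK : E_cond_norm kappa K a g lam by exact: compactly_carried_E_cond lc.
have ub : (min_energy kappa K a g <= (B (R_ lam) (R_ lam))%:E)%E.
  by rewrite -energy_mutual//; apply: ereal_inf_lbound; exists lam.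
have lb : ((V^-1)%:E <= min_energy kappa K a g)%E.
  apply: le_ereal_inf_tmp => _ [l lK' <-].
  have lA := E_cond_norm_sub KA lK'; have [[_ /finite_energyP lF] _] := lA.
  by rewrite energy_mutual// lee_fin min_energy_le.
rewrite /capacity inve_gt0.
- by apply: lt_le_trans lb; rewrite lte_fin invr_gt0.
- by rewrite gt_eqF// (lt_le_trans _ lb)// lte_fin invr_gt0.
- by rewrite lt_eqF// (le_lt_trans ub)// ltry.
Qed.

(** * Consequences of the potential bounds and of the prescribed sum *)

Section solution.
Variables (rho : radon R X) (tau : I -> R).
Hypothesis rhoF : F rho.
Hypothesis tau_bound : forall i, potential_bound rho i (tau i).
Hypothesis tau_sum : \sum_(i < m + p) tau i = (V + B rho rho) / (2 * V).

(** With r = |rho|^2, the Cauchy-Schwarz inequality for rho and near minimizers gives ((V + r) / (2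
    V))^2 <= r / V, which rearranges to (V - r)^2 <= 0. *)
Lemma solution_energy : B rho rho = V.
Proof.
set r := B rho rho; have r0 : 0 <= r by exact: mutual_ge0.
have tr : \sum_(i < m + p) tau i = (V + r) / (2 * V) by [].
have T0 : 0 <= (V + r) / (2 * V).
  by apply: divr_ge0; [apply: addr_ge0 => //|apply: mulr_ge0 => //]; exact: ltW.
have H : ((V + r) / (2 * V)) ^+ 2 <= r / V.
  apply/ler_addgt0Pr => e e0.
  have e'0 : 0 < e / (r + 1) by rewrite divr_gt0// ltr_wpDl.
  have [K [lam [lc le]]] := near_minimizer e'0.
  have lamF := compactly_carried_finite lc.
  have := potential_bound_sum tau_bound rhoF lc; rewrite tr => ge.
  have cs := mutual_cauchy_schwarz lamF rhoF.
  apply: (@le_trans _ _ (B (R_ lam) rho ^+ 2)).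
    by rewrite ler_pXn2r// nnegrE (le_trans T0).
  apply: (le_trans cs); rewrite -/r.
  apply: (le_trans (ler_wpM2r r0 le)); rewrite mulrDl mulrC lerD2l.
  by rewrite mulrAC ler_pdivrMr ?ltr_wpDl// ler_pM2l// lerDl.
have {}H : (V - r) ^+ 2 <= 0.
  have -> : (V - r) ^+ 2 = (4 * V ^+ 2) * (((V + r) / (2 * V)) ^+ 2 - r / V).
    by field; rewrite gt_eqF.
  by rewrite pmulr_rle0 ?subr_le0// mulr_gt0// exprn_gt0.
have : (V - r) ^+ 2 == 0 by rewrite eq_le H sqr_ge0.
by rewrite sqrf_eq0 subr_eq0 => /eqP.
Qed.

Lemma solution_sum : \sum_(i < m + p) tau i = 1.
Proof. by rewrite tau_sum solution_energy; field; rewrite gt_eqF. Qed.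

(** Each term alpha_j kappa(lam^j, rho) is at least tau_j, while their sum is at most 1 + e and the
    tau_j add up to 1; so no term can exceed its tau_j by more than e. *)
Lemma solution_near i (e : R) : 0 < e -> exists K lam,
  compactly_carried g a A lam K /\ alpha R i * B (lam i) rho <= tau i + e.
Proof.
(* From |rho - V lam|^2 >= 0 one has 2 V kappa(lam, rho) <= V + V^2 |lam|^2, and the excess 2 e / V
   makes the right side at most 2 V (1 + e). *)
move=> e0; have e'0 : 0 < 2 * e / V by rewrite divr_gt0// mulr_gt0.
have [K [lam [lc le]]] := near_minimizer e'0; exists K, lam; split => //.
have lamF := compactly_carried_finite lc.
have lamE j : Ep (lam j) by case: lc => _ _ _ _ lE; have [] := lE j.
have := mutual_ge0 (jordan_finite_sub rhoF (jordan_finiteZ V lamF)).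
rewrite mutual_sq_sub// solution_energy [B rho _]mutualC => H.
have VV : V ^+ 2 * B (R_ lam) (R_ lam) <= V + V * (2 * e).
  apply: (le_trans (ler_wpM2l _ le)); first by rewrite sqr_ge0.
  by rewrite le_eqVlt; apply/orP; left; apply/eqP; field; rewrite gt_eqF.
have {H VV} : B (R_ lam) rho <= 1 + e.
  rewrite -(ler_pM2l V0); move: H VV.
  by generalize (V ^+ 2 * B (R_ lam) (R_ lam)) (B (R_ lam) rho) => *; lra.
rewrite mutual_signed_sum//; have := solution_sum.
rewrite (bigD1 i)//= [X in X <= _](bigD1 i)//=.
have : \sum_(j < m + p | j != i) tau j <=
    \sum_(j < m + p | j != i) alpha R j * B (lam j) rho.
  by apply: ler_sum => j _; exact: potential_bound_carried lc.
by lra.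
Qed.

Lemma solution_max i (q : R) : potential_bound rho i q -> q <= tau i.
Proof.
move=> ne; apply/ler_addgt0Pr => e e0.
have [K [lam [lc le]]] := solution_near i e0.
by apply: le_trans le; exact: potential_bound_carried lc.
Qed.

Lemma solution_ne_inf i : (tau i)%:E =
  ne_inf kappa (A i) (potential_defined kappa rho)
    (fun x => (alpha R i * a i)%R%:E * potential kappa rho x / (g x)%:E)%E.
Proof.
have E (q : R) : nearly_everywhere kappa (A i) (fun x => potential_defined kappa rho x /\
    (q%:E <= (alpha R i * a i)%R%:E * potential kappa rho x / (g x)%:E)%E) =
    potential_bound rho i q.
  rewrite /potential_bound; congr (nearly_everywhere _ _ _); apply/funext => x.
  apply/propext; by rewrite EFinM inver gt_eqF// lee_pdivlMr.
apply/eqP; rewrite eq_le; apply/andP; split.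
  by apply: ereal_sup_ubound; exists (tau i) => //; rewrite /= E; exact: tau_bound.
by apply: ge_ereal_sup => _ [q + <-]; rewrite /= E lee_fin; exact: solution_max.
Qed.

(** V lam lies within d of rho in the strong norm, and V kappa(lam, omega) >= V by the bounds of
    omega; the Cauchy-Schwarz inequality carries the latter over to rho with an error of at most d N
    <= e. *)
Lemma Gamma_hat_mutual omega c : Gamma_hat_with kappa A a g omega c ->
  V <= B rho omega.
Proof.
move=> [/finite_energyP oF ne c1].
have alg (x b y : R) : x <= V + y -> V * 1 <= V * b -> V - 2 * V * b + x <= y.
  by move=> ? ?; lra.
apply/ler_addgt0Pr => e e0.
have N0 := strong_norm_ge0 omega; set N := strong_norm kappa omega in N0.
pose d : R := e / (N + 1).
have d0 : 0 < d by rewrite divr_gt0// ltr_wpDl.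
have e'0 : 0 < d ^+ 2 / V ^+ 2 by rewrite divr_gt0// exprn_gt0.
have [K [lam [lc le]]] := near_minimizer e'0.
have lamF := compactly_carried_finite lc; have VlF := jordan_finiteZ V lamF.
have dF := jordan_finite_sub rhoF VlF.
have lr := potential_bound_sum tau_bound rhoF lc; rewrite solution_sum in lr.
have lo := le_trans c1 (potential_bound_sum ne oF lc).
have nd : strong_norm kappa (rho - V *: R_ lam) <= d.
  rewrite -(@ler_pXn2r _ 2)// ?nnegrE ?strong_norm_ge0//; last exact: ltW.
  rewrite sqr_strong_norm// mutual_sq_sub// solution_energy [B rho _]mutualC.
  have VV : V ^+ 2 * B (R_ lam) (R_ lam) <= V + d ^+ 2.
    apply: (le_trans (ler_wpM2l _ le)); first by rewrite sqr_ge0.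
    by rewrite le_eqVlt; apply/orP; left; apply/eqP; field; rewrite gt_eqF.
  by apply: alg => //; rewrite ler_pM2l.
have := mutual_le_norm dF oF; rewrite -/N mutualBl// mutualZl// ler_norml => /andP[+ _].
have : strong_norm kappa (rho - V *: R_ lam) * N <= d * N by rewrite ler_wpM2r.
have : d * N <= e by rewrite /d mulrAC ler_pdivrMr ?ltr_wpDl// ler_pM2l// lerDl.
have : V * 1 <= V * B (R_ lam) omega by rewrite ler_pM2l.
by generalize (strong_norm kappa (rho - V *: R_ lam) * N) => ?; lra.
Qed.

Lemma solution_Gamma_hat_with : Gamma_hat_with kappa A a g rho tau.
Proof. by split; [apply/finite_energyP|exact: tau_bound|rewrite solution_sum]. Qed.

(** V^2 <= kappa(rho, omega)^2 <= V |omega|^2. *)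
Lemma Gamma_hat_energy omega c : Gamma_hat_with kappa A a g omega c -> V <= B omega omega.
Proof.
move=> Go; have := Gamma_hat_mutual Go; have [/finite_energyP oF _ _] := Go => le.
have := mutual_cauchy_schwarz rhoF oF; rewrite solution_energy => cs.
rewrite -(ler_pM2l V0) (le_trans _ cs)// -expr2 ler_pXn2r// nnegrE ltW//.
exact: lt_le_trans le.
Qed.

Lemma solution_minimizer : Gamma_hat_minimizers kappa A a g rho.
Proof.
have Gr := solution_Gamma_hat_with; split; first by exists tau.
apply/eqP; rewrite eq_le; apply/andP; split.
  apply: le_ereal_inf_tmp => _ [omega [c Go] <-].
  have [/finite_energyP oF _ _] := Go.
  by rewrite !energy_mutual// lee_fin solution_energy; exact: Gamma_hat_energy Go.
by apply: ereal_inf_lbound; exists rho => //; exists tau.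
Qed.

Lemma minimizer_constants omega c : Gamma_hat_minimizers kappa A a g omega ->
  Gamma_hat_with kappa A a g omega c -> c = tau.
Proof.
move=> [_ omin] Go; have [/finite_energyP oF ne c1] := Go.
have oV : B omega omega = V.
  apply: EFin_inj; rewrite -energy_mutual// omin -solution_energy -energy_mutual//.
  by have [_ <-] := solution_minimizer.
have dF := jordan_finite_sub oF rhoF.
have d0 : strong_norm kappa (omega - rho) = 0.
  apply/eqP; rewrite -sqrf_eq0 eq_le sqr_ge0 andbT sqr_strong_norm//.
  have -> : omega - rho = omega - 1 *: rho by rewrite scale1r.
  rewrite mutual_sq_sub// oV solution_energy [B omega _]mutualC.
  have := Gamma_hat_mutual Go; lra.
have le i : c i <= tau i.
  apply/ler_addgt0Pr => e e0.
  have [K [lam [lc le]]] := solution_near i e0.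
  apply: le_trans le; apply: (le_trans (potential_bound_carried (ne i) oF lc)).
  have lF : F (lam i) by apply: jordan_finite_pos; case: lc => _ _ _ _ lE; have [] := lE i.
  have := mutual_le_norm dF lF; rewrite d0 mul0r normr_le0 mutualBl// subr_eq0 => /eqP.
  by rewrite ![B _ (lam i)]mutualC => ->.
apply/funext => i; apply/eqP; rewrite eq_le le/=.
have := solution_sum; move: c1; rewrite (bigD1 i)//= [X in X = _ -> _](bigD1 i)//=.
have : \sum_(j < m + p | j != i) c j <= \sum_(j < m + p | j != i) tau j.
  by apply: ler_sum => j _.
by lra.
Qed.

(** The described set contains tau, so that [xget] does not return its default. *)
Lemma solution_constants : inner_capacitary_constants kappa A a g = tau.
Proof.
rewrite /inner_capacitary_constants.
have [omega omin Go] : [set c | exists2 omega, Gamma_hat_minimizers kappa A a g omega &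
    Gamma_hat_with kappa A a g omega c]
    (xget (fun=> 0) [set c | exists2 omega, Gamma_hat_minimizers kappa A a g omega &
    Gamma_hat_with kappa A a g omega c]).
  apply: xgetPex; exists tau, rho; [exact: solution_minimizer|].
  exact: solution_Gamma_hat_with.
exact: minimizer_constants Go.
Qed.

(** With c the capacity of K', the scaled near minimizer c lam competes with lam', so |lam'|^2 <=
    c^2 (1 / V + e), and the bounds tau give kappa(lam', rho) >= c. Hence |lam' - rho|^2 <= (V -
    c)^2 / V + c^2 e. Here V - c <= V^2 e, and e <= 1 / V makes the quadratic term at most V^2 e. *)
Lemma exhausting_near K lam (e : R) (K' : I -> set X) (lam' : I -> radon R X) :
  0 < e -> e <= V^-1 ->
  compactly_carried g a A lam K -> B (R_ lam) (R_ lam) <= V^-1 + e ->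
  exhausting kappa A a g K' -> (forall i, K i `<=` K' i) ->
  minimizers kappa K' (fun i => a i * fine (capacity kappa K' a g)) g lam' ->
  F (R_ lam') /\ B (R_ lam' - rho) (R_ lam' - rho) <= 2 * V ^+ 2 * e.
Proof.
move=> e0 eV lc le [cK' kK' K'A _] KK' [lam'K' lam'min].
have lamF := compactly_carried_finite lc.
have lK : E_cond_norm kappa K a g lam by exact: compactly_carried_E_cond lc.
have ub : (min_energy kappa K' a g <= (V^-1 + e)%:E)%E.
  apply: (@le_trans _ _ (energy kappa (R_ lam))).
    by apply: ereal_inf_lbound; exists lam => //; exact: E_cond_norm_sub lK.
  by rewrite energy_mutual// lee_fin.
have lb : ((V^-1)%:E <= min_energy kappa K' a g)%E.
  apply: le_ereal_inf_tmp => _ [l lK' <-].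
  have lA := E_cond_norm_sub K'A lK'; have [[_ /finite_energyP lF] _] := lA.
  by rewrite energy_mutual// lee_fin min_energy_le.
move: lam'K' lam'min; rewrite /capacity.
move: lb ub; case: (min_energy kappa K' a g) => [w||]//; rewrite !lee_fin => lb ub.
have iV0 : 0 < V^-1 by rewrite invr_gt0.
have w0 : 0 < w by exact: lt_le_trans lb.
rewrite inver gt_eqF//=; set c := w^-1 => lam'K' lam'min.
have c0 : 0 < c by rewrite invr_gt0.
have cV : c <= V by rewrite /c -[V]invrK lef_pV2.
have Vc : V - c <= V ^+ 2 * e.
  have -> : V - c = V * c * (w - V^-1) by rewrite /c; field; rewrite !gt_eqF.
  apply: (@le_trans _ _ (V * c * e)); first by apply: ler_wpM2l; [apply: mulr_ge0; exact: ltW|lra].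
  by rewrite expr2 ler_pM2r// ler_pM2l.
have [[lam'M /finite_energyP lam'F] lam'g] := lam'K'; split=> //.
have lam'E : forall i, Ep (lam' i) by apply: (E_cond_pos_finite cK'); case: lam'K'.
have ener : B (R_ lam') (R_ lam') <= c ^+ 2 * (V^-1 + e).
  rewrite -lee_fin -energy_mutual// lam'min.
  apply: (@le_trans _ _ (energy kappa (R_ (fun i => c *: lam i)))).
    apply: ereal_inf_lbound; exists (fun i => c *: lam i) => //.
    have [_ _ _ cl lE] := lc; have [[lM _] lg] := E_cond_norm_sub KK' lK.
    split; last first.
      by move=> i; rewrite lintZ// lg -EFinM mulrC.
    split; last by rewrite /= signed_sumZ; apply/finite_energyP; exact: jordan_finiteZ.
    move=> i; have [kK KA _ _ _] := lc; apply: (@carried_Mplus _ _ _ (K i)).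
    - exact: compact_closed.
    - exact: KK'.
    - by move=> f fK; rewrite radonZE; apply: mulr_ge0; [exact: ltW|exact: cl].
  rewrite signed_sumZ energy_mutual; last exact: jordan_finiteZ.
  by rewrite mutualZZ// lee_fin ler_wpM2l// sqr_ge0.
have mut : c <= B (R_ lam') rho.
  rewrite mutual_signed_sum// -[c]mul1r -solution_sum mulr_suml; apply: ler_sum => i _.
  apply: (potential_bound_mass (tau_bound i) rhoF (lam'E i) (kK' i) (K'A i)) => //.
  exact: Mplus_carried.
have -> : R_ lam' - rho = R_ lam' - 1 *: rho by rewrite scale1r.
rewrite mutual_sq_sub// solution_energy.
have H1 : c ^+ 2 * (V^-1 + e) <= V^-1 * c ^+ 2 + V ^+ 2 * e.
  by rewrite mulrDr mulrC lerD2l ler_pM2r// ler_pXn2r// nnegrE ltW.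
have H2 : V^-1 * c ^+ 2 + V - 2 * c = V^-1 * (V - c) ^+ 2.
  by field; rewrite gt_eqF.
have H3 : V^-1 * (V - c) ^+ 2 <= V ^+ 2 * e.
  apply: (@le_trans _ _ (V^-1 * (V ^+ 2 * e) ^+ 2)).
    by rewrite ler_pM2l// ler_pXn2r// nnegrE ?subr_ge0// mulr_ge0 ?sqr_ge0// ltW.
  have -> : V^-1 * (V ^+ 2 * e) ^+ 2 = (V ^+ 2 * e) * (V * e).
    by field; rewrite gt_eqF.
  apply: ler_piMr; first by apply: mulr_ge0; [exact: sqr_ge0|exact: ltW].
  by rewrite -(mulfV (lt0r_neq0 V0)) ler_pM2l.
rewrite -[2 * V ^+ 2 * e]mulrA; move: ener H1 H2 H3 mut.
generalize (c ^+ 2 * (V^-1 + e)) (V^-1 * c ^+ 2) (V^-1 * (V - c) ^+ 2) (B (R_ lam') rho).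
generalize (B (R_ lam') (R_ lam')) (V ^+ 2 * e) => *; lra.
Qed.

(** The measures rho and gamma are strong limits of the same net of minimizers. *)
Lemma solution_equiv (nu gamma : I -> radon R X) : R_ nu = rho ->
  inner_capacitary_distributions kappa A a g gamma -> cond_equiv kappa nu gamma.
Proof.
move=> nuE [[_ /finite_energyP gF] [S [K [l [exK Kcof lmin _ lim]]]]].
rewrite /cond_equiv /cond_dist nuE; apply/eqP; rewrite eq_le strong_norm_ge0 andbT.
apply/ler_addgt0Pr => d d0; rewrite add0r.
have d20 : 0 < d / 2 by rewrite divr_gt0.
pose e := Num.min V^-1 ((d / 2) ^+ 2 / (2 * V ^+ 2)).
have V20 : 0 < 2 * V ^+ 2 by rewrite mulr_gt0// exprn_gt0.
have e0 : 0 < e by rewrite lt_min invr_gt0 V0 divr_gt0// exprn_gt0.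
have eV : e <= V^-1 by rewrite ge_min lexx.
have ed : 2 * V ^+ 2 * e <= (d / 2) ^+ 2 by rewrite mulrC -ler_pdivlMr// ge_min lexx orbT.
have [K0 [lam [lc le]]] := near_minimizer e0.
have [s0 Hs0] := Kcof _ (exhausting_carried lc).
have [s1 Hs1] := lim _ (nbhsx_ballx (0 : R) (d / 2) d20).
have [s [ss0 ss1]] := dle_upper s0 s1.
have [lF near] := exhausting_near e0 eV lc le (exK s) (Hs0 _ ss0) (lmin s).
have := Hs1 _ ss1; rewrite /= /ball/= sub0r normrN ger0_norm; last exact: strong_norm_ge0.
rewrite /cond_dist => close.
have close' : strong_norm kappa (rho - R_ (l s)) <= d / 2.
  have dF := jordan_finite_sub lF rhoF.
  rewrite -opprB -scaleN1r strong_normZ// normrN normr1 mul1r.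
  rewrite -(@ler_pXn2r _ 2)// ?nnegrE ?strong_norm_ge0//; last exact: ltW.
  by rewrite sqr_strong_norm// (le_trans near).
have -> : rho - R_ gamma = (rho - R_ (l s)) + (R_ (l s) - R_ gamma).
  by rewrite addrA subrK.
apply: (le_trans (strong_normD _ _)); [exact: jordan_finite_sub|exact: jordan_finite_sub|].
by rewrite (splitr d) lerD// ltW.
Qed.

End solution.

End extremal_problem.

End energy_form.

Local Open Scope ereal_scope.

Theorem proposition2 (R : realType) (X : topologicalType)
  (hX : hausdorff_space X) (lcX : locally_compact [set: X])
  (kappa : X * X -> \bar R)
  (hkappa : potential_kernel kappa) (pdkappa : positive_definite kappa)
  (ckappa : consistent kappa)
  (m p : nat) (hm : (1 <= m)%N)
  (g : X -> R) (cg : continuous g) (g0 : forall x, (0 < g x)%R)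
  (a : 'I_(m + p) -> R) (a0 : forall i, (0 < a i)%R)
  (A : 'I_(m + p) -> set X) (hA : condenser A)
  (capA0 : 0 < capacity kappa A a g) (capAoo : capacity kappa A a g < +oo)
  (hyp : p = 0%N \/
     (0 < ereal_inf [set (g x)%:E | x in cond_all A] /\
      ereal_sup [set kappa (x, y) | x in cond_plus A & y in cond_minus A] < +oo))
  (nu : 'I_(m + p) -> radon R X) (hnu : E_cond kappa (cond_closure A) nu)
  (tau : 'I_(m + p) -> R)
  (htau : forall i, nearly_everywhere kappa (A i) (fun x =>
     potential_defined kappa (signed_sum nu) x /\
     (tau i * g x)%R%:E <= (alpha R i * a i)%R%:E * potential kappa (signed_sum nu) x))
  (hsum : (\sum_(i < m + p) tau i)%R%:E =
     (capacity kappa A a g + energy kappa (signed_sum nu)) /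
       (2%:E * capacity kappa A a g)) :
  (forall gamma, inner_capacitary_distributions kappa A a g gamma ->
     cond_equiv kappa nu gamma) /\
  (forall i, tau i = inner_capacitary_constants kappa A a g i /\
     (inner_capacitary_constants kappa A a g i)%:E =
       ne_inf kappa (A i) (potential_defined kappa (signed_sum nu))
         (fun x => (alpha R i * a i)%R%:E * potential kappa (signed_sum nu) x
                   / (g x)%:E)).
Proof.
have [V [V0 capV minV]] : exists V : R, [/\ (0 < V)%R, capacity kappa A a g = V%:E &
    min_energy kappa A a g = (V^-1)%R%:E].
  (* An infimum 0 would make the capacity +oo, and an infimum +oo would make it 0. *)
  move: capA0 capAoo; rewrite /capacity; case: (min_energy kappa A a g) => [w||]; [|by rewrite invey ltxx|by []].
  rewrite inver; case: eqP => [//|/eqP w0]; rewrite lte_fin => V0 _.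
  by exists w^-1%R; rewrite invrK.
have [_ /(finite_energyP hX lcX hkappa pdkappa) rhoF] := hnu.
have V20 : (2 * V)%R != 0%R by rewrite mulf_neq0// gt_eqF.
have tau_sum : (\sum_(i < m + p) tau i = (V + mutual kappa (signed_sum nu) (signed_sum nu)) / (2 * V))%R.
  apply: EFin_inj; rewrite hsum capV (energy_mutual hX lcX hkappa pdkappa)//.
  by rewrite -EFinD -EFinM inver (negbTE V20) -EFinM.
split=> [gamma|i].
  by apply: (solution_equiv hX lcX hkappa pdkappa cg g0 a0 hA V0 minV rhoF htau tau_sum).
rewrite (solution_constants hX lcX hkappa pdkappa cg g0 a0 hA V0 minV rhoF htau tau_sum).
split=> //.
exact: (solution_ne_inf hX lcX hkappa pdkappa cg g0 a0 hA V0 minV rhoF htau tau_sum).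
Qed.
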